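(* Assume the setting of Lemma 4.3: $\Theta\subseteq\mathbb{R}^d$, functions $f_\theta\colon[0,\infty)\times\mathbb{N}_0\to[0,\infty)$, $\theta_0\in\Theta$, constants $\delta>0$, $C<\infty$, $\kappa_1,\kappa_2\ge0$ with $\kappa_1+\kappa_2<1$ such that for all $\theta'\in\Theta$ with $\|\theta'-\theta_0\|\le\delta$: $|f_{\theta'}(\lambda,y)-f_{\theta_0}(\lambda,y)|\le C\|\theta'-\theta_0\|(\lambda+y+1)$ and $|f_{\theta'}(\lambda,y)-f_{\theta'}(\tilde\lambda,\tilde y)|\le\kappa_1|\lambda-\tilde\lambda|+\kappa_2|y-\tilde y|$ for all $\lambda,\tilde\lambda\ge0$, $y,\tilde y\in\mathbb{N}_0$; a strictly stationary process $((N_t,\lambda_t))_{t\in\mathbb{Z}}$ with $N_t\mid\sigma(\lambda_s,N_s:s\le t-1)\sim\mathrm{Poisson}(\lambda_t)$ and $\lambda_t=f_{\theta_0}(\lambda_{t-1},N_{t-1})$; estimators $\widehat\theta_n-\theta_0=O_P(n^{-1/2})$; an arbitrary a.s. finite $\widehat\lambda_1\ge0$ and $\widehat\lambda_t=f_{\widehat\theta_n}(\widehat\lambda_{t-1},N_{t-1})$, $t=2,\dots,n$. Assume moreover $f_{\theta_0}(0,0)>0$. Let $\widehat T_n=n^{-1/2}\sum_{t=1}^n\{(N_t-\widehat\lambda_t)^2-N_t\}$. Then $$\Big((2/n)\sum_{t=1}^n\widehat\lambda_t^2\Big)^{-1/2}\widehat T_n\xrightarrow{d}\mathcal{N}(0,1),$$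 and consequently, for $\alpha\in(0,1)$, $u_\alpha=\Phi^{-1}(1-\alpha)$, and the test $\varphi_n=I\big(((2/n)\sum_{t=1}^n\widehat\lambda_t^2)^{-1/2}\widehat T_n>u_\alpha\big)$, we have $P(\varphi_n=1)\to\alpha$ as $n\to\infty$.
   Context: $\Phi$ is the standard normal distribution function and $I(\cdot)$ the indicator function. *)

(* Defs.v *)
From HB Require Import structures.
From mathcomp Require Import all_boot all_order all_algebra.
From mathcomp Require Import all_classical all_reals all_analysis.
Set Implicit Arguments. Unset Strict Implicit. Unset Printing Implicit Defensive.
Import Order.TTheory GRing.Theory Num.Theory.
Import numFieldNormedType.Exports.
Local Open Scope classical_set_scope.
Local Open Scope ring_scope.

Definition eucl {R : realType} {dim : nat} (v : 'rV[R]_dim) : R :=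
  Num.sqrt (\sum_(i < dim) (v ord0 i) ^+ 2).

(* Poisson probability mass function (correct also for rate 0). *)
Definition pois_pmf {R : realType} (l : R) (k : nat) : R :=
  expR (- l) * l ^+ k / (k`!)%:R.

Definition Phi {R : realType} (x : R) : R :=
  fine (normal_prob 0 1 `]-oo, x]).

Definition past_sigma {d} {T : measurableType d} {R : realType}
  (N : int -> T -> nat) (lam : int -> T -> R) (t : int) : set (set T) :=
  <<s [set A | exists s : int, (s <= t)%R /\
        ((exists B : set nat, A = N s @^-1` B) \/
         (exists B : set R, measurable B /\ A = lam s @^-1` B))] >>.

(* Strict stationarity of ((N_t, lambda_t))_t: all finite-dimensional
   distributions are shift invariant (checked on measurable rectangles,
   which determine the finite-dimensional laws). *)
Definition strictly_stationary {d} {T : measurableType d} {R : realType}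
  (P : probability T R) (N : int -> T -> nat) (lam : int -> T -> R) : Prop :=
  forall (n : nat) (ts : 'I_n -> int) (A : 'I_n -> set nat)
         (B : 'I_n -> set R) (h : int),
    (forall i, measurable (B i)) ->
    P (\bigcap_(i in [set: 'I_n]) (N (ts i + h) @^-1` A i `&` lam (ts i + h) @^-1` B i))
    = P (\bigcap_(i in [set: 'I_n]) (N (ts i) @^-1` A i `&` lam (ts i) @^-1` B i)).

Definition cond_poisson {d} {T : measurableType d} {R : realType}
  (P : probability T R) (N : int -> T -> nat) (lam : int -> T -> R) : Prop :=
  forall (t : int) (k : nat) (E : set T), past_sigma N lam (t - 1) E ->
    P (E `&` N t @^-1` [set k]) =
    (\int[P]_(w in E) (pois_pmf (lam t w) k)%:E)%E.

(* Plug-in intensities: lamhat_rec th l1 N m = \hat\lambda_{m+1}, i.e.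
   \hat\lambda_1 = l1 and \hat\lambda_{t} = f_th(\hat\lambda_{t-1}, N_{t-1}). *)
Fixpoint lamhat_rec {R : realType} {dim : nat}
  (f : 'rV[R]_dim -> R -> nat -> R) (th : 'rV[R]_dim) (l1 : R)
  (Nw : int -> nat) (m : nat) : R :=
  match m with
  | 0 => l1
  | m'.+1 => f th (lamhat_rec f th l1 Nw m') (Nw (m'.+1)%:Z)
  end.

Definition lamhat {d} {T : measurableType d} {R : realType} {dim : nat}
  (f : 'rV[R]_dim -> R -> nat -> R) (thhat : nat -> T -> 'rV[R]_dim)
  (l1 : T -> R) (N : int -> T -> nat) (n t : nat) (w : T) : R :=
  lamhat_rec f (thhat n w) (l1 w) (fun s => N s w) t.-1.

Definition That {d} {T : measurableType d} {R : realType} {dim : nat}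
  (f : 'rV[R]_dim -> R -> nat -> R) (thhat : nat -> T -> 'rV[R]_dim)
  (l1 : T -> R) (N : int -> T -> nat) (n : nat) (w : T) : R :=
  (Num.sqrt (n%:R))^-1 * \sum_(1 <= t < n.+1)
     (((N t%:Z w)%:R - lamhat f thhat l1 N n t w) ^+ 2 - (N t%:Z w)%:R).

Definition Stat {d} {T : measurableType d} {R : realType} {dim : nat}
  (f : 'rV[R]_dim -> R -> nat -> R) (thhat : nat -> T -> 'rV[R]_dim)
  (l1 : T -> R) (N : int -> T -> nat) (n : nat) (w : T) : R :=
  (Num.sqrt (2 / n%:R * \sum_(1 <= t < n.+1) (lamhat f thhat l1 N n t w) ^+ 2))^-1
  * That f thhat l1 N n w.

Definition test {d} {T : measurableType d} {R : realType} {dim : nat}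
  (f : 'rV[R]_dim -> R -> nat -> R) (thhat : nat -> T -> 'rV[R]_dim)
  (l1 : T -> R) (N : int -> T -> nat) (u : R) (n : nat) (w : T) : R :=
  if Stat f thhat l1 N n w > u then 1 else 0.

Definition root_n_tight {d} {T : measurableType d} {R : realType} {dim : nat}
  (P : probability T R) (thhat : nat -> T -> 'rV[R]_dim) (th0 : 'rV[R]_dim) : Prop :=
  forall eps : R, 0 < eps -> exists M : R, exists n0 : nat, forall n : nat,
    (n0 <= n)%N ->
    (P [set w | (Num.sqrt (n%:R) * eucl (thhat n w - th0) > M)%R] <= eps%:E)%E.

(* Main.v *)
(** With [eps_t = N_t - lambda_t], the statistic is the sum of
    [n^{-1/2} \sum ((N_t - lambda_t)^2 - N_t)], of
    [n^{-1/2} \sum (lambdahat_t - lambda_t)^2] and of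
    [- 2 n^{-1/2} \sum eps_t (lambdahat_t - lambda_t)].

    The first sum has martingale difference summands with conditional variance
    [2 lambda_t^2].  The contraction property gives the law of large numbers for
    the [lambda_t^2] through a Poisson equation.  The central limit theorem then
    follows by telescoping [E Phi ((a - S_k) / sqrt (v - V_k))], where [S_k] are
    the partial sums and [V_k] the accumulated conditional variances: since
    [Phi ((a - x) / sqrt v)] solves a heat equation, each step changes this
    expectation only by a third order term.

    The second sum is negligible because
    [|lambdahat_t - lambda_t| <= kappa1^{t-1} D + |thetahat - theta0| W_t] with
    [W_t] bounded in mean square.

    The cross sum is not a martingale, as [lambdahat_t] depends on the whole
    sample through [thetahat].  But both recursions forget their past
    exponentially fast, so that up to a small error [lambdahat_t - lambda_t] is a
    function of [lambda_{t-k}] and of the last [k] counts.  These data are cut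
    into about [sqrt n] cells.  On each cell the function is almost constant and
    of size [n^{-1/2}], and for a fixed cell the sum of the [eps_t] falling into
    it is a martingale that does not involve [thetahat].  The second moments of
    all these sums add up to [O(n)], so by Cauchy-Schwarz the sum of their
    absolute values is [O(n^{3/4})]. *)

Require Import Defs.
From HB Require Import structures.
From mathcomp Require Import all_boot all_order all_algebra.
From mathcomp Require Import all_classical all_reals all_analysis measurable_realfun.
From mathcomp Require Import ring lra zify.
Set Implicit Arguments. Unset Strict Implicit. Unset Printing Implicit Defensive.
Import Order.TTheory GRing.Theory Num.Theory.
Import numFieldNormedType.Exports.
Local Open Scope classical_set_scope.
Local Open Scope ring_scope.

(** * Gaussian estimates *)

(** Only second moments of the intensities are available, and even these are extracted from
    stationarity and contraction. Taylor remainders are therefore kept as minima of a lower and a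
    higher order term, the former giving integrability and the latter smallness: Lindeberg's
    condition rather than Lyapunov's. As [Phi ((a - x) / sqrt v)] is singular at [v = 0], the
    telescoping runs with an additional variance [eps^2], a Gaussian smoothing that a sandwich
    removes at the end; increments are switched off when the accumulated variance becomes too large.

    Conditioning is done without an operator: an increment is a function of the current count with
    past-measurable coefficients, and its conditional mean is a pointwise Poisson series.

    The plug-in error is bounded at a fixed sample point, for every map near the true one, by a
    variable that does not depend on this map; this admits an estimator that looks at the whole
    sample. The mesh of the cells is a small multiple of [n^{-1/2}]: rounding then costs little in
    total, and there are still few enough cells for Cauchy-Schwarz. *)

Section calculus.
Context {R : realType}.
Implicit Types (F G H : R -> R) (x y z h K : R).

(** Covers both orders of [x] and [y]. That [z] lies between them is recorded because [z] later
    serves as a Poisson rate and has to be nonnegative. *)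
Lemma MVT_all F G x y : (forall z, is_derive z (1:R) F (G z)) ->
  exists z, [/\ F y - F x = G z * (y - x), `|z - x| <= `|y - x|
    & Num.min x y <= z <= Num.max x y].
Proof.
move=> dF; have cF u v : {within `[u, v], continuous F}.
  apply: derivable_within_continuous => z _; exact: (@ex_derive _ _ _ _ _ _ _ (dF z)).
case: (ltgtP x y) => xy.
- have [z zxy ->] := MVT xy (fun z _ => dF z) (cF _ _).
  move: zxy; rewrite in_itv/= => /andP[xz zy]; exists z; split => //.
    by rewrite !gtr0_norm ?subr_gt0// lerB// ltW.
  by rewrite !ltW.
- have [z zxy E] := MVT xy (fun z _ => dF z) (cF _ _).
  move: zxy; rewrite in_itv/= => /andP[xz zy]; exists z; split => //.
  + by apply: oppr_inj; rewrite opprB E -mulrN opprB.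
  + by rewrite !ltr0_norm ?subr_lt0// lerN2 lerB// ltW.
  + by rewrite !ltW.
- by exists x; rewrite xy !subrr mulr0 normr0 !lexx.
Qed.

Lemma lipschitz_of_derive F G K : (forall z, is_derive z (1:R) F (G z)) ->
  (forall z, `|G z| <= K) -> forall x y, `|F y - F x| <= K * `|y - x|.
Proof.
move=> dF GK x y; have [z [-> _ _]] := MVT_all x y dF.
by rewrite normrM ler_wpM2r.
Qed.

Lemma taylor1_bound F G K x : (forall z, is_derive z (1:R) F (G z)) ->
  (forall z, `|G z - G x| <= K * `|z - x|) ->
  forall h, `|F (x + h) - F x - h * G x| <= K * h ^+ 2.
Proof.
move=> dF GK h; have [z [-> zx _]] := MVT_all x (x + h) dF.
move: zx; rewrite (addrC x) addrK => zx.
rewrite (mulrC h) -mulrBl normrM -[h ^+ 2]real_normK ?num_real// expr2 mulrA.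
rewrite ler_wpM2r// (le_trans (GK z))// ler_wpM2l//.
(* The bound at [x + 1] forces [0 <= K]. *)
have := GK (x + 1); rewrite (addrC x) addrK normr1 mulr1; exact: le_trans.
Qed.

Lemma taylor2_bound F G H K x : (forall z, is_derive z (1:R) F (G z)) ->
  (forall z, is_derive z (1:R) G (H z)) ->
  (forall z, `|H z - H x| <= K * `|z - x|) ->
  forall h, `|F (x + h) - F x - h * G x - h ^+ 2 / 2 * H x| <= K * `|h| ^+ 3.
Proof.
move=> dF dG HK h.
(* Subtracting the quadratic part turns the derivative into the first order Taylor remainder of [G],
   to which [taylor1_bound] applies. *)
pose F1 z := F z - z * G x - (z - x) ^+ 2 / 2 * H x.
have dF1 z : is_derive z (1:R) F1 (G z - G x - (z - x) * H x).
  rewrite /F1; apply: is_derive_eq.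
  by rewrite /GRing.scale/=; field.
have [z [E zx _]] := MVT_all x (x + h) dF1.
have -> : F (x + h) - F x - h * G x - h ^+ 2 / 2 * H x = F1 (x + h) - F1 x.
  by rewrite /F1; field.
rewrite E normrM [x + h]addrC addrK exprSr mulrA ler_wpM2r//.
have := taylor1_bound dG HK (z - x); rewrite (addrC x) subrK => /le_trans; apply.
have K0 : 0 <= K.
  have := HK (x + 1); rewrite (addrC x) addrK normr1 mulr1; exact: le_trans.
rewrite ler_wpM2l// -[_ ^+ 2]real_normK ?num_real// lerXn2r ?nnegrE//.
by move: zx; rewrite (addrC x) addrK.
Qed.

End calculus.

Section gaussian.
Context {R : realType}.
Implicit Types (x y z v h : R).

Local Notation phi := (@normal_pdf R 0 1).

Lemma phiE x : phi x = normal_peak 1 * expR (- (x ^+ 2 / 2)).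
Proof. by rewrite normal_pdfE ?oner_neq0// /normal_fun subr0 expr1n mulNr. Qed.

Lemma is_derive_Phi x : is_derive x (1:R) Phi (phi x).
Proof.
have xu : x < x + 1 by rewrite ltrDl.
have ci : lebesgue_measure.-integrable `]-oo, x + 1] (EFin \o phi).
  by apply: integrableS (integrable_normal_pdf 0 1).
have [//||] := @continuous_FTC1 R phi -oo%O x (x + 1) xu ci.
- exact: ltNyr.
- by apply: continuous_normal_pdf; rewrite oner_neq0.
rewrite derive1E => ? <-.
exact: derivableP.
Qed.

Lemma is_derive_phi x : is_derive x (1:R) phi (- (x * phi x)).
Proof.
rewrite (_ : phi = fun x => normal_peak 1 * expR (- (x ^+ 2 / 2))); last first.
  by apply/funext => y; rewrite phiE.
apply: is_derive_eq.
by rewrite /GRing.scale/= -!/(GRing.exp _ _); field.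
Qed.

Lemma phi_ge0 x : 0 <= phi x.
Proof. exact: normal_pdf_ge0. Qed.

(** With [t = x^2 / 2] one has [expR t >= (1 + t / 2)^2], and [16 (1 + t / 2)^2 = (4 + x^2)^2]
    dominates [|x|^k] for [k <= 4]; the normalizing factor is at most 1. The constants 16 and 32 of
    the next lemmas come from this crude bound. *)
Lemma phi_moment_le k x : (k <= 4)%N -> `|x| ^+ k * phi x <= 16.
Proof.
move=> k4; rewrite phiE.
have peak1 : normal_peak 1 <= 1 :> R.
  rewrite /normal_peak expr1n invf_le1; last first.
    by rewrite sqrtr_gt0 mulrn_wgt0// mul1r pi_gt0.
  rewrite -[leLHS]sqrtr1 ler_sqrt; last by rewrite mulrn_wge0// mul1r pi_ge0.
  have := @pi_ge2 R; rewrite mul1r mulr2n; lra.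
set t := x ^+ 2 / 2.
have t0 : 0 <= t by rewrite divr_ge0// sqr_ge0.
have e0 : (1 + t / 2) ^+ 2 <= expR t.
  have := @expR_ge1Dx R (t / 2) => le1.
  rewrite [in leRHS](splitr t) expRD -expr2 lerXn2r// nnegrE ?expR_ge0//.
  by rewrite addr_ge0// divr_ge0.
rewrite expRN mulrA ler_pdivrMr ?expR_gt0//.
have xk : `|x| ^+ k <= 16 * (1 + t / 2) ^+ 2.
  have -> : t = `|x| ^+ 2 / 2 by rewrite /t real_normK ?num_real.
  have [x1|x1] := lerP `|x| 1.
    apply: (@le_trans _ _ 1); first by rewrite exprn_ile1.
    have ? : 0 <= `|x| ^+ 2 by rewrite exprn_ge0.
    nra.
  apply: (@le_trans _ _ (`|x| ^+ 4)); first by rewrite ler_weXn2l// ltW.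
  have := normr_ge0 x; nra.
apply: (@le_trans _ _ (`|x| ^+ k * 1)).
  by rewrite ler_wpM2l// exprn_ge0.
by rewrite mulr1 (le_trans xk)// ler_wpM2l.
Qed.

Lemma phi_le x : phi x <= 16.
Proof. by have := @phi_moment_le 0 x isT; rewrite expr0 mul1r. Qed.

Lemma xphi_le x : `|x * phi x| <= 16.
Proof.
by have := @phi_moment_le 1 x isT; rewrite expr1 normrM (ger0_norm (phi_ge0 _)).
Qed.

Lemma x3phi_le x : `|x ^+ 3 * phi x| <= 16.
Proof.
by have := @phi_moment_le 3 x isT; rewrite normrM normrX (ger0_norm (phi_ge0 _)).
Qed.

Lemma is_derive_xphi x :
  is_derive x (1:R) (fun z => z * phi z) ((1 - x ^+ 2) * phi x).
Proof.
have dphi := is_derive_phi x.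
by apply: is_derive_eq; rewrite /GRing.scale/=; ring.
Qed.

Lemma xphi_lip x z : `|z * phi z - x * phi x| <= 32 * `|z - x|.
Proof.
apply: (lipschitz_of_derive is_derive_xphi) => {x z} x.
have := @phi_moment_le 2 x isT; rewrite real_normK ?num_real// => h2.
have := phi_le x; have := phi_ge0 x; have := sqr_ge0 x => h1 h0 h3.
have : 0 <= x ^+ 2 * phi x by rewrite mulr_ge0.
by rewrite ler_norml mulrBl mul1r => h4; apply/andP; split; lra.
Qed.

(** As the second derivative of [Phi] is [- y * phi y], the left side is a second order Taylor
    remainder. The cubic bound serves for small [h]; the quadratic one keeps the remainder
    integrable when [h] has only two moments. *)
Lemma Phi_taylor2 y h :
  `|Phi (y + h) - Phi y - h * phi y + h ^+ 2 / 2 * (y * phi y)|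
  <= 32 * Num.min (h ^+ 2) (`|h| ^+ 3).
Proof.
have [e1 e2] : `|Phi (y + h) - Phi y - h * phi y| <= 16 * h ^+ 2 /\
    `|Phi (y + h) - Phi y - h * phi y - h ^+ 2 / 2 * - (y * phi y)|
      <= 32 * `|h| ^+ 3.
  split.
    apply: (taylor1_bound is_derive_Phi) => z.
    apply: (lipschitz_of_derive is_derive_phi) => x; rewrite normrN; exact: xphi_le.
  apply: (taylor2_bound is_derive_Phi is_derive_phi) => z.
  by rewrite -opprD normrN xphi_lip.
rewrite (_ : h ^+ 2 / 2 * (y * phi y) = - (h ^+ 2 / 2 * - (y * phi y))); last first.
  by rewrite mulrN opprK.
have [_|_] := leP (h ^+ 2); last exact: e2.
rewrite (le_trans (ler_normB _ _))//.
have : `|h ^+ 2 / 2 * - (y * phi y)| <= 8 * h ^+ 2.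
  rewrite normrM normrN ger0_norm ?divr_ge0 ?sqr_ge0//.
  have := xphi_le y; have := sqr_ge0 h; nra.
have := sqr_ge0 h; lra.
Qed.

Lemma Phi_ge0 x : 0 <= Phi x.
Proof. by rewrite /Phi fine_ge0. Qed.

Lemma Phi_le1 x : Phi x <= 1.
Proof.
rewrite /Phi -lee_fin fineK ?fin_num_measure//.
exact: (@probability_le1 _ _ _ (normal_prob 0 1)).
Qed.

Lemma Phi_lipschitz x y : `|Phi y - Phi x| <= 16 * `|y - x|.
Proof.
apply: (lipschitz_of_derive is_derive_Phi) => z.
by rewrite (ger0_norm (phi_ge0 _)) phi_le.
Qed.

Lemma Phi_tails (e : R) : 0 < e -> exists2 B : R, 0 < B &
  forall x, (B <= x -> 1 - e <= Phi x) /\ (x <= - B -> Phi x <= e).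
Proof.
move=> e0; pose P := @normal_prob R 0 1.
pose I (k : nat) := `[- k%:R, k%:R]%classic : set R.
have mI k : measurable (I k) by rewrite /I; exact: measurable_itv.
have : P (I k) @[k --> \oo] --> P (\bigcup_k I k).
  apply: nondecreasing_cvg_mu => //=.
  - by apply: bigcup_measurable => k _; exact: mI.
  - move=> m n mn; apply/subsetPset; apply: subset_itv.
      by rewrite bnd_simp lerN2 ler_nat.
    by rewrite bnd_simp ler_nat.
have -> : \bigcup_k I k = setT.
  apply/seteqP; split => // x _; exists (Num.truncn `|x|).+1 => //=.
  by rewrite /I/= in_itv/= -ler_norml ltW// archimedean.Num.Theory.truncnS_gt.
have -> : P setT = 1%E by exact: (@probability_setT _ _ _ (normal_prob 0 1)).
move=> /fine_cvgP[_] /cvgr_dist_le /(_ _ e0)[n _ /(_ n (leqnn n))] /=.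
rewrite ler_norml => /andP[_ h].
have h1 : 1 - e <= fine (P (I n)) by lra.
(* With [n.+1] in place of [n], the half-line up to [- n.+1] is disjoint from [[-n, n]]. *)
exists n.+1%:R => // x; split => xn.
  apply: (le_trans h1); rewrite /Phi fine_le ?fin_num_measure//; try exact: mI.
  apply: (@le_measure _ _ _ (normal_prob 0 1)); rewrite ?inE//; try exact: mI.
  by apply: subset_itv => //; rewrite bnd_simp (le_trans _ xn)// ler_nat.
have : (P `]-oo, x]%classic + P (I n) <= 1)%E.
  have dis : `]-oo, x]%classic `&` I n = set0.
    apply/seteqP; split => // z [] /=; rewrite /I/= !in_itv/= => zx /andP[nz _].
    by have := le_trans nz (le_trans zx xn); rewrite lerN2 ler_nat ltnn.
  rewrite -(measureU (normal_prob 0 1) _ (mI n) dis)//.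
  by apply: (@probability_le1 _ _ _ (normal_prob 0 1)); apply: measurableU => //; exact: mI.
rewrite -[P (I n)]fineK ?fin_num_measure//; try exact: mI.
rewrite -[P _]fineK ?fin_num_measure// -EFinD lee_fin -/(Phi x).
by lra.
Qed.

End gaussian.

Section heat.
Context {R : realType}.
Implicit Types (a b x y z v h lo : R).
Local Notation phi := (@normal_pdf R 0 1).

(* [Phi ((a - x) / sqrt v)] solves the backward heat equation
   [d/dv = 1/2 d^2/dx^2]; the second order terms of the next two lemmas
   therefore cancel. *)
Lemma heat_space a lo : 0 < lo -> exists2 K : R, 0 < K & forall v x z, lo <= v ->
  let y := (a - x) / Num.sqrt v in
  `|Phi ((a - (x + z)) / Num.sqrt v) - Phi y + z * (phi y / Num.sqrt v)
    + z ^+ 2 * ((y * phi y) / (2 * v))| <= K * Num.min (z ^+ 2) (`|z| ^+ 3).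
Proof.
move=> lo0; pose c := (Num.sqrt lo)^-1.
have c0 : 0 < c by rewrite invr_gt0 sqrtr_gt0.
(* Rescaling by [1 / sqrt v <= c] costs [c^2] in the quadratic and [c^3] in the cubic bound;
   [(1 + c)^3] dominates both, whether or not [c] exceeds 1. *)
exists (32 * (1 + c) ^+ 3); first by rewrite mulr_gt0// exprn_gt0// addr_gt0.
move=> v x z lov /=; set y := (a - x) / Num.sqrt v; have v0 : 0 < v by apply: lt_le_trans lov.
pose s := Num.sqrt v; have s0 : 0 < s by rewrite sqrtr_gt0.
have sv : v = s ^+ 2 by rewrite sqr_sqrtr// ltW.
have -> : (a - (x + z)) / Num.sqrt v = y + - z / s.
  by rewrite /y -/s; field; rewrite gt_eqF.
have -> : z * (phi y / Num.sqrt v) = - (- z / s * phi y).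
  by rewrite -/s; field; rewrite gt_eqF.
have -> : z ^+ 2 * (y * phi y / (2 * v)) = (- z / s) ^+ 2 / 2 * (y * phi y).
  by rewrite sv; field; rewrite gt_eqF.
rewrite (le_trans (Phi_taylor2 _ _))// -mulrA ler_wpM2l//.
have sc : s^-1 <= 1 + c.
  apply: (@le_trans _ _ c); last by rewrite lerDr.
  by rewrite lef_pV2 ?posrE ?sqrtr_gt0// ler_sqrt// ltW.
have c1 : 1 <= 1 + c by rewrite lerDl ltW.
have si0 : 0 <= s^-1 by rewrite invr_ge0 ltW.
have z3 : `|- z / s| ^+ 3 <= (1 + c) ^+ 3 * `|z| ^+ 3.
  rewrite normrM normrN (ger0_norm si0) exprMn mulrC ler_wpM2r ?exprn_ge0//.
  by rewrite lerXn2r// ?nnegrE// (le_trans _ c1).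
have z2 : (- z / s) ^+ 2 <= (1 + c) ^+ 3 * z ^+ 2.
  rewrite exprMn sqrrN mulrC ler_wpM2r ?sqr_ge0//.
  apply: (@le_trans _ _ ((1 + c) ^+ 2)); last by rewrite ler_weXn2l.
  by rewrite lerXn2r// ?nnegrE// (le_trans _ c1).
by have [_|_] := leP (z ^+ 2); rewrite ge_min ?z2 ?z3 ?orbT.
Qed.

Lemma is_derive_heat_time b v : 0 < v ->
  is_derive v (1:R) (fun v => Phi (b / Num.sqrt v))
    (- (b / Num.sqrt v * phi (b / Num.sqrt v)) / (2 * v)).
Proof.
move=> v0; have dP := is_derive_Phi (b / Num.sqrt v).
have ds := is_derive1_sqrt v0.
have s0 : Num.sqrt v != 0 by rewrite gt_eqF ?sqrtr_gt0.
have di : is_derive v (1:R) (fun v => (Num.sqrt v)^-1) _ := is_deriveV s0 ds.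
have db : is_derive v (1:R) (fun v => b / Num.sqrt v) _ := is_deriveZ b di.
have dd := @is_derive1_comp _ Phi (fun v => b / Num.sqrt v) _ _ _ dP db.
refine (@is_derive_eq _ _ _ _ _ _ _ _ dd _).
rewrite /GRing.scale/= -[in X in _ = _ / (2 * X)](sqr_sqrtr (ltW v0)).
by field.
Qed.

Lemma is_derive_heat_time2 b v : 0 < v ->
  let y := b / Num.sqrt v in
  is_derive v (1:R) (fun v => - (b / Num.sqrt v * phi (b / Num.sqrt v)) / (2 * v))
    ((3 * (y * phi y) - y ^+ 3 * phi y) / (4 * v ^+ 2)).
Proof.
move=> v0 y; have dP := is_derive_xphi y.
have ds := is_derive1_sqrt v0.
have s0 : Num.sqrt v != 0 by rewrite gt_eqF ?sqrtr_gt0.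
have di : is_derive v (1:R) (fun v => (Num.sqrt v)^-1) _ := is_deriveV s0 ds.
have db : is_derive v (1:R) (fun v => b / Num.sqrt v) _ := is_deriveZ b di.
have dd := @is_derive1_comp _ (fun z => z * phi z) (fun v => b / Num.sqrt v) _ _ _ dP db.
have vn0 : 2 * v != 0 by rewrite mulf_neq0// gt_eqF.
have dv : is_derive v (1:R) (fun v => 2 * v) _ := is_deriveZ 2 (is_derive_id v 1).
have dvi : is_derive v (1:R) (fun v => (2 * v)^-1) _ := is_deriveV vn0 dv.
have := is_deriveM (is_deriveN dd) dvi => H.
refine (@is_derive_eq _ _ _ _ _ _ _ _ H _).
rewrite /GRing.scale/= /y opprfctE /=.
move: s0 (sqr_sqrtr (ltW v0)); move: (Num.sqrt v) => s s0 <-.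
by field.
Qed.

Lemma heat_time lo : 0 < lo -> exists2 K : R, 0 < K & forall b v h, lo <= v -> 0 <= h ->
  let y := b / Num.sqrt v in
  `|Phi (b / Num.sqrt (v + h)) - Phi y| <= K * h /\
  `|Phi (b / Num.sqrt (v + h)) - Phi y + h * ((y * phi y) / (2 * v))|
    <= K * Num.min h (h ^+ 2).
Proof.
move=> lo0; pose c := lo^-1.
have c0 : 0 < c by rewrite invr_gt0.
(* [8 c] bounds the first derivative in [v] and [16 c^2] the second; each of the two summands of the
   constant serves one entry of the minimum. *)
exists (16 * (c + c ^+ 2)); first by rewrite mulr_gt0// addr_gt0// exprn_gt0.
move=> b v h lov h0 /=; set y := b / Num.sqrt v.
pose F v := Phi (b / Num.sqrt v).
pose G v := - (b / Num.sqrt v * phi (b / Num.sqrt v)) / (2 * v).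
pose H v := let y := b / Num.sqrt v in
  (3 * (y * phi y) - y ^+ 3 * phi y) / (4 * v ^+ 2).
have pos z : lo <= z -> 0 < z by exact: lt_le_trans.
have dF z : lo <= z -> is_derive z (1:R) F (G z) by move=> /pos; exact: is_derive_heat_time.
have dG z : lo <= z -> is_derive z (1:R) G (H z) by move=> /pos; exact: is_derive_heat_time2.
have ci z : lo <= z -> z^-1 <= c by move=> zlo; rewrite lef_pV2 ?posrE// pos.
have GK z : lo <= z -> `|G z| <= 8 * c.
  move=> zlo; rewrite /G normrM normrN.
  have := xphi_le (b / Num.sqrt z); set q := `|_| => hq.
  have z2 : 0 <= (2 * z)^-1 by rewrite invr_ge0 mulr_ge0// ltW// pos.
  rewrite (ger0_norm z2) invfM.
  have zi : 0 <= z^-1 by rewrite invr_ge0 ltW// pos.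
  rewrite (_ : 8 * c = 16 * (2^-1 * c)); last by field.
  apply: ler_pM => //; [exact: normr_ge0|exact: mulr_ge0|].
  by rewrite ler_wpM2l// ci.
have HK z : lo <= z -> `|H z| <= 16 * c ^+ 2.
  move=> zlo; rewrite /H/=; set y0 := b / _; rewrite normrM.
  have h1 : `|3 * (y0 * phi y0) - y0 ^+ 3 * phi y0| <= 64.
    rewrite (le_trans (ler_normB _ _))// normrM (@ger0_norm _ 3)//.
    have := xphi_le y0; have := x3phi_le y0; lra.
  have z4 : 0 <= (4 * z ^+ 2)^-1 by rewrite invr_ge0 mulr_ge0// sqr_ge0.
  rewrite (ger0_norm z4).
  rewrite invfM (_ : 16 * c ^+ 2 = 64 * (4^-1 * c ^+ 2)); last by field.
  have zi : 0 <= z^-1 by rewrite invr_ge0 ltW// pos.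
  apply: ler_pM => //; first by rewrite -invfM.
  by rewrite ler_wpM2l// -exprVn lerXn2r ?nnegrE ?ci//; rewrite ltW.
have cont (f g : R -> R) u w : lo <= u -> (forall z, lo <= z -> is_derive z (1:R) f (g z)) ->
    {within `[u, w], continuous f}.
  move=> lou df; apply: derivable_within_continuous => z; rewrite in_itv/= => /andP[uz _].
  exact: (@ex_derive _ _ _ _ _ _ _ (df z (le_trans lou uz))).
have vvh : v <= v + h by rewrite lerDl.
have [z zv E] : exists2 z, z \in `[v, v + h]%R & F (v + h) - F v = G z * (v + h - v).
  apply: MVT_segment => // [z|]; last exact: cont lov dF.
  by rewrite in_itv/= => /andP[vz _]; apply: dF; rewrite (le_trans lov)// ltW.
move: zv; rewrite in_itv/= => /andP[vz zvh].
have [z' z'v E'] : exists2 z', z' \in `[v, z]%R & G z - G v = H z' * (z - v).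
  apply: MVT_segment => // [z'|]; last exact: cont lov dG.
  by rewrite in_itv/= => /andP[vz' _]; apply: dG; rewrite (le_trans lov)// ltW.
move: z'v; rewrite in_itv/= => /andP[vz' z'z].
have EF : F (v + h) - F v = h * G z by rewrite E (addrC v) addrK mulrC.
have E2 : h * (y * phi y / (2 * v)) = - (h * G v).
  by rewrite /G mulNr mulrN opprK.
rewrite -/(F (v + h)) -/(F v) E2 EF.
have b1 : `|h * G z| <= 8 * c * h.
  by rewrite normrM ger0_norm// mulrC ler_wpM2r// GK// (le_trans lov).
split; first by apply: (le_trans b1); rewrite ler_wpM2r//; have := exprn_gt0 2 c0; lra.
have [_|_] := leP h.
  rewrite (le_trans (ler_normB _ _))//.
  have : `|h * G v| <= 8 * c * h by rewrite normrM ger0_norm// mulrC ler_wpM2r// GK.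
  have := exprn_gt0 2 c0; nra.
rewrite -mulrBr E' normrM (ger0_norm h0) normrM (@ger0_norm _ (z - v)) ?subr_ge0//.
have h1 : `|H z'| * (z - v) <= 16 * c ^+ 2 * h.
  apply: ler_pM => //; rewrite ?subr_ge0 ?HK ?(le_trans lov)//.
  by rewrite lerBlDl.
rewrite (_ : 16 * (c + c ^+ 2) * h ^+ 2 = h * (16 * (c + c ^+ 2) * h)); last by ring.
rewrite ler_wpM2l// (le_trans h1)// ler_wpM2r//.
by rewrite ler_wpM2l// lerDr ltW.
Qed.

End heat.

(** * Poisson sums *)

Section poisson_sums.
Context {R : realType}.
Implicit Types (l s : R) (h g : nat -> R).

(** The mean of [h] under the Poisson law of rate [l]. Stated as a relation, it carries the
    convergence of the series along, so that moment identities need no separate summability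
    argument. *)
Definition psum l h s := series (fun k => pois_pmf l k * h k) @ \oo --> s.

Lemma pois_pmf_ge0 l k : 0 <= l -> 0 <= pois_pmf l k.
Proof. by move=> l0; rewrite /pois_pmf divr_ge0// mulr_ge0 ?expR_ge0// exprn_ge0. Qed.

Lemma psum_unique l h s s' : psum l h s -> psum l h s' -> s = s'.
Proof. by move=> /cvg_lim <-// /cvg_lim <-. Qed.

Lemma eq_psum l h g s : (forall k, h k = g k) -> psum l h s -> psum l g s.
Proof. by move=> /funext ->. Qed.

Lemma psumD l h g s s' : psum l h s -> psum l g s' ->
  psum l (fun k => h k + g k) (s + s').
Proof.
move=> hs gs; rewrite /psum.
rewrite (_ : (fun k => _) = (fun k => pois_pmf l k * h k) + (fun k => pois_pmf l k * g k)).
  by rewrite seriesD; exact: cvgD.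
by apply/funext => k; rewrite mulrDr.
Qed.

Lemma psumZ (c : R) l h s : psum l h s -> psum l (fun k => c * h k) (c * s).
Proof.
move=> hs; rewrite /psum.
rewrite (_ : (fun k => _) = c *: (fun k => pois_pmf l k * h k)).
  by rewrite seriesZ; apply: cvgZr.
by apply/funext => k; rewrite mulrCA.
Qed.

Lemma psumB l h g s s' : psum l h s -> psum l g s' ->
  psum l (fun k => h k - g k) (s - s').
Proof.
move=> hs /(@psumZ (-1) _ _ _) gs; rewrite -[- s']mulN1r.
by apply: eq_psum (psumD hs gs) => k; rewrite mulN1r.
Qed.

Lemma psum1 l : psum l (fun=> 1) 1.
Proof.
rewrite /psum -[X in _ --> X](_ : expR (- l) * expR l = 1); last first.
  by rewrite -expRD addNr expR0.
rewrite (_ : (fun k => _) = expR (- l) *: exp_coeff l).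
  by rewrite seriesZ; apply: cvgZr; exact: is_cvg_series_exp_coeff.
by apply/funext => k; rewrite /pois_pmf mulr1 -[RHS]/(_ * (_ / _)) mulrA.
Qed.

Lemma psum_cst (c : R) l : psum l (fun=> c) c.
Proof. by rewrite -[c in psum _ _ c]mulr1; apply: eq_psum (@psumZ c _ _ _ (@psum1 l)) => k; rewrite mulr1. Qed.

Lemma psum_le l h g s s' : 0 <= l -> (forall k, h k <= g k) ->
  psum l h s -> psum l g s' -> s <= s'.
Proof.
move=> l0 hg hs gs; rewrite -(cvg_lim _ hs)// -(cvg_lim _ gs)//.
apply: lim_series_le; [exact: (cvgP _ hs)|exact: (cvgP _ gs)|].
by move=> k; rewrite ler_wpM2l// pois_pmf_ge0.
Qed.

Lemma psum_dominated l h g s : 0 <= l -> (forall k, `|h k| <= g k) ->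
  psum l g s -> exists s', psum l h s'.
Proof.
move=> l0 hg gs; exists (limn (series (fun k => pois_pmf l k * h k))).
apply: normed_cvg.
apply: (@series_le_cvg _ _ (fun k => pois_pmf l k * g k)) => [//=|k|k/=|].
- by rewrite mulr_ge0 ?pois_pmf_ge0// (le_trans _ (hg k)).
- by rewrite normrM ger0_norm ?pois_pmf_ge0// ler_wpM2l// pois_pmf_ge0.
- exact: cvgP gs.
Qed.

(** The Stein-Chen identity [E (N h (N - 1)) = l E h (N)], from [k / k! = 1 / (k - 1)!]. Iterated
    from the constant 1 it yields the factorial moments. The convention [0.-1 = 0] is harmless
    because of the factor [k]. *)
Lemma psum_shift l h s : psum l h s -> psum l (fun k => k%:R * h k.-1) (l * s).
Proof.
move=> hs; rewrite /psum -cvg_shiftS/=.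
rewrite (_ : (fun _ => _) = l *: series (fun k => pois_pmf l k * h k)).
  exact: cvgZr.
apply/funext => n; rewrite /series/= big_nat_recl// mul0r mulr0 add0r.
rewrite -[RHS]/(l * _) mulr_sumr; apply: eq_bigr => k _.
rewrite /pois_pmf /= factS natrM exprS; field.
by rewrite nat1r !pnatr_eq0 -lt0n fact_gt0.
Qed.

Lemma natr_pred k : k%:R * (k.-1)%:R = k%:R * (k%:R - 1) :> R.
Proof. by case: k => [|k]; [rewrite !mul0r|rewrite /= -(natr1 k) addrK]. Qed.

Lemma psum_id l : psum l (fun k => k%:R) l.
Proof. by rewrite -[l in psum _ _ l]mulr1; apply: eq_psum (psum_shift (@psum1 l)) => k; rewrite mulr1. Qed.

Lemma psum_fact2 l : psum l (fun k => k%:R * (k%:R - 1)) (l ^+ 2).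
Proof. by rewrite expr2; apply: eq_psum (psum_shift (@psum_id l)) => k; rewrite natr_pred. Qed.

Lemma psum_fact3 l : psum l (fun k => k%:R * (k%:R - 1) * (k%:R - 2)) (l ^+ 3).
Proof.
rewrite exprS; apply: eq_psum (psum_shift (@psum_fact2 l)) => -[|k]; first by rewrite !mul0r.
by rewrite /= -natr1; ring.
Qed.

Lemma psum_fact4 l :
  psum l (fun k => k%:R * (k%:R - 1) * (k%:R - 2) * (k%:R - 3)) (l ^+ 4).
Proof.
rewrite exprS; apply: eq_psum (psum_shift (@psum_fact3 l)) => -[|k]; first by rewrite !mul0r.
by rewrite /= -natr1; ring.
Qed.

(** The falling factorial of order [j] has Poisson mean [l^j], so a quartic polynomial is averaged
    by reading off its coefficients in this basis. *)
Lemma psum_poly l a0 a1 a2 a3 a4 h :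
  (forall k, h k = a0 + a1 * k%:R + a2 * (k%:R * (k%:R - 1))
     + a3 * (k%:R * (k%:R - 1) * (k%:R - 2))
     + a4 * (k%:R * (k%:R - 1) * (k%:R - 2) * (k%:R - 3))) ->
  psum l h (a0 + a1 * l + a2 * l ^+ 2 + a3 * l ^+ 3 + a4 * l ^+ 4).
Proof.
move=> hE.
have s1 := psumD (@psum_cst a0 l) (@psumZ a1 _ _ _ (@psum_id l)).
have s2 := psumD s1 (@psumZ a2 _ _ _ (@psum_fact2 l)).
have s3 := psumD s2 (@psumZ a3 _ _ _ (@psum_fact3 l)).
by apply: eq_psum (psumD s3 (@psumZ a4 _ _ _ (@psum_fact4 l))) => k; rewrite hE.
Qed.

Lemma psum_center l : psum l (fun k => k%:R - l) 0.
Proof. by rewrite -(subrr l); apply: psumB (@psum_id l) (@psum_cst l l). Qed.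

Lemma psum_sqr l : psum l (fun k => k%:R ^+ 2) (l + l ^+ 2).
Proof.
have := @psum_poly l 0 1 1 0 0 (fun k => k%:R ^+ 2).
rewrite add0r !mul1r !mul0r !addr0; apply => k; ring.
Qed.

Lemma psum_variance l : psum l (fun k => (k%:R - l) ^+ 2) l.
Proof.
have := @psum_poly l (l ^+ 2) (1 - 2 * l) 1 0 0 (fun k => (k%:R - l) ^+ 2).
rewrite (_ : l ^+ 2 + _ + _ + _ + _ = l); last by ring.
by apply => k; ring.
Qed.

(** Expanded, [k (k - 1) - 2 l k + l^2]: the monic Charlier polynomial of degree two, which explains
    its mean 0 and its variance [2 l^2]. *)
Definition pearson l (k : nat) : R := (k%:R - l) ^+ 2 - k%:R.

Lemma psum_pearson l : psum l (pearson l) 0.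
Proof. by rewrite -(subrr l); exact: psumB (@psum_variance l) (@psum_id l). Qed.

Lemma psum_pearson2 l : psum l (fun k => pearson l k ^+ 2) (2 * l ^+ 2).
Proof.
have := @psum_poly l (l ^+ 4) (4 * l ^+ 2 - 4 * l ^+ 3) (2 + 6 * l ^+ 2 - 8 * l)
  (4 - 4 * l) 1 (fun k => pearson l k ^+ 2).
rewrite (_ : l ^+ 4 + _ + _ + _ + _ = 2 * l ^+ 2); last by ring.
by apply => k; rewrite /pearson; ring.
Qed.

Definition poisE h l := limn (series (fun k => pois_pmf l k * h k)).

Section bounded.
Variables (B : R) (h : nat -> R).
Hypothesis hB : forall k, `|h k| <= B.

Lemma psum_poisE l : 0 <= l -> psum l h (poisE h l).
Proof.
move=> l0; have [s hs] := psum_dominated l0 hB (@psum_cst B l).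
by rewrite /poisE (cvg_lim _ hs).
Qed.

Lemma is_cvg_bounded_exp_series x :
  cvgn (pseries (fun k => h k / k`!%:R) x).
Proof.
apply: normed_cvg.
apply: (@series_le_cvg _ _ (B *: exp_coeff `|x|)) => [//=|k|k/=|].
- by apply: mulr_ge0; [exact: le_trans (hB 0)|exact: exp_coeff_ge0].
- rewrite normrM normrM normfV normrX normr_nat -mulrA -[leRHS]/(_ * (_ / _)).
  by apply: ler_pM => //; rewrite mulrC.
- by apply: is_cvg_seriesZ; exact: is_cvg_series_exp_coeff.
Qed.

(** Pulling out [expR (- l)] leaves a power series in [l], which can be differentiated term by term
    on the whole line. *)
Lemma poisE_pseries l :
  poisE h l = expR (- l) * limn (pseries (fun k => h k / k`!%:R) l).
Proof.
rewrite /poisE -[RHS]/(_ *: _) -lim_seriesZ; last exact: is_cvg_bounded_exp_series.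
congr (limn (series _)); apply/funext => k.
rewrite /pois_pmf -[RHS]/(expR (- l) * (h k / k`!%:R * l ^+ k)); ring.
Qed.

End bounded.

(** Differentiating the power series shifts [h] by one, and the factor [expR (- x)] contributes
    [- h]. *)
Lemma is_derive_poisE (B : R) h (x : R) : (forall k, `|h k| <= B) ->
  is_derive x (1:R) (poisE h) (poisE (fun k => h k.+1 - h k) x).
Proof.
move=> hB; pose c k := h k / k`!%:R.
have diffs (g : nat -> R) : pseries_diffs (fun k => g k / k`!%:R) = fun k => g k.+1 / k`!%:R.
  apply/funext => k; rewrite /pseries_diffs factS natrM; field.
  by rewrite nat1r !pnatr_eq0 -lt0n fact_gt0.
have hS k : `|h k.+1| <= B by [].
have dS k : `|h k.+1 - h k| <= B + B by rewrite (le_trans (ler_normB _ _))// lerD.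
have dc : is_derive x (1:R) (fun x => limn (pseries c x))
    (limn (pseries (fun k => h k.+1 / k`!%:R) x)).
  rewrite -diffs; apply: (@pseries_snd_diffs _ _ (`|x| + 1)).
  - exact: (is_cvg_bounded_exp_series hB).
  - by rewrite diffs; exact: (@is_cvg_bounded_exp_series B (fun k => h k.+1)).
  - by rewrite !diffs; exact: (@is_cvg_bounded_exp_series B (fun k => h k.+2)).
  - by rewrite [ltRHS]ger0_norm// ltrDl.
have -> : poisE h = (fun x => expR (- x) * limn (pseries c x)).
  by apply/funext => y; rewrite (poisE_pseries hB).
apply: is_derive_eq.
rewrite (poisE_pseries dS) /GRing.scale/=.
have -> : (fun k => (h k.+1 - h k) / k`!%:R) =
   (fun k => h k.+1 / k`!%:R) - (fun k => h k / k`!%:R).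
  by apply/funext => k; rewrite mulrBl.
have := @is_cvg_bounded_exp_series B h hB x.
have := @is_cvg_bounded_exp_series B (fun k => h k.+1) hS x.
move=> c1 c2.
have -> : pseries ((fun k => h k.+1 / k`!%:R) - (fun k => h k / k`!%:R)) x =
    pseries (fun k => h k.+1 / k`!%:R) x - pseries (fun k => h k / k`!%:R) x.
  apply/funext => n; rewrite /pseries /series/= -[RHS]/(_ - _) -sumrB.
  by apply: eq_bigr => k _; rewrite -[(_ - _) k]/(_ - _) mulrBl.
rewrite limB//; ring.
Qed.

(* The derivative of [l |-> E h (Poisson l)] is [E (h (N + 1) - h N)]; this
   replaces the coupling of two Poisson laws. *)
Lemma poisE_lipschitz (B L : R) h (x y : R) : (forall k, `|h k| <= B) ->
  (forall k, `|h k.+1 - h k| <= L) -> 0 <= x -> 0 <= y ->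
  `|poisE h y - poisE h x| <= L * `|y - x|.
Proof.
move=> hB hL x0 y0.
have [z [-> _ /andP[zm _]]] := MVT_all x y (fun z => is_derive_poisE z hB).
have z0 : 0 <= z by apply: le_trans zm; rewrite le_min x0.
rewrite normrM ler_wpM2r// ler_norml.
have hs := psum_poisE hL z0.
rewrite (psum_le z0 _ (@psum_cst (- L) z) hs)/=; last first.
  by move=> k; have := hL k; rewrite ler_norml => /andP[].
by rewrite (psum_le z0 _ hs (@psum_cst L z))// => k; rewrite (le_trans (ler_norm _)).
Qed.

Lemma poisE_range (B : R) h l : (forall k, 0 <= h k <= B) -> 0 <= l -> 0 <= poisE h l <= B.
Proof.
move=> hB l0.
have hN k : `|h k| <= B by have /andP[? ?] := hB k; rewrite ger0_norm.
have hs := psum_poisE hN l0.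
by rewrite (psum_le l0 _ (@psum_cst 0 l) hs) ?(psum_le l0 _ hs (@psum_cst B l))//
  => k; have /andP[] := hB k.
Qed.

End poisson_sums.

(** * Expectation bounds *)

Section expectation_bounds.
Context {R : realType} {d : measure_display} {T : measurableType d}.
Variable P : probability T R.
Implicit Types (X Y : T -> R) (a c e : R).

(** Bundles a bound on the mean with measurability and nonnegativity, so that such bounds can be
    added, scaled and compared in the extended reals without integrability conditions. *)
Definition Ele X c := [/\ measurable_fun setT X, (forall w, 0 <= X w) &
  (\int[P]_w (X w)%:E <= c%:E)%E].

Let mE X : measurable_fun setT X -> measurable_fun setT (EFin \o X).
Proof. by move=> mX; apply/measurable_EFinP. Qed.

Lemma le_integralE X Y : measurable_fun setT X -> measurable_fun setT Y ->
  (forall w, 0 <= X w) -> (forall w, X w <= Y w) ->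
  (\int[P]_w (X w)%:E <= \int[P]_w (Y w)%:E)%E.
Proof.
move=> mX mY X0 XY; apply: ge0_le_integral => //; try exact: mE.
all: by move=> w _; rewrite lee_fin.
Qed.

Lemma integralDE X Y : measurable_fun setT X -> measurable_fun setT Y ->
  (forall w, 0 <= X w) -> (forall w, 0 <= Y w) ->
  (\int[P]_w (X w + Y w)%:E = \int[P]_w (X w)%:E + \int[P]_w (Y w)%:E)%E.
Proof.
move=> mX mY X0 Y0; rewrite -ge0_integralD//; try exact: mE.
all: by move=> w _; rewrite lee_fin.
Qed.

Lemma measurable_sum_nat m n (X : nat -> T -> R) :
  (forall i, (m <= i)%N -> measurable_fun setT (X i)) ->
  measurable_fun setT (fun w => \sum_(m <= i < n) X i w).
Proof.
move=> mX; rewrite (_ : (fun w => _) =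
    fun w => \sum_(i <- index_iota m n) (if (m <= i)%N then X i w else 0)).
  by apply: measurable_sum => i; have [/mX//|_] := leqP m i; exact: measurable_cst.
by apply/funext => w; rewrite big_nat [RHS]big_nat; apply: eq_bigr => i /andP[->].
Qed.

Lemma integral_sumE (I : Type) (r : seq I) (X : I -> T -> R) :
  (forall i, measurable_fun setT (X i)) -> (forall i w, 0 <= X i w) ->
  (\int[P]_w (\sum_(i <- r) X i w)%:E = \sum_(i <- r) \int[P]_w (X i w)%:E)%E.
Proof.
move=> mX X0; under eq_integral do rewrite -sumEFin; rewrite ge0_integral_sum//.
- by move=> i; exact: mE.
- by move=> i w _; rewrite lee_fin.
Qed.

Lemma integral_cstE c : (\int[P]_w c%:E = c%:E)%E.
Proof. by rewrite integral_cst//; apply: etrans (mule1 _); congr (_ * _)%E; exact: probability_setT. Qed.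

Lemma Ele_ge0 X c : Ele X c -> 0 <= c.
Proof.
case=> _ X0 Xc; rewrite -lee_fin (le_trans _ Xc)//.
by apply: integral_ge0 => w _; rewrite lee_fin.
Qed.

Lemma Ele_weaken X c c' : Ele X c -> c <= c' -> Ele X c'.
Proof. by case=> mX X0 Xc cc'; split=> //; rewrite (le_trans Xc)// lee_fin. Qed.

Lemma Ele_le X Y c : Ele Y c -> measurable_fun setT X -> (forall w, 0 <= X w) ->
  (forall w, X w <= Y w) -> Ele X c.
Proof.
case=> mY Y0 Yc mX X0 XY; split=> //; apply: le_trans Yc.
exact: le_integralE.
Qed.

Lemma Ele_cst c : 0 <= c -> Ele (fun=> c) c.
Proof. by move=> c0; split=> //; rewrite integral_cstE. Qed.

Lemma EleD X Y c c' : Ele X c -> Ele Y c' -> Ele (fun w => X w + Y w) (c + c').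
Proof.
case=> mX X0 Xc [mY Y0 Yc]; split; first exact: measurable_funD.
- by move=> w; rewrite addr_ge0.
- by rewrite integralDE// EFinD leeD.
Qed.

Lemma EleZ a X c : 0 <= a -> Ele X c -> Ele (fun w => a * X w) (a * c).
Proof.
move=> a0 [mX X0 Xc]; split; first exact: measurable_funM.
- by move=> w; rewrite mulr_ge0.
- under eq_integral do rewrite EFinM.
  rewrite ge0_integralZl_EFin//; last first.
  + by apply: mE.
  + by move=> w _; rewrite lee_fin.
  by rewrite EFinM lee_wpmul2l// lee_fin.
Qed.

Lemma Ele_sum (I : Type) (r : seq I) (Q : pred I) (X : I -> T -> R) (c : I -> R) :
  (forall i, Q i -> Ele (X i) (c i)) ->
  Ele (fun w => \sum_(i <- r | Q i) X i w) (\sum_(i <- r | Q i) c i).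
Proof.
move=> H; elim: r => [|i r IH].
  rewrite big_nil (_ : (fun _ => _) = fun=> 0); first exact: Ele_cst.
  by apply/funext => w; rewrite big_nil.
rewrite big_cons; under [X in Ele X _]eq_fun do rewrite big_cons.
by case: ifPn => // /H Xi; exact: EleD.
Qed.

Lemma Ele_sum_nat m n (X : nat -> T -> R) c :
  (forall i, (m <= i < n)%N -> Ele (X i) c) ->
  Ele (fun w => \sum_(m <= i < n) X i w) ((n - m)%:R * c).
Proof.
move=> H; rewrite mulr_natl -sumr_const_nat big_nat.
under [X in Ele X _]eq_fun do rewrite big_nat.
exact: Ele_sum.
Qed.

Lemma Ele_markov X c e : 0 < e -> Ele X c ->
  exists2 A, measurable A & (P A <= (c / e)%:E)%E /\ forall w, ~ A w -> X w <= e.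
Proof.
move=> e0 [mX X0 Xc]; exists (X @^-1` `]e, +oo[).
  by rewrite -[X in measurable X]setTI; apply: mX => //; exact: measurable_itv.
split; last by move=> w /=; rewrite in_itv/= andbT => /negP; rewrite -leNgt.
have := @le_integral_abse _ _ _ P setT measurableT _ e (mE mX) e0.
under [X in (_ <= X)%E -> _]eq_integral do rewrite gee0_abs ?lee_fin//.
move=> /le_trans /(_ Xc) h; rewrite -(@lee_pmul2l _ e%:E)//.
rewrite -EFinM mulrCA divff ?gt_eqF// mulr1; apply: le_trans h.
apply: lee_wpmul2l; first by rewrite lee_fin ltW.
apply: le_measure; rewrite ?inE.
- by rewrite -[X in measurable X]setTI; apply: mX => //; exact: measurable_itv.
- apply: emeasurable_fun_c_infty => //.
  by apply: measurableT_comp => //; exact: mE.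
- move=> w /=; rewrite in_itv/= andbT => ew; split => //.
  by rewrite lee_fin (le_trans (ltW ew))// ler_norm.
Qed.

Lemma Ele_dominated X c (Y : nat -> T -> R) : Ele X c ->
  (forall n, measurable_fun setT (Y n)) -> (forall n w, 0 <= Y n w <= X w) ->
  (forall w, Y n w @[n --> \oo] --> 0) ->
  forall e, 0 < e -> \forall n \near \oo, Ele (Y n) e.
Proof.
case=> mX X0 Xc mY YX Y0 e e0.
have [] := @dominated_convergence _ _ _ P setT measurableT
  (fun n w => (Y n w)%:E) (fun=> 0%E) (fun w => (X w)%:E).
- by move=> n; exact: mE.
- by [].
- by apply: aeW => w _; apply/cvg_EFin; [exact: nearW|exact: Y0].
- apply/integrableP; split; first exact: mE.
  under eq_integral do rewrite gee0_abs ?lee_fin//.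
  by rewrite (le_lt_trans Xc)// ltry.
- apply: aeW => w n _; have /andP[? ?] := YX n w.
  by rewrite gee0_abs lee_fin.
move=> _ _; rewrite integral0 => /fine_cvgP[fin] /cvgr_dist_le /(_ _ e0) sm.
near=> n; split => //.
  by move=> w; have /andP[] := YX n w.
have finn : (\int[P]_w (Y n w)%:E)%E \is a fin_num by near: n.
rewrite -(fineK finn) lee_fin.
have : `|0 - fine (\int[P]_w (Y n w)%:E)%E| <= e by near: n.
by rewrite sub0r normrN; apply: le_trans; rewrite ler_norm.
Unshelve. all: by end_near. Qed.

Lemma Ele_fatou X c (Y : nat -> T -> R) : (forall n, Ele (Y n) c) ->
  measurable_fun setT X -> (forall w, 0 <= X w) ->
  (forall w, Y n w @[n --> \oo] --> X w) -> Ele X c.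
Proof.
move=> Yc mX X0 YX; split=> //.
have mY n := let: And3 h _ _ := Yc n in h.
have Y0 n := let: And3 _ h _ := Yc n in h.
have := @fatou _ _ _ P setT measurableT (fun n w => (Y n w)%:E)
  (fun n => mE (mY n)) (fun n w _ => Y0 n w).
rewrite (_ : (\int[P]_x _)%E = (\int[P]_w (X w)%:E)%E); last first.
  apply: eq_integral => w _; apply: (cvg_limn_einf_sup _).1.
  by apply/cvg_EFin; [exact: nearW|exact: YX].
move=> /le_trans; apply; rewrite limn_einf_lim.
apply: lime_le; first exact: is_cvg_einfs.
apply: nearW => n; apply: ge_ereal_inf.
exists (\int[P]_w (Y n w)%:E)%E; last by have [] := Yc n.
by exists n => /=.
Qed.

(* The exceptional set is quantified so that [Q n] itself need not be measurable. *)
Definition whp e (Q : nat -> T -> Prop) := \forall n \near \oo,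
  exists2 A, measurable A & (P A <= e%:E)%E /\ forall w, ~ A w -> Q n w.

Lemma whpS e (Q Q' : nat -> T -> Prop) : whp e Q ->
  (\forall n \near \oo, forall w, Q n w -> Q' n w) -> whp e Q'.
Proof.
apply: filterS2 => n [A mA [PA QA]] QQ'; exists A => //; split=> // w /QA.
exact: QQ'.
Qed.

Lemma whpI e e' (Q Q' : nat -> T -> Prop) : whp e Q -> whp e' Q' ->
  whp (e + e') (fun n w => Q n w /\ Q' n w).
Proof.
apply: filterS2 => n [A mA [PA QA]] [B mB [PB QB]].
exists (A `|` B); first exact: measurableU.
split; last by move=> w /not_orP[/QA ? /QB].
by rewrite (le_trans (measureU2 _ mA mB))// EFinD leeD.
Qed.

Lemma whp_markov (X : nat -> T -> R) c e : 0 < e ->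
  (\forall n \near \oo, Ele (X n) c) -> whp (c / e) (fun n w => X n w <= e).
Proof. by move=> e0; apply: filterS => n; exact: Ele_markov. Qed.

Lemma whp_measure_le e (A B : nat -> set T) : (forall n, measurable (A n)) ->
  (forall n, measurable (B n)) -> whp e (fun n w => A n w -> B n w) ->
  \forall n \near \oo, (P (A n) <= P (B n) + e%:E)%E.
Proof.
move=> mA mB; apply: filterS => n [N mN [PN AB]].
apply: (@le_trans _ _ (P (B n `|` N))).
  apply: le_measure; rewrite ?inE//; first exact: measurableU.
  by move=> w Aw; have [Nw|Nw] := pselect (N w); [right|left; exact: AB].
by rewrite (le_trans (measureU2 _ (mB n) mN))// leeD2l.
Qed.

Lemma tight_random_variable X e : measurable_fun setT X -> 0 < e ->
  exists2 B : R, 0 < B & whp e (fun _ w => `|X w| <= B).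
Proof.
move=> mX e0.
pose A (n : nat) := X @^-1` (~` `[- n%:R, n%:R]).
have mA n : measurable (A n).
  rewrite -[X in measurable X]setTI; apply: mX => //; apply: measurableC.
  exact: measurable_itv.
have : \forall n \near \oo, Ele (\1_(A n) : T -> R) e.
  apply: (Ele_dominated (Ele_cst ler01)) e0.
  - by move=> n; exact: measurable_indic.
  - by move=> n w; rewrite indicE ler0n lern1 leq_b1.
  - move=> w; apply: cvg_near_cst.
    near=> n; rewrite indicE memNset// /A/=; apply; rewrite /= in_itv/= -ler_norml.
    by near: n; exact: nbhs_infty_ger.
move=> [n _ /(_ n (leqnn n))] [_ _]; rewrite integral_indic//.
rewrite setIT => h; exists n.+1%:R => //; apply: nearW => _.
exists (A n) => //; split => // w /contrapT /=; rewrite in_itv/= -ler_norml => /le_trans; apply.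
by rewrite ler_nat.
Unshelve. all: by end_near. Qed.

End expectation_bounds.

(** * Weights measurable for a sub-sigma-algebra *)

Section sub_sigma_algebra.
Context {R : realType} {d : measure_display} {T : measurableType d}.
Variables (P : probability T R) (G : set (set T)).
Hypothesis mG : G `<=` @measurable d T.
Let T' := g_sigma_algebraType G.

Lemma measurable_sub (E : set T') : measurable E -> @measurable d T E.
Proof.
move=> mE; apply: (smallest_sub _ mG mE); split.
- exact: measurable0.
- by move=> A mA; rewrite setTD; exact: measurableC.
- by move=> F mF; exact: bigcup_measurable.
Qed.

Lemma measurable_fun_sub d' (U : measurableType d') (g : T -> U) :
  measurable_fun [set: T'] (g : T' -> U) -> measurable_fun [set: T] g.
Proof. by move=> mg _ B mB; rewrite setTI; apply: measurable_sub; rewrite -[X in measurable X]setTI; exact: mg. Qed.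

Import HBNNSimple.

(** Taking out what is known: equality of integrals over the sets of the smaller sigma-algebra
    extends to its simple functions by linearity and to its nonnegative functions by monotone
    convergence. *)
Lemma eq_integral_sub (X1 X2 g : T -> R) :
  measurable_fun [set: T] X1 -> measurable_fun [set: T] X2 ->
  (forall w, 0 <= X1 w) -> (forall w, 0 <= X2 w) ->
  (forall E : set T', measurable E ->
     (\int[P]_(w in E) (X1 w)%:E = \int[P]_(w in E) (X2 w)%:E)%E) ->
  measurable_fun [set: T'] (g : T' -> R) -> (forall w, 0 <= g w) ->
  (\int[P]_w (g w * X1 w)%:E = \int[P]_w (g w * X2 w)%:E)%E.
Proof.
move=> mX1 mX2 X10 X20 X12 mg g0.
have mg' : measurable_fun [set: T'] (EFin \o (g : T' -> R)) by exact/measurable_EFinP.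
(* The approximation is carried out on [T'], so that the level sets of [h n] lie in the smaller
   sigma-algebra. *)
pose h n := (nnsfun_approx measurableT mg' n : T' -> R).
have mh n : measurable_fun [set: T] (h n : T -> R).
  by apply: measurable_fun_sub; exact: measurable_funP.
have h0 n w : 0 <= h n w by [].
have hnd (w : T) m n : (m <= n)%N -> h m w <= h n w.
  by move=> mn; have /lefP/(_ w) := nd_nnsfun_approx measurableT mg' mn.
have hg (w : T) : h n w @[n --> \oo] --> g w.
  have := @cvg_nnsfun_approx _ _ _ _ measurableT _ mg' (fun x _ => g0 x) w I.
  by move=> /fine_cvgP[].
have lim (X : T -> R) : measurable_fun [set: T] X -> (forall w, 0 <= X w) ->
    (\int[P]_w (h n w * X w)%:E)%E @[n --> \oo] --> (\int[P]_w (g w * X w)%:E)%E.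
  move=> mX X0.
  rewrite (_ : (\int[P]_w (g w * X w)%:E)%E =
      (\int[P]_w (limn (fun n => (h n w * X w)%:E)))%E); last first.
    apply: eq_integral => w _; apply/esym/cvg_lim => //.
    by apply/cvg_EFin; [exact: nearW|apply: cvgMl; exact: hg].
  apply: cvg_monotone_convergence => //.
  - by move=> n; apply/measurable_EFinP; exact: measurable_funM.
  - by move=> n w _; rewrite lee_fin mulr_ge0.
  - by move=> w _ m n mn; rewrite lee_fin ler_wpM2r// hnd.
have step n (X : T -> R) : measurable_fun [set: T] X -> (forall w, 0 <= X w) ->
    (\int[P]_w (h n w * X w)%:E = \sum_(y \in range (h n))
      (y%:E * \int[P]_(w in h n @^-1` [set y]) (X w)%:E))%E.
  move=> mX X0.
  have my y : measurable (h n @^-1` [set y] : set T).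
    by apply: measurable_sub; exact: measurable_funPTI.
  have hE w : h n w = \sum_(y \in range (h n)) y * \1_(h n @^-1` [set y]) w.
    exact: fimfunE.
  have fin : finite_set (range (h n)) by exact: fimfunP.
  under eq_integral => w _.
    rewrite (_ : (h n w * X w)%:E = (\sum_(y \in range (h n))
        (y * (\1_(h n @^-1` [set y]) w * X w))%:E)%E); last first.
      rewrite fsumEFin//; congr EFin; rewrite [in LHS]hE !fsbig_finite//= big_distrl/=.
      by apply: eq_bigr => y _; rewrite mulrA.
    over.
  rewrite ge0_integral_fsum//.
  - apply: eq_fsbigr => y /[!inE] -[w _ <-].
    under eq_integral do rewrite EFinM.
    rewrite ge0_integralZl_EFin//; last 2 first.
    + by move=> z _; rewrite lee_fin mulr_ge0.
    + by apply/measurable_EFinP; apply: measurable_funM => //; exact: measurable_indic.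
    congr (_ * _)%E; rewrite [RHS]integral_mkcond; apply: eq_integral => z _.
    rewrite /patch indicE; case: ifPn; rewrite ?mul1r ?mul0r//.
  - move=> y; apply/measurable_EFinP; apply: measurable_funM => //.
    by apply: measurable_funM => //; exact: measurable_indic.
  - move=> y w _; rewrite lee_fin indicE; have [|_] := boolP (_ \in _).
      by rewrite inE => /= <-; rewrite !mulr_ge0.
    by rewrite mul0r mulr0.
apply: (cvg_unique _ (lim X1 mX1 X10)) => //.
rewrite (_ : (fun n => _) = (fun n => (\int[P]_w (h n w * X2 w)%:E)%E)); first exact: lim.
apply/funext => n; rewrite !step//; apply: eq_fsbigr => y _; rewrite X12//.
Qed.

End sub_sigma_algebra.

Section natural_switch.
Context {R : realType} {d : measure_display} {T : measurableType d}.

Lemma measurable_fun_switch d' (U : measurableType d') (nu : T -> nat) (H : nat -> T -> U) :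
  (forall k, measurable (nu @^-1` [set k])) ->
  (forall k, measurable_fun setT (H k)) ->
  measurable_fun setT (fun w => H (nu w) w).
Proof.
move=> mnu mH _ B mB; rewrite setTI.
rewrite (_ : _ @^-1` B = \bigcup_k (nu @^-1` [set k] `&` H k @^-1` B)).
  apply: bigcup_measurable => k _; apply: measurableI => //.
  by rewrite -[X in measurable X]setTI; exact: mH.
apply/seteqP; split => [w /= HB|w [k _ [/= <-]]//].
by exists (nu w).
Qed.

End natural_switch.

(** * Conditional expectation given the past *)

Section past.
Context {R : realType} {d : measure_display} {T : measurableType d}.
Variables (P : probability T R) (N : int -> T -> nat) (lam : int -> T -> R).
Hypothesis N_meas : forall t k, measurable (N t @^-1` [set k]).
Hypothesis lam_meas : forall t, measurable_fun setT (lam t).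
Hypothesis lam_ge0 : forall t w, 0 <= lam t w.
Hypothesis stat : strictly_stationary P N lam.
Hypothesis cpois : cond_poisson P N lam.

Definition past_gen (t : int) : set (set T) :=
  [set A | exists s : int, (s <= t)%R /\
        ((exists B : set nat, A = N s @^-1` B) \/
         (exists B : set R, measurable B /\ A = lam s @^-1` B))].

(** Measurability for the past up to time [t], encoded by viewing [X] on a copy of [T] that carries
    the generated sigma-algebra; the general measurability lemmas then apply unchanged. *)
Definition pmeas t (X : T -> R) :=
  measurable_fun [set: g_sigma_algebraType (past_gen t)]
    (X : g_sigma_algebraType (past_gen t) -> R).

Lemma past_gen_measurable t : past_gen t `<=` @measurable d T.
Proof.
move=> A [s [_ [[B ->]|[B [mB ->]]]]].
  rewrite (_ : _ @^-1` B = \bigcup_(k in B) (N s @^-1` [set k])).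
    by apply: bigcup_measurable.
  by apply/seteqP; split => [w Bw|w [k Bk /= ->]//]; exists (N s w).
by rewrite -[X in measurable X]setTI; exact: lam_meas.
Qed.

Lemma pmeas_measurable t X : pmeas t X -> measurable_fun setT X.
Proof. by move=> mX; apply: (measurable_fun_sub (@past_gen_measurable t)); exact: mX. Qed.

Lemma pmeas_mono s t X : s <= t -> pmeas s X -> pmeas t X.
Proof.
move=> st mX _ B mB; rewrite setTI.
have : <<s past_gen s >> (X @^-1` B).
  by have := mX measurableT B mB; rewrite setTI.
apply: sub_sigma_algebra2 => A [u [us H]]; exists u; split => //.
exact: le_trans us st.
Qed.

Lemma pmeas_lam s t : s <= t -> pmeas t (lam s).
Proof.
move=> st _ B mB; rewrite setTI; apply: sub_sigma_algebra.
by exists s; split => //; right; exists B.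
Qed.

Lemma past_N s t k : s <= t ->
  (@measurable _ (g_sigma_algebraType (past_gen t))) (N s @^-1` [set k]).
Proof.
by move=> st; apply: sub_sigma_algebra; exists s; split => //; left; exists [set k].
Qed.

Lemma pmeas_switch s t (H : nat -> T -> R) : s <= t ->
  (forall k, pmeas t (H k)) -> pmeas t (fun w => H (N s w) w).
Proof.
by move=> st mH; apply: measurable_fun_switch => // k; exact: past_N.
Qed.

Lemma measurable_pois_pmf k : measurable_fun setT (fun l : R => pois_pmf l k).
Proof.
apply: measurable_funM => //; apply: measurable_funM; last exact: measurable_funX.
by apply: measurableT_comp => //; exact: measurableT_comp.
Qed.

Lemma cond_expectation_single t k (g : T -> R) : pmeas (t - 1) g ->
  (forall w, 0 <= g w) ->
  (\int[P]_w (g w * \1_(N t @^-1` [set k]) w)%:E =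
   \int[P]_w (g w * pois_pmf (lam t w) k)%:E)%E.
Proof.
move=> mg g0.
apply: (eq_integral_sub (@past_gen_measurable (t - 1))) => //.
- exact: (measurableT_comp (measurable_pois_pmf k) (lam_meas t)).
- by move=> w; rewrite pois_pmf_ge0.
move=> E mE; rewrite -(cpois k mE) integral_indic//; first by rewrite setIC.
exact: measurable_sub (@past_gen_measurable (t - 1)) _ mE.
Qed.

(** [H (N t w) w] is the sum over [k] of [H k w] times the indicator of [N t = k]. Each indicator is
    replaced by its conditional probability, and nonnegativity allows sum and integral to be
    interchanged before and after. *)
Lemma cond_expectation_series t (H : nat -> T -> R) :
  (forall k, pmeas (t - 1) (H k)) -> (forall k w, 0 <= H k w) ->
  (\int[P]_w (H (N t w) w)%:E =
   \int[P]_w (\sum_(k <oo) (pois_pmf (lam t w) k * H k w)%:E))%E.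
Proof.
move=> mH H0.
have mHT k : measurable_fun setT (H k) by exact: pmeas_measurable (mH k).
rewrite integral_nneseries//=; last 2 first.
- move=> k; apply/measurable_EFinP; apply: measurable_funM => //.
  exact: (measurableT_comp (measurable_pois_pmf k) (lam_meas t)).
- by move=> k w _; rewrite lee_fin mulr_ge0// pois_pmf_ge0.
under [RHS]eq_eseriesr => k _.
  under eq_integral do rewrite mulrC.
  rewrite -cond_expectation_single//; over.
rewrite -integral_nneseries//=; last 2 first.
- by move=> k; apply/measurable_EFinP; exact: measurable_funM.
- by move=> k w _; rewrite lee_fin mulr_ge0.
apply: eq_integral => w _.
rewrite (@nneseriesD1 _ _ (N t w))//; last by move=> k _; rewrite lee_fin mulr_ge0.
rewrite indicE mem_set//= mulr1 eseries0 ?adde0// => k _ /=.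
move=> /eqP kN; rewrite indicE memNset ?mulr0//= => /esym.
exact: kN.
Qed.

(** The form in which conditioning is used: [s] is the conditional mean of [H (N t)] given the past,
    computed at each sample point as a Poisson sum of rate [lam t w]. *)
Lemma cond_expectation t (H : nat -> T -> R) (s : T -> R) :
  (forall k, pmeas (t - 1) (H k)) -> (forall k w, 0 <= H k w) ->
  (forall w, psum (lam t w) (fun k => H k w) (s w)) ->
  (\int[P]_w (H (N t w) w)%:E = \int[P]_w (s w)%:E)%E.
Proof.
move=> mH H0 Hs; rewrite cond_expectation_series//.
apply: eq_integral => w _; apply/cvg_lim => //.
under eq_fun do rewrite sumEFin.
by apply/cvg_EFin; [exact: nearW|exact: Hs].
Qed.

Lemma psum_measurable (H : nat -> T -> R) (l s : T -> R) :
  measurable_fun setT l -> (forall k, measurable_fun setT (H k)) ->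
  (forall w, psum (l w) (fun k => H k w) (s w)) -> measurable_fun setT s.
Proof.
move=> ml mH Hs.
apply: (@measurable_fun_cvg _ _ _ setT
  (fun n w => series (fun k => pois_pmf (l w) k * H k w) n)).
- move=> n; apply: measurable_sum => k /=; apply: measurable_funM => //.
  exact: (measurableT_comp (measurable_pois_pmf k) ml).
- by move=> w _; exact: Hs.
Qed.

Lemma law_lam t (g : R -> \bar R) : measurable_fun setT g -> (forall x, 0 <= g x)%E ->
  (\int[P]_w g (lam t w) = \int[P]_w g (lam 0 w))%E.
Proof.
move=> mg g0.
transitivity (\int[pushforward P (lam t)]_x g x)%E.
  by rewrite ge0_integral_pushforward.
transitivity (\int[pushforward P (lam 0)]_x g x)%E; last first.
  by rewrite ge0_integral_pushforward.
apply: eq_measure_integral => B mB _.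
have := @stat 1%N (fun=> 0) (fun=> setT) (fun=> B) t (fun=> mB).
have big (A : set T) : \bigcap_(i in [set: 'I_1]) A = A.
  by apply/seteqP; split => [w /(_ ord0 I)|w Aw i _].
by rewrite !big add0r !preimage_setT !setTI.
Qed.

End past.

(** * The autoregressive model and its moments *)

Record ingarch {R : realType} {d : measure_display} {T : measurableType d}
  (P : probability T R) (N : int -> T -> nat) (lam : int -> T -> R)
  (g0 : R -> nat -> R) (kappa1 kappa2 : R) : Prop := Ingarch {
  ingarch_N_meas : forall t k, measurable (N t @^-1` [set k]);
  ingarch_lam_meas : forall t, measurable_fun setT (lam t);
  ingarch_lam_ge0 : forall t w, 0 <= lam t w;
  ingarch_stat : strictly_stationary P N lam;
  ingarch_cpois : cond_poisson P N lam;
  ingarch_kappa1 : 0 <= kappa1;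
  ingarch_kappa2 : 0 <= kappa2;
  ingarch_kappa_lt1 : kappa1 + kappa2 < 1;
  ingarch_ge0 : forall x y, 0 <= g0 x y;
  ingarch_lip : forall x x' y y',
    `|g0 x y - g0 x' y'| <= kappa1 * `|x - x'| + kappa2 * `|y%:R - y'%:R|;
  ingarch_rec : forall t w, lam t w = g0 (lam (t - 1) w) (N (t - 1) w) }.

Lemma lipschitz_measurable {R : realType} (g : R -> R) L :
  (forall x y, `|g x - g y| <= L * `|x - y|) -> measurable_fun setT g.
Proof.
move=> gL; have L0 : 0 <= L.
  by have := gL 1 0; rewrite subr0 normr1 mulr1; exact: le_trans.
apply: continuous_measurable_fun => x.
apply/cvgrPdist_le => e e0.
have e1 : 0 < e / (L + 1) by rewrite divr_gt0// ltr_wpDl.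
have [] // := (@cvgrPdist_le _ R^o _ (nbhs x) _ id x).1 cvg_id _ e1.
move=> r r0 xr; exists r => // y /xr /=; rewrite ler_pdivlMr ?ltr_wpDl// => xy.
rewrite (le_trans (gL _ _))//; apply: le_trans xy.
by rewrite mulrC ler_wpM2l// lerDl.
Qed.

Section autoregression.
Context {R : realType} {d : measure_display} {T : measurableType d}.
Variables (P : probability T R) (N : int -> T -> nat) (lam : int -> T -> R).
Variables (g0 : R -> nat -> R) (kappa1 kappa2 : R).
Hypothesis model : ingarch P N lam g0 kappa1 kappa2.

Let N_meas := ingarch_N_meas model.
Let lam_meas := ingarch_lam_meas model.
Let lam_ge0 := ingarch_lam_ge0 model.
Let stat := ingarch_stat model.
Let cpois := ingarch_cpois model.
Let kappa1_ge0 := ingarch_kappa1 model.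
Let kappa2_ge0 := ingarch_kappa2 model.
Let kappa_lt1 := ingarch_kappa_lt1 model.
Let g0_ge0 := ingarch_ge0 model.
Let g0_lip := ingarch_lip model.
Let lam_rec := ingarch_rec model.

Local Notation pmeas := (pmeas N lam).

Lemma g0_measurable k : measurable_fun setT (fun x => g0 x k).
Proof.
apply: (@lipschitz_measurable _ _ kappa1) => x y.
by have := g0_lip x y k k; rewrite subrr normr0 mulr0 addr0.
Qed.

Lemma pmeas_comp t (X : T -> R) (g : R -> R) : measurable_fun setT g ->
  pmeas t X -> pmeas t (fun w => g (X w)).
Proof. by move=> mg mX; rewrite /pmeas; exact: (measurableT_comp mg mX). Qed.

(** The recursion makes the intensity predictable; hence functions of [lam t] act as constants when
    the count at time [t] is averaged. *)
Lemma pmeas_lam_next t : pmeas (t - 1) (lam t).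
Proof.
rewrite (_ : lam t = fun w => g0 (lam (t - 1) w) (N (t - 1) w)); last first.
  by apply/funext => w; rewrite lam_rec.
apply: (@pmeas_switch _ _ _ N lam _ _ (fun k w => g0 (lam (t - 1) w) k)) => // k.
exact: (pmeas_comp (g0_measurable k) (@pmeas_lam _ _ _ N lam _ _ (lexx _))).
Qed.

Lemma pair_measurable t (h : R -> nat -> R) : (forall k, measurable_fun setT (h ^~ k)) ->
  measurable_fun setT (fun w => h (lam t w) (N t w)).
Proof.
move=> mh; apply: (@measurable_fun_switch _ _ _ _ (N t) (fun k w => h (lam t w) k)) => // k.
exact: (measurableT_comp (mh k) (lam_meas t)).
Qed.

(** Given [lam t], the count is Poisson with this rate, so the law of the pair is determined by the
    law of [lam t], which is shift invariant. *)
Lemma law_pair t (h : R -> nat -> R) : (forall k, measurable_fun setT (h ^~ k)) ->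
  (forall x k, 0 <= h x k) ->
  (\int[P]_w (h (lam t w) (N t w))%:E = \int[P]_w (h (lam 0 w) (N 0 w))%:E)%E.
Proof.
(* The absolute value makes every term of the series nonnegative on the whole line; on the range of
   [lam] it changes nothing. *)
move=> mh h0; pose g x := (\sum_(k <oo) (pois_pmf `|x| k * h x k)%:E)%E.
have mg : measurable_fun setT g.
  apply: ge0_emeasurable_sum => k.
    by move=> x _ _; rewrite lee_fin mulr_ge0// pois_pmf_ge0.
  move=> _; apply/measurable_EFinP; apply: measurable_funM => //.
  exact: (measurableT_comp (measurable_pois_pmf k) (@normr_measurable R setT)).
have step s : (\int[P]_w (h (lam s w) (N s w))%:E = \int[P]_w g (lam s w))%E.
  rewrite (@cond_expectation_series _ _ _ P N lam N_meas lam_meas lam_ge0 cpois s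
    (fun k w => h (lam s w) k))//.
    by apply: eq_integral => w _; rewrite /g ger0_norm.
  by move=> k; exact: (pmeas_comp (mh k) (@pmeas_lam_next s)).
rewrite !step (law_lam lam_meas stat)// => x; apply: nneseries_ge0 => k _ _.
by rewrite lee_fin mulr_ge0// pois_pmf_ge0.
Qed.

Lemma Ele_stationary t (h : R -> nat -> R) c : (forall k, measurable_fun setT (h ^~ k)) ->
  (forall x k, 0 <= h x k) ->
  Ele P (fun w => h (lam 0 w) (N 0 w)) c -> Ele P (fun w => h (lam t w) (N t w)) c.
Proof.
move=> mh h0 [_ _ hc]; split=> //; first exact: pair_measurable.
by rewrite law_pair.
Qed.

(** By stationarity the left side may be computed from [lam 1], whose conditional second moment is
    controlled by the drift hypothesis; the mean of a minimum is at most the minimum of the means.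
    The truncation at [M] is there because finiteness of the second moment is what is to be
    proved. *)
Lemma truncated_drift (a b rho M : R) : 0 <= M -> a = g0 0 0 ->
  (forall x, 0 <= x -> a ^+ 2 + 2 * a * (kappa1 + kappa2) * x
     + (kappa1 + kappa2) ^+ 2 * x ^+ 2 + kappa2 ^+ 2 * x <= rho * x ^+ 2 + b) ->
  0 <= rho -> 0 <= b ->
  (\int[P]_w (Num.min (lam 0 w ^+ 2) M)%:E <=
   \int[P]_w (Num.min (rho * lam 0 w ^+ 2 + b) M)%:E)%E.
Proof.
move=> M0 aE drift rho0 b0; have a0 : 0 <= a by rewrite aE.
have g0a x k : 0 <= x -> g0 x k <= a + kappa1 * x + kappa2 * k%:R.
  move=> x0; have := g0_lip x 0 k 0; rewrite -aE !subr0 (ger0_norm x0) normr_nat.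
  by move=> /(le_trans (ler_norm _)); rewrite lerBlDl addrA.
pose h x k := Num.min (g0 x k ^+ 2) M.
have hr x k : 0 <= h x k <= M by rewrite /h ge_min lexx orbT andbT le_min sqr_ge0.
have hn x k : `|h x k| <= M by have /andP[? ?] := hr x k; rewrite ger0_norm.
have hp w : psum (lam 0 w) (h (lam 0 w)) (poisE (h (lam 0 w)) (lam 0 w)).
  exact: (psum_poisE (hn (lam 0 w)) (lam_ge0 0 w)).
have mh k : measurable_fun setT (h ^~ k).
  by apply: measurable_minr => //; apply: measurable_funX; exact: g0_measurable.
have mh0 k : measurable_fun setT (fun w => h (lam 0 w) k).
  exact: (measurableT_comp (mh k) (lam_meas 0)).
have := @law_pair 1 (fun x _ => Num.min (x ^+ 2) M).
rewrite (_ : (\int[P]_w (Num.min (lam 1 w ^+ 2) M)%:E)%E =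
    (\int[P]_w (poisE (h (lam 0 w)) (lam 0 w))%:E)%E); last first.
  under eq_integral do rewrite lam_rec subrr.
  apply: (@cond_expectation _ _ _ P N lam N_meas lam_meas lam_ge0 cpois 0 (fun k w => h (lam 0 w) k)) => //.
    by move=> k; exact: (pmeas_comp (mh k) (@pmeas_lam_next 0)).
  by move=> k w; have /andP[] := hr (lam 0 w) k.
move=> <-.
- apply: le_integralE.
  + exact: psum_measurable (lam_meas 0) mh0 hp.
  + apply: measurable_minr => //; apply: measurable_funD => //.
    by apply: measurable_funM => //; exact: measurable_funX.
  + by move=> w; have /andP[] := poisE_range (hr (lam 0 w)) (lam_ge0 0 w).
  + move=> w; rewrite le_min; apply/andP; split; last first.
      by have /andP[] := poisE_range (hr (lam 0 w)) (lam_ge0 0 w).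
    apply: le_trans (drift _ (lam_ge0 0 w)).
    set x := lam 0 w; have x0 : 0 <= x by exact: lam_ge0.
    have S := @psum_poly _ x ((a + kappa1 * x) ^+ 2)
      (2 * (a + kappa1 * x) * kappa2 + kappa2 ^+ 2) (kappa2 ^+ 2) 0 0
      (fun k => (a + kappa1 * x + kappa2 * k%:R) ^+ 2).
    have := psum_le x0 _ (hp w) (S _); rewrite -/x.
    rewrite (_ : _ + _ + _ + _ + _ = a ^+ 2 + 2 * a * (kappa1 + kappa2) * x
     + (kappa1 + kappa2) ^+ 2 * x ^+ 2 + kappa2 ^+ 2 * x); last by ring.
    apply; last by move=> k; ring.
    move=> k; rewrite ge_min; apply/orP; left.
    by rewrite lerXn2r ?nnegrE//; [exact: le_trans (g0_ge0 _ _) (g0a _ _ x0)|exact: g0a].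
- by move=> k; apply: measurable_minr => //; exact: measurable_funX.
- by move=> x k; rewrite le_min sqr_ge0.
Qed.

(** With [V = lam^2], subtracting possibly infinite means is avoided:
    [min V n + b - min (rho V + b) n] is nonnegative, has mean at most [b] by the truncated drift,
    and tends to [(1 - rho) V], so that Fatou's lemma bounds the mean of [V]. *)
Lemma second_moment : exists c, Ele P (fun w => lam 0 w ^+ 2) c.
Proof.
pose kappa := kappa1 + kappa2; pose a := g0 0 0.
have k0 : 0 <= kappa by rewrite addr_ge0.
have a0 : 0 <= a by exact: g0_ge0.
(* [rho] is the midpoint of [kappa] and 1. The gap [s = rho - kappa] absorbs the linear term,
   [q x <= s x^2 + q^2 / s], which explains [b]. *)
pose rho := (1 + kappa) / 2; pose q := 2 * a * kappa + kappa2 ^+ 2.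
have q0 : 0 <= q by rewrite addr_ge0 ?sqr_ge0// !mulr_ge0.
have r1 : 0 < 1 - rho by rewrite /rho; have := kappa_lt1; rewrite -/kappa; lra.
have r0 : 0 <= rho by rewrite divr_ge0// addr_ge0.
pose s := (1 - kappa) / 2.
have s0 : 0 < s by rewrite /s; have := kappa_lt1; rewrite -/kappa; lra.
pose b := a ^+ 2 + q ^+ 2 / s.
have b0 : 0 <= b by rewrite addr_ge0 ?sqr_ge0// divr_ge0 ?sqr_ge0// ltW.
have drift x : 0 <= x -> a ^+ 2 + 2 * a * (kappa1 + kappa2) * x
     + (kappa1 + kappa2) ^+ 2 * x ^+ 2 + kappa2 ^+ 2 * x <= rho * x ^+ 2 + b.
  move=> x0; rewrite -/kappa.
  have kk : kappa ^+ 2 <= kappa.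
    by rewrite expr2 ler_piMr// ltW//; exact: kappa_lt1.
  have h1 : q * x <= s * x ^+ 2 + q ^+ 2 / s.
    have : 0 <= s^-1 * (s * x - q) ^+ 2 by rewrite mulr_ge0 ?sqr_ge0// invr_ge0 ltW.
    rewrite (_ : s^-1 * _ = s * x ^+ 2 + q ^+ 2 / s - 2 * (q * x)); last first.
      by field; rewrite gt_eqF.
    have : 0 <= q * x by rewrite mulr_ge0.
    lra.
  have h2 : kappa ^+ 2 * x ^+ 2 <= kappa * x ^+ 2 by rewrite ler_wpM2r// sqr_ge0.
  have -> : rho = kappa + s by rewrite /rho /s; field.
  rewrite /b; move: h1; rewrite /q; lra.
pose V w := lam 0 w ^+ 2.
have V0 w : 0 <= V w by exact: sqr_ge0.
have mV : measurable_fun setT V by exact: measurable_funX.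
pose A (n : nat) w := Num.min (V w) n%:R.
pose B (n : nat) w := Num.min (rho * V w + b) n%:R.
have mA n : measurable_fun setT (A n) by exact: measurable_minr.
have mB n : measurable_fun setT (B n).
  by apply: measurable_minr => //; apply: measurable_funD => //; exact: measurable_funM.
have A0 n w : 0 <= A n w by rewrite le_min V0/=.
have W0 w : 0 <= rho * V w + b by rewrite addr_ge0// mulr_ge0.
have B0 n w : 0 <= B n w by rewrite le_min W0/=.
have BA n w : B n w <= A n w + b.
  rewrite /A /B; have [_|nV] := leP (V w) n%:R.
    by rewrite ge_min lerD2r ler_piMl// -subr_ge0 ltW.
  by rewrite ge_min lerDl b0 orbT.
have Bfin n : (\int[P]_w (B n w)%:E)%E \is a fin_num.
  rewrite ge0_fin_numE; last by apply: integral_ge0 => w _; rewrite lee_fin.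
  apply: (@le_lt_trans _ _ (\int[P]_w (n%:R)%:E)%E); last by rewrite integral_cstE ltry.
  by apply: le_integralE => // w; rewrite ge_min lexx orbT.
have D n : Ele P (fun w => A n w + b - B n w) b.
  split.
  - by apply: measurable_funB => //; exact: measurable_funD.
  - by move=> w; rewrite subr_ge0.
  - rewrite -(leeD2lE _ _ (Bfin n)) -integralDE//; last 2 first.
    + by apply: measurable_funB => //; exact: measurable_funD.
    + by move=> w; rewrite subr_ge0.
    under eq_integral do rewrite addrC subrK.
    rewrite integralDE// integral_cstE leeD2r//.
    exact: truncated_drift.
have lim w : A n w + b - B n w @[n --> \oo] --> (1 - rho) * V w.
  apply: cvg_near_cst; near=> n.
  have h1 : V w <= n%:R by near: n; exact: nbhs_infty_ger.
  have h2 : rho * V w + b <= n%:R by near: n; exact: nbhs_infty_ger.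
  by rewrite /A /B !min_l//; ring.
have := @Ele_fatou _ _ _ P (fun w => (1 - rho) * V w) b _ D _ _ lim.
move=> H; exists ((1 - rho)^-1 * b).
have := @EleZ _ _ _ P (1 - rho)^-1 _ _ _ (H _ _).
under [X in Ele _ X]eq_fun do rewrite mulKf ?gt_eqF//.
apply; first by rewrite invr_ge0 ltW.
- exact: measurable_funM.
- by move=> w; rewrite mulr_ge0// ltW.
Unshelve. all: by end_near. Qed.

End autoregression.

Lemma young {R : realFieldType} (x e : R) : 0 < e -> 2 * x <= e + e^-1 * x ^+ 2.
Proof.
move=> e0; rewrite -subr_ge0.
rewrite (_ : _ - _ = e^-1 * (x - e) ^+ 2); last by field; rewrite gt_eqF.
by rewrite mulr_ge0 ?sqr_ge0// invr_ge0 ltW.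
Qed.

Section moments.
Context {R : realType} {d : measure_display} {T : measurableType d}.
Variables (P : probability T R) (N : int -> T -> nat) (lam : int -> T -> R).
Variables (g0 : R -> nat -> R) (kappa1 kappa2 : R).
Hypothesis model : ingarch P N lam g0 kappa1 kappa2.

Let N_meas := ingarch_N_meas model.
Let lam_meas := ingarch_lam_meas model.
Let lam_ge0 := ingarch_lam_ge0 model.
Let cpois := ingarch_cpois model.
Let kappa1_ge0 := ingarch_kappa1 model.
Let kappa2_ge0 := ingarch_kappa2 model.
Let kappa_lt1 := ingarch_kappa_lt1 model.
Let g0_ge0 := ingarch_ge0 model.
Let g0_lip := ingarch_lip model.
Let lam_rec := ingarch_rec model.

Local Notation pmeas := (pmeas N lam).

Definition mean_sq_intensity : R := fine (\int[P]_w (lam 0 w ^+ 2)%:E).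
Local Notation mu2 := mean_sq_intensity.

Lemma integral_lam2 t : (\int[P]_w (lam t w ^+ 2)%:E = mu2%:E)%E.
Proof.
rewrite (law_pair model t (h := fun x _ => x ^+ 2)); last 2 first.
- by move=> _; exact: measurable_funX.
- by move=> x _; exact: sqr_ge0.
rewrite fineK// ge0_fin_numE; last by apply: integral_ge0 => w _; rewrite lee_fin sqr_ge0.
have [c [_ _ hc]] := second_moment model.
by rewrite (le_lt_trans hc)// ltry.
Qed.

Lemma Ele_lam2 t : Ele P (fun w => lam t w ^+ 2) mu2.
Proof.
split; first exact: measurable_funX.
- by move=> w; exact: sqr_ge0.
- by rewrite integral_lam2.
Qed.

Lemma mean_sq_intensity_ge0 : 0 <= mu2.
Proof. exact: Ele_ge0 (Ele_lam2 0). Qed.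

Lemma Ele_lam t : Ele P (lam t) (1 + mu2).
Proof.
apply: Ele_le (EleD (Ele_cst P ler01) (Ele_lam2 t)) _ _ _ => // w.
have := sqr_ge0 (lam t w - 1); rewrite sqrrB1 => h.
have := lam_ge0 t w; lra.
Qed.

Lemma Ele_cond t (h : R -> nat -> R) (s : R -> R) c :
  (forall k, measurable_fun setT (h ^~ k)) -> (forall x k, 0 <= h x k) ->
  (forall x, 0 <= x -> psum x (h x) (s x)) ->
  Ele P (fun w => s (lam t w)) c -> Ele P (fun w => h (lam t w) (N t w)) c.
Proof.
move=> mh h0 hs [_ _ sc]; split=> //; first exact: (pair_measurable model).
rewrite (@cond_expectation _ _ _ P N lam N_meas lam_meas lam_ge0 cpois t
  (fun k w => h (lam t w) k) (fun w => s (lam t w)))//.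
- by move=> k; exact: (pmeas_comp (mh k) (@pmeas_lam_next _ _ _ _ _ _ _ _ _ model t)).
- by move=> w; exact: hs.
Qed.

Lemma Ele_N2 t : Ele P (fun w => (N t w)%:R ^+ 2) (1 + mu2 + mu2).
Proof.
apply: (@Ele_cond t (fun _ k => k%:R ^+ 2) (fun x => x + x ^+ 2)) => //.
- by move=> x _; exact: psum_sqr.
- exact: EleD (Ele_lam t) (Ele_lam2 t).
Qed.

Lemma Ele_eps2 t : Ele P (fun w => ((N t w)%:R - lam t w) ^+ 2) (1 + mu2).
Proof.
apply: (@Ele_cond t (fun x k => (k%:R - x) ^+ 2) id).
- by move=> k; apply: measurable_funX; exact: measurable_funB.
- by move=> x k; exact: sqr_ge0.
- by move=> x _; exact: psum_variance.
- exact: Ele_lam.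
Qed.

Lemma Ele_pearson2 t : Ele P (fun w => pearson (lam t w) (N t w) ^+ 2) (2 * mu2).
Proof.
apply: (@Ele_cond t (fun x k => pearson x k ^+ 2) (fun x => 2 * x ^+ 2)).
- move=> k; apply: measurable_funX; apply: measurable_funB => //.
  by apply: measurable_funX; exact: measurable_funB.
- by move=> x k; exact: sqr_ge0.
- by move=> x _; exact: psum_pearson2.
- exact: EleZ (Ele_lam2 t).
Qed.

(** The Lipschitz bound gives [g0 0 0 <= lam 1 + lam 0 + N 0]. If [mu2] were 0, each term on the
    right would have mean at most [g0 0 0 / 4]. This makes the limiting variance positive. *)
Lemma mean_sq_intensity_gt0 : 0 < g0 0 0 -> 0 < mu2.
Proof.
move=> g00; rewrite lt_neqAle mean_sq_intensity_ge0 andbT; apply/eqP => mu0.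
pose e := g0 0 0 / 4.
have e0 : 0 < e by rewrite divr_gt0.
have El t : Ele P (lam t) e.
  have := EleD (Ele_cst P (ltW e0)) (EleZ _ (Ele_lam2 t) (a := e^-1)).
  rewrite -mu0 mulr0 addr0 invr_ge0 (ltW e0) => /(_ isT) H.
  apply: Ele_le H _ _ _ => // w; have := lam_ge0 t w; set x := lam t w => x0.
  have := young x e0; lra.
have EN : Ele P (fun w => (N 0 w)%:R) e.
  apply: (@Ele_cond 0 (fun _ k => k%:R) id) => //; by move=> x _; exact: psum_id.
have [_ _] := EleD (EleD (El 1) (El 0)) EN.
have : (\int[P]_w (g0 0 0)%:E <= \int[P]_w (lam 1 w + lam 0 w + (N 0 w)%:R)%:E)%E.
  have [mN _ _] := EN.
  apply: le_integralE => //.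
    by apply: measurable_funD => //; exact: measurable_funD.
  move=> w; have := g0_lip 0 (lam 0 w) 0 (N 0 w).
  have -> : g0 (lam 0 w) (N 0 w) = lam 1 w by rewrite [RHS]lam_rec subrr.
  rewrite !sub0r !normrN (ger0_norm (lam_ge0 0 w)) normr_nat => h.
  have := le_trans (ler_norm _) h.
  have := lam_ge0 0 w; set x := lam 0 w; set k := (N 0 w)%:R => x0.
  have k0 : 0 <= k :> R by exact: ler0n.
  have k1 : kappa1 <= 1 by have := kappa_lt1; have := kappa2_ge0; lra.
  have k2 : kappa2 <= 1 by have := kappa_lt1; have := kappa1_ge0; lra.
  have : kappa1 * x <= x by rewrite ler_piMl.
  have : kappa2 * k <= k by rewrite ler_piMl.
  lra.
move=> /le_trans h /h; rewrite integral_cstE lee_fin /e; lra.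
Qed.

(** [e i k w] is the increment at time [i] if the count is [k]. Separating [k] leaves a predictable
    function of [w], and the martingale property becomes the vanishing of a Poisson sum. *)
Definition mart (e : nat -> nat -> T -> R) m n w : R :=
  \sum_(m <= i < n) e i (N i%:Z w) w.

Lemma pmeas_measurable_fun t X : pmeas t X -> measurable_fun setT X.
Proof. exact: (@pmeas_measurable _ _ _ N lam N_meas lam_meas). Qed.

Lemma pmeas_mart e m n : (forall i k, (m <= i)%N -> pmeas (i%:Z - 1) (e i k)) ->
  pmeas (n%:Z - 1) (mart e m n).
Proof.
move=> me; elim: n => [|n IH].
  rewrite (_ : mart e m 0 = fun=> 0); first exact: measurable_cst.
  by apply/funext => w; rewrite /mart big_geq.
have [mn|nm] := leqP m n; last first.
  rewrite (_ : mart e m n.+1 = fun=> 0); first exact: measurable_cst.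
  by apply/funext => w; rewrite /mart big_geq.
rewrite (_ : mart e m n.+1 = fun w => mart e m n w + e n (N n%:Z w) w); last first.
  by apply/funext => w; rewrite /mart big_nat_recr.
have le1 : n%:Z - 1 <= n.+1%:Z - 1 by rewrite lerD2r lez_nat.
have le2 : n%:Z <= n.+1%:Z - 1 by rewrite -addn1 PoszD addrK.
apply: measurable_funD; first exact: (@pmeas_mono _ _ _ N lam _ _ _ le1 IH).
apply: (@pmeas_switch _ _ _ N lam _ _ _ le2) => k.
exact: (@pmeas_mono _ _ _ N lam _ _ _ le1 (me n k mn)).
Qed.

Section orthogonality.
Variables (e : nat -> nat -> T -> R) (q : nat -> T -> R) (m : nat).
Hypothesis pe : forall i k, (m <= i)%N -> pmeas (i%:Z - 1) (e i k).
Hypothesis e0 : forall i w, (m <= i)%N -> psum (lam i%:Z w) (e i ^~ w) 0.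
Hypothesis e2 : forall i w, (m <= i)%N ->
  psum (lam i%:Z w) (fun k => e i k w ^+ 2) (q i w).

Lemma mart_measurable n : measurable_fun setT (mart e m n).
Proof. exact: pmeas_measurable_fun (@pmeas_mart e m n pe). Qed.

Lemma increment_measurable i : (m <= i)%N -> measurable_fun setT (q i).
Proof.
move=> mi; apply: (@psum_measurable _ _ _ (fun k w => e i k w ^+ 2) (lam i%:Z) (q i)) => //.
  move=> k; apply: measurable_funX; exact: pmeas_measurable_fun (pe k mi).
by move=> w; exact: e2.
Qed.

Lemma increment_ge0 i w : (m <= i)%N -> 0 <= q i w.
Proof.
move=> mi; have h k : 0 <= e i k w ^+ 2 by exact: sqr_ge0.
exact: (psum_le (lam_ge0 i%:Z w) h (@psum_cst _ 0 (lam i%:Z w)) (@e2 i w mi)).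
Qed.

(** The last increment is averaged inside the complete square: the conditional mean of [(M + e)^2]
    is [M^2 + q]. The integrand stays nonnegative, so the cross term [2 M e] never has to be
    integrated on its own. *)
Lemma mart_variance n : (\int[P]_w (mart e m n w ^+ 2)%:E =
  \int[P]_w (\sum_(m <= i < n) q i w)%:E)%E.
Proof.
have [mn|nm] := leqP m n; last first.
  by apply: eq_integral => w _; rewrite /mart !big_geq ?expr0n// ltnW.
rewrite -(subnKC mn); elim: (n - m)%N => [|p IH].
  by apply: eq_integral => w _; rewrite /mart addn0 !big_geq ?expr0n.
have mp : (m <= m + p)%N by exact: leq_addr.
rewrite addnS; set n' := (m + p)%N in mp IH *.
have mM : pmeas (n'%:Z - 1) (mart e m n') by exact: pmeas_mart.
transitivity (\int[P]_w ((mart e m n' w + e n' (N n'%:Z w) w) ^+ 2)%:E)%E.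
  by apply: eq_integral => w _; rewrite /mart big_nat_recr.
transitivity (\int[P]_w (mart e m n' w ^+ 2 + q n' w)%:E)%E.
  apply: (@cond_expectation _ _ _ P N lam N_meas lam_meas lam_ge0 cpois n'%:Z
    (fun k w => (mart e m n' w + e n' k w) ^+ 2)).
  - by move=> k; apply: measurable_funX; apply: measurable_funD; [exact: mM|exact: pe].
  - by move=> k w; exact: sqr_ge0.
  - move=> w; have := psumD (psumD (@psum_cst _ (mart e m n' w ^+ 2) (lam n' w))
       (@psumZ _ (2 * mart e m n' w) _ _ _ (@e0 n' w mp))) (@e2 n' w mp).
    by rewrite mulr0 addr0; apply: eq_psum => k; ring.
have mq := increment_measurable mp.
have q0 w : 0 <= q n' w by exact: increment_ge0.
rewrite integralDE//; last 2 first.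
- by apply: measurable_funX; exact: mart_measurable.
- by move=> w; exact: sqr_ge0.
rewrite IH -integralDE//.
- by apply: eq_integral => w _; rewrite big_nat_recr.
- by apply: measurable_sum_nat => i; exact: increment_measurable.
- move=> w; rewrite big_nat; apply: sumr_ge0 => i /andP[mi _]; exact: increment_ge0.
Qed.

Lemma Ele_mart_variance n c : (forall i, (m <= i)%N -> Ele P (q i) c) ->
  Ele P (fun w => mart e m n w ^+ 2) ((n - m)%:R * c).
Proof.
move=> qc; split.
- by apply: measurable_funX; exact: mart_measurable.
- by move=> w; exact: sqr_ge0.
rewrite mart_variance.
have [_ _] := @Ele_sum_nat _ _ _ P m n q c (fun i => fun mi => qc i (proj1 (andP mi))).
exact.
Qed.

End orthogonality.

End moments.

(** * Law of large numbers *)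

Lemma max_lipschitz {R : realDomainType} (c x y : R) :
  `|Num.max x c - Num.max y c| <= `|x - y|.
Proof.
have h1 := ler_norm (x - y); have h2 := ler_norm (y - x); rewrite distrC in h2.
have [?|?] := leP x c; have [?|?] := leP y c; rewrite ler_norml; apply/andP; split; lra.
Qed.

Lemma min_lipschitz {R : realDomainType} (c x y : R) :
  `|Num.min x c - Num.min y c| <= `|x - y|.
Proof.
have h1 := ler_norm (x - y); have h2 := ler_norm (y - x); rewrite distrC in h2.
have [?|?] := leP x c; have [?|?] := leP y c; rewrite ler_norml; apply/andP; split; lra.
Qed.

Section law_of_large_numbers.
Context {R : realType} {d : measure_display} {T : measurableType d}.
Variables (P : probability T R) (N : int -> T -> nat) (lam : int -> T -> R).
Variables (g0 : R -> nat -> R) (kappa1 kappa2 : R).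
Hypothesis model : ingarch P N lam g0 kappa1 kappa2.

Let N_meas := ingarch_N_meas model.
Let lam_meas := ingarch_lam_meas model.
Let lam_ge0 := ingarch_lam_ge0 model.
Let cpois := ingarch_cpois model.
Let kappa1_ge0 := ingarch_kappa1 model.
Let kappa2_ge0 := ingarch_kappa2 model.
Let kappa_lt1 := ingarch_kappa_lt1 model.
Let g0_ge0 := ingarch_ge0 model.
Let g0_lip := ingarch_lip model.
Let lam_rec := ingarch_rec model.

Local Notation pmeas := (pmeas N lam).
Local Notation mu2 := (mean_sq_intensity P lam).
Local Notation kappa := (kappa1 + kappa2).

Definition lip_class (B L : R) (g : R -> R) :=
  (forall x, 0 <= g x <= B) /\ (forall x y : R, `|g x - g y| <= L * `|x - y|).

(** The Markov operator of the intensity chain, mapping [g] to the conditional mean of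
    [g (lam (t + 1))] given [lam t = x]; the maximum extends it to negative [x]. *)
Definition transition (g : R -> R) (x : R) : R :=
  poisE (fun k => g (g0 x k)) (Num.max x 0).

Lemma psum_transition B L g x : lip_class B L g -> 0 <= x ->
  psum x (fun k => g (g0 x k)) (transition g x).
Proof.
move=> [gB _] x0; rewrite /transition max_l//.
apply: (@psum_poisE _ B) => // k.
by have /andP[? ?] := gB (g0 x k); rewrite ger0_norm.
Qed.

(** The state enters twice: through the first argument of [g0] at a fixed Poisson rate, at cost
    [kappa1], and through the rate, at cost [kappa2] by [poisE_lipschitz]. Iterates of the operator
    therefore flatten geometrically. *)
Lemma transition_lip_class B L g : 0 <= L -> lip_class B L g ->
  lip_class B (kappa * L) (transition g).
Proof.
move=> L0 [gB gL].
have gN x : `|g x| <= B by have /andP[? ?] := gB x; rewrite ger0_norm.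
have m0 (x : R) : 0 <= Num.max x 0 by rewrite le_max lexx orbT.
split; first by move=> x; exact: poisE_range.
move=> x y; rewrite /transition.
set hx := fun k => g (g0 x k); set hy := fun k => g (g0 y k).
have sx := psum_poisE (fun k => gN (g0 x k)) (m0 x).
have sy := psum_poisE (fun k => gN (g0 y k)) (m0 x).
have d1 : `|poisE hx (Num.max x 0) - poisE hy (Num.max x 0)| <= L * kappa1 * `|x - y|.
  have hk k : `|hx k - hy k| <= L * kappa1 * `|x - y|.
    rewrite (le_trans (gL _ _))// -mulrA ler_wpM2l//.
    by have := g0_lip x y k k; rewrite subrr normr0 mulr0 addr0.
  rewrite ler_norml; apply/andP; split.
    apply: (psum_le (m0 x) _ (@psum_cst _ _ _) (psumB sx sy)) => k.
    by have := hk k; rewrite ler_norml => /andP[].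
  apply: (psum_le (m0 x) _ (psumB sx sy) (@psum_cst _ _ _)) => k.
  exact: (le_trans (ler_norm _) (hk k)).
have d2 : `|poisE hy (Num.max x 0) - poisE hy (Num.max y 0)| <= L * kappa2 * `|x - y|.
  apply: (@le_trans _ _ (L * kappa2 * `|Num.max x 0 - Num.max y 0|)).
    apply: (@poisE_lipschitz _ B) => [k|k|//|//]; first exact: gN.
    rewrite /hy (le_trans (gL _ _))// ler_wpM2l//.
    have := g0_lip y y k.+1 k; rewrite subrr normr0 mulr0 add0r -natrB//.
    by rewrite subSnn normr1 mulr1.
  rewrite ler_wpM2l ?mulr_ge0//.
  have [xh|xh] := lerP 0 x; have [yh|yh] := lerP 0 y.
  - by [].
  - by rewrite subr0 ger0_norm// (le_trans _ (ler_norm _))// lerDl oppr_ge0 ltW.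
  - rewrite sub0r normrN ger0_norm// distrC (le_trans _ (ler_norm _))// lerDl.
    by rewrite oppr_ge0 ltW.
  - by rewrite subrr normr0.
rewrite (le_trans (ler_distD (poisE hy (Num.max x 0)) _ _))//.
by rewrite (_ : kappa * L * `|x - y| = L * kappa1 * `|x - y| + L * kappa2 * `|x - y|) ?lerD//; ring.
Qed.

Section lipschitz_averages.
Variables (B L : R) (g : R -> R).
Hypotheses (L0 : 0 <= L) (gBL : lip_class B L g).

Let Q k := iter k transition g.

Lemma iter_lip_class k : lip_class B (kappa ^+ k * L) (Q k).
Proof.
elim: k => [|k IH]; first by rewrite expr0 mul1r.
rewrite exprS -mulrA; apply: transition_lip_class => //.
by rewrite mulr_ge0// exprn_ge0// addr_ge0.
Qed.

Lemma iter_measurable k : measurable_fun setT (Q k).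
Proof. exact: lipschitz_measurable (iter_lip_class k).2. Qed.

Lemma iter_ge0 k x : 0 <= Q k x.
Proof. by have /andP[] := (iter_lip_class k).1 x. Qed.

Lemma psum_iter k w : psum (lam 0 w) (fun j => Q k (g0 (lam 0 w) j)) (Q k.+1 (lam 0 w)).
Proof. exact: psum_transition (iter_lip_class k) (lam_ge0 0 w). Qed.

Definition mean_lam : R := fine (\int[P]_w (g (lam 0 w))%:E).

Lemma integral_iter k : (\int[P]_w (Q k (lam 0 w))%:E = mean_lam%:E)%E.
Proof.
elim: k => [|k IH].
  rewrite /mean_lam fineK// ge0_fin_numE; last first.
    by apply: integral_ge0 => w _; rewrite lee_fin (iter_ge0 0).
  apply: (@le_lt_trans _ _ (\int[P]_w B%:E)%E); last by rewrite integral_cstE ltry.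
  apply: le_integralE => //.
  - exact: (measurableT_comp (iter_measurable 0) (lam_meas 0)).
  - by move=> w; exact: (iter_ge0 0).
  - by move=> w; have /andP[] := gBL.1 (lam 0 w).
rewrite -IH -(law_pair model 1 (h := fun x _ => Q k x)); last 2 first.
- by move=> _; exact: iter_measurable.
- by move=> x _; exact: iter_ge0.
transitivity (\int[P]_w (Q k (g0 (lam 0 w) (N 0 w)))%:E)%E; last first.
  by apply: eq_integral => w _; rewrite (lam_rec 1) subrr.
rewrite (@cond_expectation _ _ _ P N lam N_meas lam_meas lam_ge0 cpois 0
  (fun j w => Q k (g0 (lam 0 w) j)) (fun w => Q k.+1 (lam 0 w)))//.
- move=> j; have mc := measurableT_comp (iter_measurable k) (g0_measurable model j).
  exact: (pmeas_comp mc (@pmeas_lam_next _ _ _ _ _ _ _ _ _ model 0)).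
- by move=> j w; exact: iter_ge0.
- by move=> w; exact: psum_iter.
Qed.

(** [Q k] has Lipschitz constant [kappa^k L] and stationary mean [mean_lam]; the bound on
    [Q k x - Q k (lam 0)] is averaged over the law of [lam 0], whose mean is at most [1 + mu2]. *)
Lemma iter_near_mean k x : 0 <= x -> `|Q k x - mean_lam| <= kappa ^+ k * L * (x + (1 + mu2)).
Proof.
move=> x0; set c := kappa ^+ k * L.
have c0 : 0 <= c by rewrite mulr_ge0// exprn_ge0// addr_ge0.
have [rB rL] := iter_lip_class k.
have E : Ele P (fun w => c * lam 0 w) (c * (1 + mu2)) by exact: EleZ (Ele_lam model 0).
have mQ : measurable_fun setT (fun w => Q k (lam 0 w)).
  exact: (measurableT_comp (iter_measurable k) (lam_meas 0)).
have QL w : `|Q k x - Q k (lam 0 w)| <= c * x + c * lam 0 w.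
  rewrite (le_trans (rL _ _))// -mulrDr ler_wpM2l//.
  by rewrite (le_trans (ler_normB _ _))// !ger0_norm.
have cx0 : 0 <= c * x by rewrite mulr_ge0.
have Y0 w : 0 <= c * x + c * lam 0 w by rewrite addr_ge0// mulr_ge0.
have [mY _ Yc] := EleD (Ele_cst P cx0) E.
rewrite mulrDr ler_norml; apply/andP; split.
- rewrite lerNl opprB lerBlDl -lee_fin -(integral_iter k).
  apply: (@le_trans _ _ (\int[P]_w (Q k x + (c * x + c * lam 0 w))%:E)%E).
    apply: le_integralE => //; first exact: measurable_funD.
      by move=> w; exact: iter_ge0.
    by move=> w; rewrite -lerBlDl (le_trans _ (QL w))// distrC ler_norm.
  by rewrite integralDE// ?integral_cstE ?EFinD ?leeD2l// => w; exact: iter_ge0.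
- rewrite lerBlDl -lee_fin -[X in (X <= _)%E](integral_cstE P).
  apply: (@le_trans _ _ (\int[P]_w (Q k (lam 0 w) + (c * x + c * lam 0 w))%:E)%E).
    apply: le_integralE => //; first exact: measurable_funD.
      by move=> w; exact: iter_ge0.
    by move=> w; rewrite -lerBlDl (le_trans _ (QL w))// ler_norm.
  rewrite integralDE//; last by move=> w; exact: iter_ge0.
  by rewrite integral_iter EFinD leeD2l.
Qed.

(* Poisson equation: with [G = \sum_(j < K) Q j] one has [g - Q K = G - transition G],
   so that the sum of [g (lam t)] is a martingale up to a boundary term and
   the nearly constant [Q K (lam t)]. *)
Lemma average_decomposition K : exists e, exists q : nat -> T -> R,
  [/\ (forall i k, pmeas (i%:Z - 1) (e i k)),
      (forall i w, psum (lam i%:Z w) (e i ^~ w) 0),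
      (forall i w, psum (lam i%:Z w) (fun k => e i k w ^+ 2) (q i w)),
      (forall i, Ele P (q i) ((K%:R * B) ^+ 2)) &
      forall n w, `|\sum_(1 <= t < n.+1) (g (lam t%:Z w) - Q K (lam t%:Z w))|
        <= `|mart N e 1 n.+1 w| + K%:R * B].
Proof.
pose G x := \sum_(j < K) Q j x; pose G1 x := \sum_(j < K) Q j.+1 x.
have rng (F : nat -> R -> R) x : (forall j, 0 <= F j x <= B) ->
    0 <= \sum_(j < K) F j x <= K%:R * B.
  move=> FB; rewrite sumr_ge0/=; last by move=> j _; have /andP[] := FB j.
  rewrite -[K in K%:R]card_ord mulr_natl -sumr_const ler_sum// => j _.
  by have /andP[] := FB j.
have GB x : 0 <= G x <= K%:R * B by apply: rng => j; exact: (iter_lip_class j).1.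
have G1B x : 0 <= G1 x <= K%:R * B by apply: (rng (fun j => Q j.+1)) => j; exact: (iter_lip_class j.+1).1.
have mG : measurable_fun setT G by apply: measurable_sum => j; exact: iter_measurable.
have mG1 : measurable_fun setT G1 by apply: measurable_sum => j; exact: iter_measurable.
(* [g0 (lam i) k] is the next intensity if the count is [k], so this is [G] at time [i + 1] minus
   its conditional mean. *)
pose e (i k : nat) w := G (g0 (lam i%:Z w) k) - G1 (lam i%:Z w).
have eB i k w : `|e i k w| <= K%:R * B.
  have /andP[a1 a2] := GB (g0 (lam i%:Z w) k); have /andP[b1 b2] := G1B (lam i%:Z w).
  by rewrite ler_norml /e; apply/andP; split; lra.
have KB0 : 0 <= K%:R * B by have /andP[] := GB 0; exact: le_trans.
have e2B i k w : e i k w ^+ 2 <= (K%:R * B) ^+ 2.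
  by rewrite -[leLHS]real_normK ?num_real// lerXn2r ?nnegrE.
have e2N i k w : `|e i k w ^+ 2| <= (K%:R * B) ^+ 2 by rewrite ger0_norm ?sqr_ge0.
have pe i k : pmeas (i%:Z - 1) (e i k).
  apply: measurable_funB.
    have mc := measurableT_comp mG (g0_measurable model k).
    exact: (pmeas_comp mc (@pmeas_lam_next _ _ _ _ _ _ _ _ _ model i%:Z)).
  exact: (pmeas_comp mG1 (@pmeas_lam_next _ _ _ _ _ _ _ _ _ model i%:Z)).
pose q (i : nat) w := poisE (fun k => e i k w ^+ 2) (lam i%:Z w).
have sq i w : psum (lam i%:Z w) (fun k => e i k w ^+ 2) (q i w).
  exact: (psum_poisE (fun k => e2N i k w) (lam_ge0 i%:Z w)).
exists e, q; split => //.
- move=> i w; rewrite -(subrr (G1 (lam i%:Z w))); apply: psumB; last exact: psum_cst.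
  rewrite /G /G1; elim: K {G G1 rng GB G1B mG mG1 e eB KB0 e2B e2N pe q sq} => [|K IH].
    by rewrite big_ord0; under [fun _ => _]eq_fun do rewrite big_ord0; exact: psum_cst.
  rewrite big_ord_recr/=.
  have := psumD IH (psum_transition (iter_lip_class K) (lam_ge0 i%:Z w)).
  by apply: eq_psum => k; rewrite big_ord_recr.
- move=> i; apply: Ele_le (Ele_cst P (sqr_ge0 _)) _ _ _.
  + apply: psum_measurable (lam_meas i%:Z) _ (sq i) => // k.
    by apply: measurable_funX; exact: (pmeas_measurable_fun model (pe i k)).
  + by move=> w; apply: psum_le (lam_ge0 _ _) _ (@psum_cst _ 0 _) (sq i w) => k; exact: sqr_ge0.
  + by move=> w; apply: psum_le (lam_ge0 _ _) _ (sq i w) (@psum_cst _ _ _) => k; exact: e2B.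
move=> n w.
have GQ x : g x - Q K x = G x - G1 x.
  rewrite /G /G1 -sumrB -(big_mkord predT (fun j => Q j x - Q j.+1 x)).
  rewrite (@telescope_sumr_eq _ 0 K (fun j => - Q j x))//; first by rewrite opprK addrC.
  by move=> j _; rewrite opprK addrC.
have E : \sum_(1 <= t < n.+1) (g (lam t%:Z w) - Q K (lam t%:Z w)) =
    mart N e 1 n.+1 w + (G (lam 1 w) - G (lam n.+1%:Z w)).
  rewrite /mart; elim: n => [|n IH]; first by rewrite !big_geq// subrr addr0.
  rewrite big_nat_recr//= IH [in RHS]big_nat_recr//= GQ /e.
  have -> : g0 (lam n.+1%:Z w) (N n.+1%:Z w) = lam n.+2%:Z w.
    by rewrite [RHS]lam_rec -[n.+2]addn1 PoszD addrK.
  ring.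
rewrite E (le_trans (ler_normD _ _))// lerD2l.
have /andP[a1 a2] := GB (lam 1 w); have /andP[b1 b2] := GB (lam n.+1%:Z w).
by rewrite ler_norml; apply/andP; split; lra.
Qed.

Lemma average_lipschitz e : 0 < e -> \forall n \near \oo,
  Ele P (fun w => `|n%:R^-1 * (\sum_(1 <= t < n.+1) g (lam t%:Z w)) - mean_lam|) e.
Proof.
move=> e0; have mu0 : 0 < 1 + mu2 by rewrite ltr_pwDl// (mean_sq_intensity_ge0 model).
have kap0 : 0 <= kappa by rewrite addr_ge0.
have [K _ /(_ K (leqnn K)) Ke] : \forall K \near \oo, kappa ^+ K * L * (1 + mu2) <= e / 8.
  have : kappa ^+ n * (L * (1 + mu2)) @[n --> \oo] --> 0 * (L * (1 + mu2)).
    by apply: cvgMl; apply: cvg_expr; rewrite ger0_norm.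
  rewrite mul0r => /cvgr_dist_le /(_ (e / 8)) h.
  have /h : 0 < e / 8 by rewrite divr_gt0.
  apply: filterS => n; rewrite sub0r normrN mulrA; apply: le_trans; exact: ler_norm.
have [xi [q [pe pxi pq Eq dec]]] := average_decomposition K.
set c := kappa ^+ K * L in Ke.
have c0 : 0 <= c by rewrite mulr_ge0// exprn_ge0.
pose KB := K%:R * B.
have KB0 : 0 <= KB by have /andP[h1 h2] := gBL.1 0; rewrite mulr_ge0// (le_trans h1).
(* By Young's inequality [|m| <= e1 n + m^2 / (e1 n)], and the mean of [m^2] is of order [n]: after
   division by [n] the martingale costs [e1] plus a term of order [1 / n]. *)
pose e1 := e / 4; have e10 : 0 < e1 by rewrite divr_gt0.
near=> n.
have n0 : 0 < n%:R :> R by rewrite ltr0n; near: n; exact: nbhs_infty_gt.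
have a0 : 0 < e1 * n%:R by rewrite mulr_gt0.
have Em := @Ele_mart_variance _ _ _ _ _ _ _ _ _ model xi q 1
  (fun i k _ => pe i k) (fun i w _ => pxi i w) (fun i w _ => pq i w) n.+1 (KB ^+ 2) (fun i _ => Eq i).
have Es : Ele P (fun w => \sum_(1 <= t < n.+1) (c * lam t%:Z w + c * (1 + mu2)))
    ((n.+1 - 1)%:R * (c * (1 + mu2) + c * (1 + mu2))).
  apply: Ele_sum_nat => t _; apply: EleD; first exact: EleZ (Ele_lam model t%:Z).
  by apply: Ele_cst; rewrite mulr_ge0// ltW.
have ai0 : 0 <= (e1 * n%:R)^-1 by rewrite invr_ge0 ltW.
have ni0 : 0 <= n%:R^-1 :> R by rewrite invr_ge0 ltW.
have EY := EleZ ni0 (EleD (EleD (Ele_cst P (ltW a0)) (EleZ ai0 Em)) (EleD (Ele_cst P KB0) Es)).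
apply: Ele_weaken; first apply: (Ele_le EY).
- apply: measurableT_comp => //; apply: measurable_funB => //; apply: measurable_funM => //.
  by apply: measurable_sum => t; exact: (measurableT_comp (iter_measurable 0) (lam_meas t%:Z)).
- by [].
- move=> w; set m := mart _ _ _ _ _.
  have -> : n%:R^-1 * (\sum_(1 <= t < n.+1) g (lam t%:Z w)) - mean_lam =
      n%:R^-1 * (\sum_(1 <= t < n.+1) (g (lam t%:Z w) - Q K (lam t%:Z w))
        + \sum_(1 <= t < n.+1) (Q K (lam t%:Z w) - mean_lam)).
    rewrite -big_split/=; under [in RHS]eq_bigr do rewrite addrA subrK.
    by rewrite sumrB sumr_const_nat subn1/= -[mean_lam *+ n]mulr_natl mulrBr mulKf// gt_eqF.
  rewrite normrM (ger0_norm ni0) ler_wpM2l// (le_trans (ler_normD _ _))//.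
  have h1 := dec n w; rewrite -/m -/KB in h1.
  have h2 : `|\sum_(1 <= t < n.+1) (Q K (lam t%:Z w) - mean_lam)| <=
      \sum_(1 <= t < n.+1) (c * lam t%:Z w + c * (1 + mu2)).
    rewrite (le_trans (ler_norm_sum _ _ _))// ler_sum// => t _.
    by rewrite -mulrDr iter_near_mean.
  have h3 := young `|m| a0; rewrite real_normK ?num_real// in h3.
  have h4 := normr_ge0 m.
  lra.
- rewrite subn1/=.
  have h1 : (e1 * n%:R)^-1 * (n%:R * KB ^+ 2) = e1^-1 * KB ^+ 2.
    by field; rewrite !gt_eqF.
  have -> : n%:R^-1 * (e1 * n%:R + (e1 * n%:R)^-1 * (n%:R * KB ^+ 2)
      + (KB + n%:R * (c * (1 + mu2) + c * (1 + mu2)))) =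
    e1 + (e1^-1 * KB ^+ 2 + KB) / n%:R + 2 * (c * (1 + mu2)).
    by rewrite h1; field; rewrite !gt_eqF.
  have h2 : (e1^-1 * KB ^+ 2 + KB) / n%:R <= e / 4.
    rewrite ler_pdivrMr// [leRHS]mulrC -ler_pdivrMr ?divr_gt0//.
    by near: n; exact: nbhs_infty_ger.
  have e1E : e1 = e / 4 by []. move: h2 Ke e1E; lra.
Unshelve. all: by end_near. Qed.

End lipschitz_averages.

(** The square is neither bounded nor Lipschitz, so it is truncated at [M]. The part cut off is
    small in mean by dominated convergence at time 0, hence at all times by stationarity. *)
Lemma law_of_large_numbers e : 0 < e -> \forall n \near \oo,
  Ele P (fun w => `|n%:R^-1 * (\sum_(1 <= t < n.+1) lam t%:Z w ^+ 2) - mu2|) e.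
Proof.
move=> e0; have e4 : 0 < e / 4 by rewrite divr_gt0.
pose g (M x : R) := Num.min (Num.max x 0) M ^+ 2.
have r (M z : R) : 0 <= M -> 0 <= Num.min (Num.max z 0) M <= M.
  by move=> M0; rewrite le_min M0 le_max lexx orbT/= ge_min lexx orbT.
have gclass M : 0 <= M -> lip_class (M ^+ 2) (2 * M) (g M).
  move=> M0; split=> [x|x y].
    by rewrite sqr_ge0/= lerXn2r ?nnegrE//; have /andP[] := r M x M0.
  rewrite /g subr_sqr normrM mulrC.
  have /andP[x1 x2] := r M x M0; have /andP[y1 y2] := r M y M0.
  apply: ler_pM => //; first by rewrite ger0_norm ?addr_ge0//; lra.
  by rewrite (le_trans (min_lipschitz _ _ _))// max_lipschitz.
pose h (M x : R) := `|x ^+ 2 - g M x|.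
have hE M x : 0 <= M -> 0 <= x -> h M x = x ^+ 2 - g M x.
  move=> M0 x0; rewrite /h /g max_l// ger0_norm// subr_ge0.
  by rewrite lerXn2r ?nnegrE ?le_min ?x0// ge_min lexx.
have hx M x : 0 <= M -> 0 <= x -> 0 <= h M x <= x ^+ 2.
  by move=> M0 x0; rewrite normr_ge0 hE//= gerBl sqr_ge0.
have mg M : 0 <= M -> measurable_fun setT (g M).
  by move=> /gclass[_]; exact: lipschitz_measurable.
have mh M : 0 <= M -> measurable_fun setT (h M).
  move=> M0; apply: measurableT_comp => //; apply: measurable_funB; last exact: mg.
  exact: measurable_funX.
have [K _ /(_ K (leqnn K)) hK] : \forall k \near \oo, Ele P (fun w => h k%:R (lam 0 w)) (e / 4).
  apply: (Ele_dominated (Ele_lam2 model 0)) e4.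
  - by move=> k; exact: (measurableT_comp (mh _ (ler0n _ _)) (lam_meas 0)).
  - by move=> k w; exact: hx.
  - move=> w; apply: cvg_near_cst; apply: filterS (nbhs_infty_ger (lam 0 w)) => k wk.
    by rewrite hE// /g max_l// min_l ?subrr.
set M := K%:R in hK; have M0 : 0 <= M by exact: ler0n.
have M20 : 0 <= 2 * M by rewrite mulr_ge0.
have hKt t : Ele P (fun w => h M (lam t w)) (e / 4).
  apply: (@Ele_stationary _ _ _ _ _ _ _ _ _ model t (fun x _ => h M x)) => [_|x _|//].
    exact: mh.
  exact: normr_ge0.
have near_mean : `|mean_lam (g M) - mu2| <= e / 4.
  have [_ _ hKe] := hK.
  have hsplit : (mu2%:E = \int[P]_w (h M (lam 0 w))%:E + (mean_lam (g M))%:E)%E.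
    rewrite -(integral_lam2 model 0) -(integral_iter M20 (gclass _ M0) 0) -integralDE//.
    - by apply: eq_integral => w _ /=; rewrite hE// subrK.
    - exact: (measurableT_comp (mh _ M0) (lam_meas 0)).
    - exact: (measurableT_comp (mg _ M0) (lam_meas 0)).
    - by move=> w; exact: normr_ge0.
    - by move=> w; exact: sqr_ge0.
  rewrite distrC ler_norml; apply/andP; split.
    apply: (@le_trans _ _ 0); first by rewrite oppr_le0 ltW.
    rewrite subr_ge0 -lee_fin hsplit -[leLHS]add0e leeD2r//.
    by apply: integral_ge0 => w _; rewrite lee_fin; exact: normr_ge0.
  by rewrite lerBlDr -lee_fin hsplit EFinD leeD2r.
have avg := average_lipschitz M20 (gclass _ M0) e4.
near=> n.
have n0 : 0 < n%:R :> R by rewrite ltr0n; near: n; exact: nbhs_infty_gt.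
have ni0 : 0 <= n%:R^-1 :> R by rewrite invr_ge0 ltW.
have An : Ele P (fun w => `|n%:R^-1 * (\sum_(1 <= t < n.+1) g M (lam t%:Z w)) - mean_lam (g M)|) (e / 4).
  by near: n; exact: avg.
have Eh := EleZ ni0 (@Ele_sum_nat _ _ _ P 1 n.+1 (fun t w => h M (lam t%:Z w)) (e / 4) (fun t _ => hKt t%:Z)).
have EY := EleD (EleD An Eh) (Ele_cst P (ltW e4)).
apply: Ele_weaken; first apply: (Ele_le EY).
- apply: measurableT_comp => //; apply: measurable_funB => //; apply: measurable_funM => //.
  by apply: measurable_sum => t; apply: measurable_funX; exact: lam_meas.
- by [].
- move=> w.
  set S := \sum_(1 <= t < n.+1) g M (lam t%:Z w); set H := \sum_(1 <= t < n.+1) h M (lam t%:Z w).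
  have -> : n%:R^-1 * (\sum_(1 <= t < n.+1) lam t%:Z w ^+ 2) - mu2 =
      (n%:R^-1 * S - mean_lam (g M)) + n%:R^-1 * H + (mean_lam (g M) - mu2).
    have -> : \sum_(1 <= t < n.+1) lam t%:Z w ^+ 2 = S + H.
      by rewrite -big_split/=; apply: eq_bigr => t _; rewrite hE// addrC subrK.
    by ring.
  rewrite (le_trans (ler_normD _ _))// lerD// (le_trans (ler_normD _ _))// lerD2l.
  by rewrite ger0_norm//; apply: mulr_ge0 => //; apply: sumr_ge0 => t _; exact: normr_ge0.
- rewrite subn1/= mulrA mulVf ?gt_eqF// mul1r; lra.
Unshelve. all: by end_near. Qed.

End law_of_large_numbers.

(** * Central limit theorem *)

Section bounded_expectation.
Context {R : realType} {d : measure_display} {T : measurableType d}.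
Variable P : probability T R.
Implicit Types F G : T -> R.

Definition unit_rv F := measurable_fun setT F /\ forall w, 0 <= F w <= 1.

Definition Ex F : R := fine (\int[P]_w (F w)%:E).

Lemma Ex_fin F : unit_rv F -> (\int[P]_w (F w)%:E = (Ex F)%:E)%E.
Proof.
move=> [mF F01]; rewrite fineK// ge0_fin_numE; last first.
  by apply: integral_ge0 => w _; rewrite lee_fin; have /andP[] := F01 w.
apply: (@le_lt_trans _ _ (\int[P]_w (1:R)%:E)%E); last by rewrite integral_cstE ltry.
by apply: le_integralE => // w; have /andP[] := F01 w.
Qed.

Lemma eq_Ex F G : (\int[P]_w (F w)%:E = \int[P]_w (G w)%:E)%E -> Ex F = Ex G.
Proof. by rewrite /Ex => ->. Qed.

Lemma Ex_le F G r c : unit_rv F -> unit_rv G -> (forall w, F w <= G w + r w) ->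
  Ele P r c -> Ex F <= Ex G + c.
Proof.
move=> uF uG FG [mr r0 rc]; rewrite -lee_fin EFinD -!Ex_fin//.
have [mF F01] := uF; have [mG G01] := uG.
have F0 w : 0 <= F w by have /andP[] := F01 w.
have G0 w : 0 <= G w by have /andP[] := G01 w.
apply: (@le_trans _ _ (\int[P]_w (G w + r w)%:E)%E).
  by apply: le_integralE => //; exact: measurable_funD.
by rewrite integralDE// leeD2l.
Qed.

Lemma Ex_dist F G r c : unit_rv F -> unit_rv G -> (forall w, `|F w - G w| <= r w) ->
  Ele P r c -> `|Ex F - Ex G| <= c.
Proof.
move=> uF uG FG rc; rewrite ler_norml; apply/andP; split.
  rewrite lerNl opprB lerBlDl; apply: Ex_le rc => // w.
  by rewrite -lerBlDl (le_trans _ (FG w))// distrC ler_norm.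
rewrite lerBlDl; apply: Ex_le rc => // w.
by rewrite -lerBlDl (le_trans _ (FG w))// ler_norm.
Qed.

Lemma Ex_indic A : measurable A -> (P A = (Ex (\1_A))%:E)%E.
Proof.
move=> mA; rewrite -Ex_fin ?integral_indic ?setIT//.
by split; [exact: measurable_indic|move=> w; rewrite indicE ler0n lern1 leq_b1].
Qed.

End bounded_expectation.

Lemma measurable_Phi {R : realType} : measurable_fun setT (@Phi R).
Proof.
apply: (@lipschitz_measurable _ _ 16) => x y; exact: Phi_lipschitz.
Qed.

Lemma measurable_inv_sqrt {R : realType} : measurable_fun setT (fun v : R => (Num.sqrt v)^-1).
Proof.
rewrite (_ : (fun v => _) = (fun x : R => x `^ (-1)) \o @Num.sqrt R); last first.
  by apply/funext => v /=; rewrite powR_inv1// sqrtr_ge0.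
apply: (measurableT_comp (measurable_powR (-1))).
by apply: continuous_measurable_fun; exact: sqrt_continuous.
Qed.

Section central_limit_theorem.
Context {R : realType} {d : measure_display} {T : measurableType d}.
Variables (P : probability T R) (N : int -> T -> nat) (lam : int -> T -> R).
Variables (g0 : R -> nat -> R) (kappa1 kappa2 : R).
Hypothesis model : ingarch P N lam g0 kappa1 kappa2.

Let N_meas := ingarch_N_meas model.
Let lam_meas := ingarch_lam_meas model.
Let lam_ge0 := ingarch_lam_ge0 model.
Let cpois := ingarch_cpois model.
Let kappa1_ge0 := ingarch_kappa1 model.
Let kappa2_ge0 := ingarch_kappa2 model.
Let kappa_lt1 := ingarch_kappa_lt1 model.
Let g0_ge0 := ingarch_ge0 model.

Local Notation pmeas := (pmeas N lam).
Local Notation mu2 := (mean_sq_intensity P lam).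
Local Notation sigma2 := (2 * mu2).

Definition pearson_sum (n : nat) (w : T) : R :=
  (Num.sqrt n%:R)^-1 * \sum_(1 <= t < n.+1) pearson (lam t%:Z w) (N t%:Z w).

Definition cond_variance (n t : nat) (w : T) : R :=
  \sum_(1 <= i < t.+1) (2 * lam i%:Z w ^+ 2 / n%:R).

Local Opaque Phi.

Section fixed_sample_size.
Variables (a eps K1 K2 : R) (n : nat).
Hypotheses (eps_gt0 : 0 < eps) (K1_gt0 : 0 < K1) (K2_gt0 : 0 < K2) (n_gt0 : (0 < n)%N).

Let lo := eps ^+ 2 / 2.
(** The initial variance exceeds the limit by [eps^2]. As the accumulated variance is kept below
    [sigma2 + lo], at least [lo] always remains. *)
Let v0 := sigma2 + eps ^+ 2.

Hypothesis space : forall v x z, lo <= v ->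
  let y := (a - x) / Num.sqrt v in
  `|Phi ((a - (x + z)) / Num.sqrt v) - Phi y + z * (normal_pdf 0 1 y / Num.sqrt v)
    + z ^+ 2 * ((y * normal_pdf 0 1 y) / (2 * v))| <= K1 * Num.min (z ^+ 2) (`|z| ^+ 3).
Hypothesis time : forall b v h, lo <= v -> 0 <= h ->
  let y := b / Num.sqrt v in
  `|Phi (b / Num.sqrt (v + h)) - Phi y| <= K2 * h /\
  `|Phi (b / Num.sqrt (v + h)) - Phi y + h * ((y * normal_pdf 0 1 y) / (2 * v))|
    <= K2 * Num.min h (h ^+ 2).

Let rn := (Num.sqrt n%:R : R)^-1.
(** The test at time [t] includes the variance added at time [t]; it is still predictable, because
    [lam t] is. *)
Let active t w : bool := cond_variance n t w <= sigma2 + lo.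
Let xi t k w : R := (active t w)%:R * (rn * pearson (lam t%:Z w) k).
Let S t := mart N xi 1 t.+1.
Let V t w : R := \sum_(1 <= i < t.+1) (active i w)%:R * (2 * lam i%:Z w ^+ 2 / n%:R).
(** The probability that [S t w] plus an independent centred normal variable of variance
    [v0 - V t w] is at most [a]: the increments still to come are replaced by a Gaussian. *)
Let U t w : R := Phi ((a - S t w) / Num.sqrt (v0 - V t w)).
Let remainder x k : R :=
  K1 * Num.min ((rn * pearson x k) ^+ 2) (`|rn * pearson x k| ^+ 3)
  + K2 * Num.min (2 * x ^+ 2 / n%:R) ((2 * x ^+ 2 / n%:R) ^+ 2).

Let hstep_ge0 i w : 0 <= 2 * lam i%:Z w ^+ 2 / n%:R.
Proof. by rewrite divr_ge0// mulr_ge0// sqr_ge0. Qed.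

Lemma rn2 : rn ^+ 2 = n%:R^-1.
Proof. by rewrite exprVn sqr_sqrtr. Qed.

Lemma pmeas_cond_variance t : pmeas (t%:Z - 1) (cond_variance n t).
Proof.
rewrite /cond_variance; elim: t => [|t IH].
  under eq_fun do rewrite big_geq//; exact: measurable_cst.
under eq_fun do rewrite big_nat_recr//=.
have le1 : t%:Z - 1 <= t.+1%:Z - 1 by rewrite lerD2r lez_nat.
apply: measurable_funD; first exact: (@pmeas_mono _ _ _ N lam _ _ _ le1 IH).
apply: measurable_funM => //; apply: measurable_funM => //; apply: measurable_funX.
exact: (@pmeas_lam_next _ _ _ _ _ _ _ _ _ model t.+1%:Z).
Qed.

Lemma pmeas_active t : pmeas (t%:Z - 1) (fun w => (active t w)%:R).
Proof.
rewrite (_ : (fun w => _) = \1_(cond_variance n t @^-1` `]-oo, sigma2 + lo])); last first.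
  apply/funext => w; rewrite indicE; congr (_%:R); congr (nat_of_bool _).
  by apply/idP/idP; rewrite inE /= in_itv.
apply: measurable_indic; rewrite -[X in measurable X]setTI.
by apply: (@pmeas_cond_variance t) => //; exact: measurable_itv.
Qed.

Lemma pearson_measurable k : measurable_fun setT (fun x : R => pearson x k).
Proof. by apply: measurable_funB => //; apply: measurable_funX; exact: measurable_funB. Qed.

Lemma pmeas_xi t k : pmeas (t%:Z - 1) (xi t k).
Proof.
apply: measurable_funM; first exact: pmeas_active.
apply: measurable_funM => //.
exact: (pmeas_comp (pearson_measurable k) (@pmeas_lam_next _ _ _ _ _ _ _ _ _ model t%:Z)).
Qed.

Lemma pmeas_V t : pmeas (t%:Z - 1) (V t).
Proof.
rewrite /V; elim: t => [|t IH].
  under eq_fun do rewrite big_geq//; exact: measurable_cst.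
under eq_fun do rewrite big_nat_recr//=.
have le1 : t%:Z - 1 <= t.+1%:Z - 1 by rewrite lerD2r lez_nat.
apply: measurable_funD; first exact: (@pmeas_mono _ _ _ N lam _ _ _ le1 IH).
apply: measurable_funM; first exact: pmeas_active.
apply: measurable_funM => //; apply: measurable_funM => //; apply: measurable_funX.
exact: (@pmeas_lam_next _ _ _ _ _ _ _ _ _ model t.+1%:Z).
Qed.

Lemma V_le t w : V t w <= sigma2 + lo.
Proof.
have mu0 := mean_sq_intensity_ge0 model.
have lo0 : 0 <= lo by rewrite divr_ge0// sqr_ge0.
elim: t => [|t IH]; first by rewrite /V big_geq// addr_ge0// mulr_ge0.
rewrite /V big_nat_recr//=; have [act|_] := boolP (active t.+1 w); last first.
  by rewrite mul0r addr0.
rewrite mul1r (le_trans _ act)// /cond_variance [leRHS]big_nat_recr//= lerD2r ler_sum// => i _.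
by case: (active i w); rewrite ?mul1r// mul0r.
Qed.

Lemma unit_rv_U t : unit_rv (U t).
Proof.
split; last by move=> w; rewrite Phi_ge0 Phi_le1.
apply: (measurableT_comp measurable_Phi); apply: measurable_funM.
  apply: measurable_funB => //.
  exact: (pmeas_measurable_fun model (@pmeas_mart _ _ _ _ _ xi 1 t.+1 (fun i k _ => @pmeas_xi i k))).
have mV := pmeas_measurable_fun model (@pmeas_V t).
exact: (measurableT_comp measurable_inv_sqrt (measurable_funB (@measurable_cst _ _ _ _ setT v0) mV)).
Qed.

Lemma remainder_psum x : 0 <= x ->
  psum x (fun k => K1 * Num.min ((rn * pearson x k) ^+ 2) (`|rn * pearson x k| ^+ 3))
    (K1 * poisE (fun k => Num.min ((rn * pearson x k) ^+ 2) (`|rn * pearson x k| ^+ 3)) x).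
Proof.
move=> x0; apply: psumZ.
have h2 : psum x (fun k => (rn * pearson x k) ^+ 2) (rn ^+ 2 * (2 * x ^+ 2)).
  by apply: eq_psum (@psumZ _ (rn ^+ 2) _ _ _ (@psum_pearson2 _ x)) => k; rewrite exprMn.
pose f k := Num.min ((rn * pearson x k) ^+ 2) (`|rn * pearson x k| ^+ 3).
have fle k : `|f k| <= (rn * pearson x k) ^+ 2.
  by rewrite /f ger0_norm ?ge_min ?lexx// le_min sqr_ge0 exprn_ge0.
by have [s hs] := psum_dominated x0 fle h2; rewrite /poisE (cvg_lim _ hs).
Qed.

(** The Poisson mean of [remainder x]. *)
Let rest x : R :=
  K1 * poisE (fun k => Num.min ((rn * pearson x k) ^+ 2) (`|rn * pearson x k| ^+ 3)) x
  + K2 * Num.min (2 * x ^+ 2 / n%:R) ((2 * x ^+ 2 / n%:R) ^+ 2).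

Lemma rest_psum x : 0 <= x -> psum x (remainder x) (rest x).
Proof. by move=> x0; apply: psumD (remainder_psum x0) (@psum_cst _ _ _). Qed.

Lemma rest_ge0 x : 0 <= x -> 0 <= rest x.
Proof.
move=> x0; apply: psum_le x0 _ (@psum_cst _ 0 _) (rest_psum x0) => k.
have h0 : 0 <= 2 * x ^+ 2 / n%:R by rewrite divr_ge0// mulr_ge0// sqr_ge0.
apply: addr_ge0; apply: mulr_ge0; rewrite ?(ltW K1_gt0) ?(ltW K2_gt0)// le_min.
  by rewrite sqr_ge0 exprn_ge0.
by rewrite h0 sqr_ge0.
Qed.

Let Unext t k w : R := Phi ((a - (S t w + xi t.+1 k w)) / Num.sqrt (v0 - V t.+1 w)).

(** Both values are compared with the same [Phi y] at variance [v = v0 - V t.+1 w]: the next value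
    differs from it in space, by [rn * pearson x k], and the present one in time, by [h]. Since the
    space increment has mean 0 and variance [h], the terms [h * q] of the two expansions cancel. *)
Lemma one_step t w : exists2 s, psum (lam t.+1%:Z w) (fun k => Unext t k w) s &
  `|s - U t w| <= rest (lam t.+1%:Z w).
Proof.
set x := lam t.+1%:Z w; have x0 : 0 <= x by exact: lam_ge0.
have VS : V t.+1 w = V t w + (active t.+1 w)%:R * (2 * x ^+ 2 / n%:R).
  by rewrite /V big_nat_recr.
have [act|nact] := boolP (active t.+1 w); last first.
  exists (U t w); last by rewrite subrr normr0 rest_ge0.
  apply: eq_psum (@psum_cst _ (U t w) _) => k.
  by rewrite /Unext VS /xi (negbTE nact) !mul0r !addr0.
set h := 2 * x ^+ 2 / n%:R; have h0 : 0 <= h by rewrite divr_ge0// mulr_ge0// sqr_ge0.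
set v := v0 - V t.+1 w.
have lov : lo <= v.
  rewrite /v lerBrDr addrC -lerBrDr (le_trans (V_le _ _))//.
  by rewrite /v0 -addrA lerD2l /lo; lra.
have vh : v0 - V t w = v + h by rewrite /v VS act mul1r -/h; ring.
pose b := a - S t w; pose y := b / Num.sqrt v.
pose p := normal_pdf 0 1 y / Num.sqrt v; pose q := y * normal_pdf 0 1 y / (2 * v).
have UE k : Unext t k w = Phi ((a - (S t w + rn * pearson x k)) / Num.sqrt v).
  by rewrite /Unext /xi act mul1r.
have Uh : U t w = Phi (b / Num.sqrt (v + h)) by rewrite /U vh.
have [_ tm] := time b lov h0; rewrite /= -/y -/q -Uh in tm.
have sp k := space (S t w) (rn * pearson x k) lov; rewrite /= -/b -/y -/p -/q in sp.
have su : psum x (Unext t ^~ w) (poisE (Unext t ^~ w) x).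
  apply: (@psum_poisE _ 1) => // k.
  by rewrite ger0_norm ?Phi_ge0 ?Phi_le1.
exists (poisE (Unext t ^~ w) x) => //; set s := poisE _ _ in su *.
have sr : psum x (fun k => Unext t k w - Phi y + rn * pearson x k * p + (rn * pearson x k) ^+ 2 * q)
    (s - Phi y + h * q).
  have := psumD (psumD (psumB su (@psum_cst _ (Phi y) x)) (@psumZ _ (rn * p) _ _ _ (@psum_pearson _ x)))
    (@psumZ _ (rn ^+ 2 * q) _ _ _ (@psum_pearson2 _ x)).
  rewrite mulr0 addr0 (_ : rn ^+ 2 * q * (2 * x ^+ 2) = h * q); last by rewrite rn2 /h; ring.
  by apply: eq_psum => k; ring.
have pr := remainder_psum x0.
have d1 : `|s - Phi y + h * q| <=
    K1 * poisE (fun k => Num.min ((rn * pearson x k) ^+ 2) (`|rn * pearson x k| ^+ 3)) x.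
  rewrite ler_norml; apply/andP; split.
    rewrite -mulN1r; apply: psum_le x0 _ (@psumZ _ (-1) _ _ _ pr) sr => k.
    by rewrite mulN1r; have := sp k; rewrite -UE ler_norml => /andP[].
  apply: psum_le x0 _ sr pr => k.
  by have := sp k; rewrite -UE ler_norml => /andP[].
have -> : s - U t w = (s - Phi y + h * q) - (U t w - Phi y + h * q) by ring.
by rewrite (le_trans (ler_normB _ _))// lerD.
Qed.

(** Stationarity moves the remainder to time 0, so that one estimate serves all steps. *)
Lemma Ex_U_step t c : Ele P (fun w => remainder (lam 0 w) (N 0 w)) c ->
  `|Ex P (U t.+1) - Ex P (U t)| <= c.
Proof.
move=> Ec.
have mrem k : measurable_fun setT (remainder ^~ k).
  have mp := measurable_funM (@measurable_cst _ _ _ _ setT rn) (pearson_measurable k).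
  have mh : measurable_fun setT (fun x : R => 2 * x ^+ 2 / n%:R).
    by apply: measurable_funM => //; apply: measurable_funM => //; exact: measurable_funX.
  apply: measurable_funD; apply: measurable_funM => //; apply: measurable_minr.
  - exact: (measurable_funX 2 mp).
  - by apply: measurable_funX; exact: (measurableT_comp (@normr_measurable R setT) mp).
  - exact: mh.
  - exact: (measurable_funX 2 mh).
have rem0 x k : 0 <= remainder x k.
  have h0 : 0 <= 2 * x ^+ 2 / n%:R by rewrite divr_ge0// mulr_ge0// sqr_ge0.
  apply: addr_ge0; apply: mulr_ge0; rewrite ?(ltW K1_gt0) ?(ltW K2_gt0)// le_min.
    by rewrite sqr_ge0 exprn_ge0.
  by rewrite h0 sqr_ge0.
have := Ele_stationary model t.+1%:Z mrem rem0 Ec.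
have mlam := lam_meas t.+1%:Z.
move=> [_ _].
rewrite (@cond_expectation _ _ _ P N lam N_meas lam_meas lam_ge0 cpois t.+1%:Z
  (fun k w => remainder (lam t.+1%:Z w) k) (fun w => rest (lam t.+1%:Z w))); last 3 first.
- by move=> k; exact: (pmeas_comp (mrem k) (@pmeas_lam_next _ _ _ _ _ _ _ _ _ model t.+1%:Z)).
- by move=> k w; exact: rem0.
- by move=> w; apply: rest_psum; exact: lam_ge0.
move=> Er.
have pU k : pmeas (t.+1%:Z - 1) (Unext t k).
  have mV := @pmeas_V t.+1.
  have mS : pmeas (t.+1%:Z - 1) (S t) by exact: (@pmeas_mart _ _ _ _ _ xi 1 t.+1 (fun i k _ => @pmeas_xi i k)).
  apply: (measurableT_comp measurable_Phi); apply: measurable_funM.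
    apply: measurable_funB => //; apply: measurable_funD; [exact: mS|exact: pmeas_xi].
  exact: (measurableT_comp measurable_inv_sqrt (measurable_funB (@measurable_cst _ _ _ _ setT v0) mV)).
pose s w := poisE (Unext t ^~ w) (lam t.+1%:Z w).
have sE w : psum (lam t.+1%:Z w) (Unext t ^~ w) (s w).
  by apply: (@psum_poisE _ 1) => // k; rewrite ger0_norm ?Phi_ge0 ?Phi_le1.
have ms : measurable_fun setT s.
  by apply: (psum_measurable mlam _ sE) => k; exact: (pmeas_measurable_fun model (pU k)).
have us : unit_rv s.
  split=> // w; apply: poisE_range => // k; by rewrite Phi_ge0 Phi_le1.
have U0 k w : 0 <= Unext t k w by exact: Phi_ge0.
have cE := @cond_expectation _ _ _ P N lam N_meas lam_meas lam_ge0 cpois t.+1%:Z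
  (Unext t) s pU U0 sE.
have UE : Ex P (U t.+1) = Ex P s.
  apply: eq_Ex; apply: etrans cE.
  by apply: eq_integral => w _; rewrite /U /Unext /S /mart big_nat_recr.
rewrite UE.
apply: (@Ex_dist _ _ _ P s (U t) (fun w => rest (lam t.+1%:Z w))) => //.
- exact: unit_rv_U.
- move=> w; have [s' hs'] := one_step t w; rewrite (psum_unique hs' (sE w)).
  exact.
- split=> //; last by move=> w; exact: rest_ge0.
  apply: (psum_measurable mlam _ (fun w => rest_psum (lam_ge0 _ w))) => k.
  exact: (measurableT_comp (mrem k) mlam).
Qed.

Lemma Ex_U_telescope t c : Ele P (fun w => remainder (lam 0 w) (N 0 w)) c ->
  `|Ex P (U t) - Phi (a / Num.sqrt v0)| <= t%:R * c.
Proof.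
move=> Ec; elim: t => [|t IH].
  rewrite mul0r (_ : U 0 = fun=> Phi (a / Num.sqrt v0)); last first.
    by apply/funext => w; rewrite /U /S /mart /V !big_geq// !subr0.
  by rewrite /Ex integral_cstE subrr normr0.
rewrite -natr1 mulrDl mul1r [leRHS]addrC.
rewrite (le_trans (ler_distD (Ex P (U t)) _ _))// lerD//.
exact: Ex_U_step.
Qed.

(** If the total conditional variance is within [lo] of its limit, no increment was switched off and
    [U n] differs from the smoothed statistic only in the variance left, by
    [|cond_variance n n w - sigma2|]. Otherwise the trivial bound 1 is at most [lo^-1] times this
    distance. *)
Lemma U_near_statistic w :
  `|U n w - Phi ((a - pearson_sum n w) / eps)| <=
    (K2 + lo^-1) * `|cond_variance n n w - sigma2|.
Proof.
have lo0 : 0 < lo by rewrite divr_gt0// exprn_gt0.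
set D := `|_ - sigma2|.
have [Dlo|loD] := leP D lo; last first.
  apply: (@le_trans _ _ 1).
    rewrite ler_norml; have := Phi_ge0 ((a - pearson_sum n w) / eps).
    have := Phi_le1 ((a - pearson_sum n w) / eps).
    have := Phi_ge0 ((a - S n w) / Num.sqrt (v0 - V n w)).
    have := Phi_le1 ((a - S n w) / Num.sqrt (v0 - V n w)).
    by rewrite /U => h1 h2 h3 h4; apply/andP; split; lra.
  apply: (@le_trans _ _ (lo^-1 * D)); first by rewrite mulrC ler_pdivlMr// mul1r ltW.
  by apply: ler_wpM2r; [exact: normr_ge0|rewrite lerDr ltW].
have act i : (i <= n)%N -> active i w.
  move=> iN; rewrite /active.
  have : cond_variance n i w <= cond_variance n n w.
    rewrite /cond_variance [leRHS](@big_cat_nat _ _ _ i.+1)//= lerDl.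
    by apply: sumr_ge0 => j _; exact: hstep_ge0.
  by have := ler_norm (cond_variance n n w - sigma2); rewrite -/D; lra.
have SE : S n w = pearson_sum n w.
  rewrite /S /mart /pearson_sum mulr_sumr big_nat [RHS]big_nat.
  by apply: eq_bigr => i /andP[_ iN]; rewrite /xi act// mul1r.
have VE : V n w = cond_variance n n w.
  rewrite /V /cond_variance big_nat [RHS]big_nat.
  by apply: eq_bigr => i /andP[_ iN]; rewrite act// mul1r.
rewrite /U SE VE; set b := a - _.
have epsE : eps = Num.sqrt (eps ^+ 2) by rewrite sqrtr_sqr ger0_norm// ltW.
have loe : lo <= eps ^+ 2 by rewrite /lo; have := exprn_gt0 2 eps_gt0; lra.
have elo : eps ^+ 2 = lo + lo by rewrite /lo; field.
have key : `|Phi (b / Num.sqrt (v0 - cond_variance n n w)) - Phi (b / eps)| <= K2 * D.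
  rewrite [in X in _ - X]epsE.
  (* [time] only increases the variance, so the smaller of the two variances is taken as the base
     point. *)
  have [sV|Vs] := leP sigma2 (cond_variance n n w).
  - have DE : D = cond_variance n n w - sigma2 by rewrite /D ger0_norm// subr_ge0.
    have e2 : eps ^+ 2 = (v0 - cond_variance n n w) + D by rewrite DE /v0; ring.
    rewrite distrC {1}e2.
    apply: (time b _ _).1; last by rewrite normr_ge0.
    by rewrite DE in Dlo; rewrite /v0; lra.
  - have DE : D = sigma2 - cond_variance n n w by rewrite /D distrC ger0_norm// subr_ge0 ltW.
    have e2 : v0 - cond_variance n n w = eps ^+ 2 + D by rewrite DE /v0; ring.
    rewrite e2; apply: (time b _ _).1 => //; exact: normr_ge0.
by rewrite (le_trans key)// ler_wpM2r ?normr_ge0// lerDl invr_ge0 ltW.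
Qed.

End fixed_sample_size.

Lemma cvg_inv_sqrt : (Num.sqrt (n%:R : R))^-1 @[n --> \oo] --> (0 : R).
Proof.
apply/cvgrPdist_le => e e0; near=> n.
have n0 : 0 < n%:R :> R by rewrite ltr0n; near: n; exact: nbhs_infty_gt.
have hn : (e^-1) ^+ 2 <= n%:R by near: n; exact: nbhs_infty_ger.
rewrite sub0r normrN ger0_norm ?invr_ge0// -[leRHS]invrK lef_pV2 ?posrE ?invr_gt0 ?sqrtr_gt0//.
by rewrite -(ler_sqr) ?nnegrE ?invr_ge0 ?(ltW e0)// sqr_sqrtr// ltW.
Unshelve. all: by end_near. Qed.

Lemma pearson_sum_measurable n : measurable_fun setT (pearson_sum n).
Proof.
apply: measurable_funM => //; apply: measurable_sum => t.
exact: (pair_measurable model t%:Z (h := @pearson R) pearson_measurable).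
Qed.

Lemma unit_rv_smoothed n a eps : unit_rv (fun w => Phi ((a - pearson_sum n w) / eps)).
Proof.
split; last by move=> w; rewrite Phi_ge0 Phi_le1.
apply: (measurableT_comp measurable_Phi); apply: measurable_funM => //.
by apply: measurable_funB => //; exact: pearson_sum_measurable.
Qed.

(** Times [n], the remainder is dominated by the lower order entries of the minima,
    [K1 pearson^2 + 2 K2 lam^2], which are integrable; the higher order entries make it tend to 0
    pointwise. Dominated convergence then gives [o(1 / n)] for a single step. *)
Lemma remainder_small K1 K2 e : 0 < K1 -> 0 < K2 -> 0 < e ->
  \forall n \near \oo, let rn := (Num.sqrt (n%:R : R))^-1 in
  Ele P (fun w => K1 * Num.min ((rn * pearson (lam 0 w) (N 0 w)) ^+ 2)
                       (`|rn * pearson (lam 0 w) (N 0 w)| ^+ 3)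
     + K2 * Num.min (2 * lam 0 w ^+ 2 / n%:R) ((2 * lam 0 w ^+ 2 / n%:R) ^+ 2)) (n%:R^-1 * e).
Proof.
move=> K10 K20 e0.
pose rn (n : nat) := (Num.sqrt (n%:R : R))^-1.
pose X w := pearson (lam 0 w) (N 0 w); pose h n w := 2 * lam 0 w ^+ 2 / n%:R.
pose r n w := K1 * Num.min ((rn n * X w) ^+ 2) (`|rn n * X w| ^+ 3)
  + K2 * Num.min (h n w) (h n w ^+ 2).
have h0 n w : 0 <= h n w by rewrite divr_ge0// mulr_ge0// sqr_ge0.
have r0 n w : 0 <= r n w.
  apply: addr_ge0; apply: mulr_ge0; rewrite ?(ltW K10) ?(ltW K20)// le_min.
    by rewrite sqr_ge0 exprn_ge0.
  by rewrite h0 sqr_ge0.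
have mX : measurable_fun setT X.
  exact: (pair_measurable model 0 (h := @pearson R) pearson_measurable).
have mr n : measurable_fun setT (r n).
  have mh : measurable_fun setT (h n).
    by apply: measurable_funM => //; apply: measurable_funM => //; exact: measurable_funX.
  have mp := measurable_funM (@measurable_cst _ _ _ _ setT (rn n)) mX.
  apply: measurable_funD; apply: measurable_funM => //; apply: measurable_minr.
  - exact: (measurable_funX 2 mp).
  - by apply: measurable_funX; exact: (measurableT_comp (@normr_measurable R setT) mp).
  - exact: mh.
  - exact: (measurable_funX 2 mh).
have E := EleD (EleZ (ltW K10) (Ele_pearson2 model 0)) (EleZ (ltW K20) (EleZ (ler0n R 2) (Ele_lam2 model 0))).
have nr2 n : (0 < n)%N -> rn n ^+ 2 = n%:R^-1 by move=> ?; rewrite /rn exprVn sqr_sqrtr.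
have small : \forall n \near \oo, Ele P (fun w => n%:R * r n w) e.
  apply: (Ele_dominated E) e0.
  - by move=> n; apply: measurable_funM.
  - move=> n w; rewrite mulr_ge0//=; case: n => [|n].
      rewrite mul0r; apply: addr_ge0; first by rewrite (mulr_ge0 (ltW K10))// sqr_ge0.
      by rewrite (mulr_ge0 (ltW K20))// mulr_ge0// sqr_ge0.
    rewrite /r mulrDr lerD//.
      rewrite mulrCA ler_pM2l//.
      apply: (@le_trans _ _ (n.+1%:R * (rn n.+1 * X w) ^+ 2)).
        by rewrite ler_wpM2l// ge_min lexx.
      by rewrite exprMn nr2// mulrA mulfV ?mul1r.
    rewrite mulrCA ler_pM2l//.
    apply: (@le_trans _ _ (n.+1%:R * h n.+1 w)); first by rewrite ler_wpM2l// ge_min lexx.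
    by rewrite /h mulrC divfK.
  - move=> w; pose A := K1 * `|X w| ^+ 3 + K2 * (2 * lam 0 w ^+ 2) ^+ 2.
    have cA : A * rn n @[n --> \oo] --> A * 0 by apply: cvgMr; exact: cvg_inv_sqrt.
    rewrite mulr0 in cA.
    apply: (@squeeze_cvgr _ _ _ _ (fun=> 0) (fun n => A * rn n)); [|exact: cvg_cst|exact: cA].
    near=> n; rewrite mulr_ge0//=.
    have n0 : (0 < n)%N by near: n; exact: nbhs_infty_gt.
    have nR : 0 < n%:R :> R by rewrite ltr0n.
    have rn0 : 0 <= rn n by rewrite invr_ge0.
    have rn1 : rn n <= 1.
      rewrite invf_le1 ?sqrtr_gt0// -[leLHS]sqrtr1 ler_sqrt//.
      by rewrite (ler_nat R 1).
    have nr1 : n%:R * rn n ^+ 2 = 1 by rewrite nr2// mulfV// gt_eqF.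
    rewrite /r mulrDr /A mulrDl lerD//.
      rewrite mulrCA -mulrA ler_pM2l//.
      apply: (@le_trans _ _ (n%:R * `|rn n * X w| ^+ 3)).
        by rewrite ler_wpM2l// ge_min lexx orbT.
      rewrite normrM (ger0_norm rn0).
      rewrite (_ : _ * _ = n%:R * rn n ^+ 2 * (`|X w| ^+ 3 * rn n)); last by ring.
      by rewrite nr1 mul1r.
    rewrite mulrCA -mulrA ler_pM2l//.
    apply: (@le_trans _ _ (n%:R * h n w ^+ 2)).
      by rewrite ler_wpM2l// ge_min lexx orbT.
    rewrite /h -nr2//.
    rewrite (_ : _ * _ = n%:R * rn n ^+ 2 * ((2 * lam 0 w ^+ 2) ^+ 2 * rn n ^+ 2)); last by ring.
    rewrite nr1 mul1r ler_wpM2l ?sqr_ge0//.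
    by rewrite expr2 ler_piMl.
near=> n => /=.
have n0 : 0 < n%:R :> R by rewrite ltr0n; near: n; exact: nbhs_infty_gt.
have ni0 : 0 <= n%:R^-1 :> R by rewrite invr_ge0 ltW.
have En : Ele P (fun w => n%:R * r n w) e by near: n; exact: small.
have := EleZ ni0 En; under [X in Ele _ X]eq_fun do rewrite mulKf ?gt_eqF//.
exact.
Unshelve. all: by end_near. Qed.

End central_limit_theorem.

Lemma sandwich_arith {R : realFieldType} (x xu xl yu yl y e : R) : 0 < e ->
  x <= xu + e / 4 -> xl <= x + e / 4 -> `|xu - yu| <= e / 4 -> `|xl - yl| <= e / 4 ->
  `|yu - y| <= e / 4 -> `|yl - y| <= e / 4 -> `|x - y| <= e.
Proof.
rewrite !ler_norml => e0 h1 h2 /andP[h3 h4] /andP[h5 h6] /andP[h7 h8] /andP[h9 h10].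
by apply/andP; split; lra.
Qed.

Section clt_distribution.
Context {R : realType} {d : measure_display} {T : measurableType d}.
Variables (P : probability T R) (N : int -> T -> nat) (lam : int -> T -> R).
Variables (g0 : R -> nat -> R) (kappa1 kappa2 : R).
Hypothesis model : ingarch P N lam g0 kappa1 kappa2.

Local Notation mu2 := (mean_sq_intensity P lam).
Local Notation sigma2 := (2 * mu2).
Local Notation pearson_sum := (pearson_sum N lam).

Lemma clt_smoothed a eps e : 0 < eps -> 0 < e -> \forall n \near \oo,
  `|Ex P (fun w => Phi ((a - pearson_sum n w) / eps)) - Phi (a / Num.sqrt (sigma2 + eps ^+ 2))|
    <= e.
Proof.
move=> eps0 e0; have lo0 : 0 < eps ^+ 2 / 2 by rewrite divr_gt0// exprn_gt0.
have [K1 K10 space] := heat_space a lo0.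
have [K2 K20 time] := heat_time lo0.
have e2 : 0 < e / 2 by rewrite divr_gt0.
have rem := remainder_small model K10 K20 e2.
pose K := K2 + (eps ^+ 2 / 2)^-1; have K0 : 0 < K by rewrite addr_gt0// invr_gt0.
have e3 : 0 < e / 2 / (2 * K) by rewrite divr_gt0// mulr_gt0.
have lln := law_of_large_numbers model e3.
near=> n.
have n0 : (0 < n)%N by near: n; exact: nbhs_infty_gt.
have nR : 0 < n%:R :> R by rewrite ltr0n.
have Er : let rn := (Num.sqrt (n%:R : R))^-1 in
  Ele P (fun w => K1 * Num.min ((rn * pearson (lam 0 w) (N 0 w)) ^+ 2)
                       (`|rn * pearson (lam 0 w) (N 0 w)| ^+ 3)
     + K2 * Num.min (2 * lam 0 w ^+ 2 / n%:R) ((2 * lam 0 w ^+ 2 / n%:R) ^+ 2)) (n%:R^-1 * (e / 2)).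
  by near: n; exact: rem.
have El : Ele P (fun w => `|n%:R^-1 * (\sum_(1 <= t < n.+1) lam t%:Z w ^+ 2) - mu2|) (e / 2 / (2 * K)).
  by near: n; exact: lln.
have d1 := Ex_U_telescope model K10 K20 space time n Er.
rewrite mulrA mulfV ?gt_eqF// mul1r in d1.
set V := Ex P _ in d1.
rewrite (le_trans (ler_distD V _ _))// [e]splitr lerD// distrC.
apply: Ex_dist.
- exact: (unit_rv_U model).
- exact: (unit_rv_smoothed model).
- by move=> w; exact: (U_near_statistic P N lam a n eps0 K20 time w).
- have cE w : cond_variance lam n n w - sigma2 =
      2 * (n%:R^-1 * (\sum_(1 <= t < n.+1) lam t%:Z w ^+ 2) - mu2).
    by rewrite /cond_variance -mulr_suml -mulr_sumr; ring.
  under eq_fun do rewrite cE normrM (@ger0_norm _ 2)// mulrA.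
  have := EleZ (_ : 0 <= K * 2) El => /(_ _) H.
  apply: Ele_weaken; first by apply: H; rewrite mulr_ge0// ltW.
  by rewrite le_eqVlt; apply/orP; left; apply/eqP; field; rewrite gt_eqF.
Unshelve. all: by end_near. Qed.

Lemma clt a e : 0 < mu2 -> 0 < e -> \forall n \near \oo,
  `|Ex P (\1_[set w | pearson_sum n w <= a]) - Phi (a / Num.sqrt sigma2)| <= e.
Proof.
move=> mu0 e0; have s0 : 0 < sigma2 by rewrite mulr_gt0.
have e4 : 0 < e / 4 by rewrite divr_gt0.
have [B B0 tails] := Phi_tails e4.
have [K K0 time] := heat_time s0.
(* [c * eta] bounds the error from shifting [a] by [eta], as [Phi] is 16-Lipschitz, and from adding
   the variance [eps^2 = eta^2 / B^2 <= eta / B^2]. The ratio [eta / eps = B] makes the normal tails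
   small. *)
pose c := 16 / Num.sqrt sigma2 + K / B ^+ 2.
have c0 : 0 < c by rewrite addr_gt0// divr_gt0// ?sqrtr_gt0// exprn_gt0.
pose eta := Num.min 1 (e / 4 / c).
have eta0 : 0 < eta by rewrite lt_min ltr01 divr_gt0.
have eta1 : eta <= 1 by rewrite ge_min lexx.
have etac : c * eta <= e / 4.
  by rewrite mulrC -ler_pdivlMr// ge_min lexx orbT.
pose eps := eta / B; have eps0 : 0 < eps by rewrite divr_gt0.
have etaB : eta / eps = B by rewrite /eps invf_div mulrCA mulfV ?mulr1// gt_eqF.
have near_limit b : `|b - a| <= eta ->
    `|Phi (b / Num.sqrt (sigma2 + eps ^+ 2)) - Phi (a / Num.sqrt sigma2)| <= e / 4.
  move=> ba; rewrite (le_trans (ler_distD (Phi (b / Num.sqrt sigma2)) _ _))//.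
  have d1 := (time b _ (eps ^+ 2) (lexx _) (sqr_ge0 _)).1.
  have d2 := Phi_lipschitz (a / Num.sqrt sigma2) (b / Num.sqrt sigma2).
  rewrite -mulrBl normrM (@ger0_norm _ (Num.sqrt _)^-1) ?invr_ge0// in d2.
  apply: le_trans etac; rewrite /c [leRHS]mulrDl [leRHS]addrC; apply: lerD; last first.
    by rewrite (le_trans d2)// mulrAC -mulrA ler_wpM2l// ler_wpM2r// invr_ge0.
  apply: (le_trans d1); rewrite -mulrA ler_wpM2l ?(ltW K0)//.
  rewrite /eps exprMn exprVn mulrC ler_wpM2l ?invr_ge0 ?sqr_ge0//.
  by rewrite expr2 ler_piMl// ltW.
pose I n : T -> R := \1_[set w | pearson_sum n w <= a].
have uI n : unit_rv (I n).
  split; last by move=> w; rewrite /I indicE ler0n lern1 leq_b1.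
  apply: measurable_indic.
  rewrite (_ : [set _ | _] = pearson_sum n @^-1` `]-oo, a]); last first.
    by apply/seteqP; split => w /=; rewrite in_itv.
  rewrite -[X in measurable X]setTI.
  by apply: (pearson_sum_measurable model n) => //; exact: measurable_itv.
have up n : Ex P (I n) <= Ex P (fun w => Phi ((a + eta - pearson_sum n w) / eps)) + e / 4.
  apply: (Ex_le (uI n) (unit_rv_smoothed model n _ _) _ (Ele_cst P (ltW e4))) => w.
  rewrite /I indicE; have [|_] := boolP (_ \in _); last by rewrite addr_ge0 ?Phi_ge0 ?ltW.
  rewrite inE /= => Sa; rewrite -lerBlDr; apply: (tails _).1.
  by rewrite -etaB ler_pM2r ?invr_gt0//; lra.
have lowr n : Ex P (fun w => Phi ((a - eta - pearson_sum n w) / eps)) <= Ex P (I n) + e / 4.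
  apply: (Ex_le (unit_rv_smoothed model n _ _) (uI n) _ (Ele_cst P (ltW e4))) => w.
  rewrite /I indicE; have [_|] := boolP (_ \in _).
    by rewrite (le_trans (Phi_le1 _))// lerDl ltW.
  rewrite notin_setE /= => /negP; rewrite -ltNge => Sa; rewrite add0r; apply: (tails _).2.
  by rewrite (_ : - B = - eta / eps); [rewrite ler_pM2r ?invr_gt0//; lra|rewrite mulNr etaB].
have limu := clt_smoothed (a + eta) eps0 e4.
have liml := clt_smoothed (a - eta) eps0 e4.
have nu : `|a + eta - a| <= eta by rewrite addrAC subrr add0r ger0_norm// ltW.
have nl : `|a - eta - a| <= eta by rewrite addrAC subrr add0r normrN ger0_norm// ltW.
near=> n.
have hu : `|Ex P (fun w => Phi ((a + eta - pearson_sum n w) / eps))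
  - Phi ((a + eta) / Num.sqrt (sigma2 + eps ^+ 2))| <= e / 4 by near: n; exact: limu.
have hl : `|Ex P (fun w => Phi ((a - eta - pearson_sum n w) / eps))
  - Phi ((a - eta) / Num.sqrt (sigma2 + eps ^+ 2))| <= e / 4 by near: n; exact: liml.
exact: (sandwich_arith e0 (up n) (lowr n) hu hl (near_limit _ nu) (near_limit _ nl)).
Unshelve. all: by end_near. Qed.

End clt_distribution.

(** * Plug-in intensities *)

Section geometric_average.
Context {R : realType} {d : measure_display} {T : measurableType d}.
Variable (P : probability T R).

(** The sum over [j < i] of [kappa^(i - 1 - j) * b j]. *)
Fixpoint geo_avg (kappa : R) (b : nat -> R) (i : nat) : R :=
  if i is j.+1 then kappa * geo_avg kappa b j + b j else 0.

Lemma geo_avg_ge0 kappa b i : 0 <= kappa -> (forall j, 0 <= b j) -> 0 <= geo_avg kappa b i.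
Proof. by move=> k0 b0; elim: i => //= i IH; rewrite addr_ge0// mulr_ge0. Qed.

Lemma geo_avg_le kappa b B b' i : 0 <= kappa -> kappa < 1 -> 0 <= B ->
  (forall j, b j <= B + b' j) -> geo_avg kappa b i <= B / (1 - kappa) + geo_avg kappa b' i.
Proof.
move=> k0 k1 B0 h; have k1' : 0 < 1 - kappa by rewrite subr_gt0.
elim: i => /= [|i IH]; first by rewrite addr0 divr_ge0// ltW.
apply: (le_trans (lerD (ler_wpM2l k0 IH) (h i))).
rewrite le_eqVlt; apply/orP; left; apply/eqP; field; exact: lt0r_neq0.
Qed.

(** Convexity of the square for the weights [kappa] and [1 - kappa] at the points [u] and
    [b / (1 - kappa)]. *)
Lemma geo_avg_sqr (kappa u b : R) : 0 <= kappa -> kappa < 1 ->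
  (kappa * u + b) ^+ 2 <= kappa * u ^+ 2 + (1 - kappa)^-1 * b ^+ 2.
Proof.
move=> k0 k1; have k1' : 0 < 1 - kappa by rewrite subr_gt0.
rewrite -subr_ge0 (_ : _ - _ = kappa / (1 - kappa) * ((1 - kappa) * u - b) ^+ 2).
  by rewrite mulr_ge0 ?sqr_ge0// divr_ge0// ltW.
field; exact: lt0r_neq0.
Qed.

Lemma geo_avg_measurable kappa (b : nat -> T -> R) i :
  (forall j, measurable_fun setT (b j)) ->
  measurable_fun setT (fun w => geo_avg kappa (b ^~ w) i).
Proof.
move=> mb; elim: i => [|i IH]; first exact: measurable_cst.
by apply: measurable_funD => //; exact: measurable_funM.
Qed.

Lemma Ele_geo_avg kappa (b : nat -> T -> R) s i : 0 <= kappa -> kappa < 1 ->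
  (forall j, measurable_fun setT (b j)) ->
  (forall j, Ele P (fun w => b j w ^+ 2) s) ->
  Ele P (fun w => geo_avg kappa (b ^~ w) i ^+ 2) (s / (1 - kappa) ^+ 2).
Proof.
move=> k0 k1 mb Hb; have k1' : 0 < 1 - kappa by rewrite subr_gt0.
have s0 := Ele_ge0 (Hb 0%N).
elim: i => [|i IH] /=.
  rewrite expr0n/=; apply: (Ele_weaken (Ele_cst P (lexx 0))).
  by rewrite divr_ge0// sqr_ge0.
have k1i : 0 <= (1 - kappa)^-1 by rewrite invr_ge0 ltW.
have := EleD (EleZ k0 IH) (EleZ k1i (Hb i)).
(* [s / (1 - kappa)^2] is the fixed point of the recursive bound. *)
rewrite [X in Ele _ _ X](_ : _ = s / (1 - kappa) ^+ 2); last by field; exact: lt0r_neq0.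
move=> H; apply: (Ele_le H).
- apply: measurable_funX; exact: (@geo_avg_measurable kappa b i.+1 mb).
- by move=> w; exact: sqr_ge0.
- by move=> w; exact: geo_avg_sqr.
Qed.

End geometric_average.

(** * Pathwise comparison of two contracting recursions *)

Section perturbed_recursion.
Context {R : realType}.
Variables (phi g : R -> nat -> R) (kappa r C : R).
Hypotheses (kappa_ge0 : 0 <= kappa) (r_ge0 : 0 <= r) (C_ge0 : 0 <= C).
Hypothesis phi_ge0 : forall x y, 0 <= x -> 0 <= phi x y.
Hypothesis g_ge0 : forall x y, 0 <= x -> 0 <= g x y.
Hypothesis phi_lip : forall x x' y, 0 <= x -> 0 <= x' ->
  `|phi x y - phi x' y| <= kappa * `|x - x'|.
Hypothesis g_lip : forall x x' y, 0 <= x -> 0 <= x' ->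
  `|g x y - g x' y| <= kappa * `|x - x'|.
Hypothesis near : forall x y, 0 <= x -> `|phi x y - g x y| <= r * (C * (x + y%:R + 1)).

Lemma foldl_ge0 (h : R -> nat -> R) x s : (forall x y, 0 <= x -> 0 <= h x y) ->
  0 <= x -> 0 <= foldl h x s.
Proof. by move=> h0; elim: s x => //= y s IH x x0; apply/IH/h0. Qed.

Lemma foldl_lip (h : R -> nat -> R) x x' s : (forall x y, 0 <= x -> 0 <= h x y) ->
  (forall x x' y, 0 <= x -> 0 <= x' -> `|h x y - h x' y| <= kappa * `|x - x'|) ->
  0 <= x -> 0 <= x' -> `|foldl h x s - foldl h x' s| <= kappa ^+ size s * `|x - x'|.
Proof.
move=> h0 hl; elim: s x x' => /= [|y s IH] x x' x0 x'0; first by rewrite expr0 mul1r.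
rewrite (le_trans (IH _ _ (h0 _ _ x0) (h0 _ _ x'0)))// exprSr -mulrA.
by rewrite ler_wpM2l ?exprn_ge0// hl.
Qed.

Lemma perturbed_step x x' y : 0 <= x -> 0 <= x' ->
  `|phi x y - g x' y| <= kappa * `|x - x'| + r * (C * (x' + y%:R + 1)).
Proof.
move=> x0 x'0; rewrite (le_trans (ler_distD (phi x' y) _ _))// lerD//.
  exact: phi_lip.
exact: near.
Qed.

Variables (X : nat -> R) (Y : nat -> nat) (lh : nat -> R).
Hypothesis X_ge0 : forall i, 0 <= X i.
Hypothesis XS : forall i, X i.+1 = g (X i) (Y i).
Hypothesis lh0_ge0 : 0 <= lh 0.
Hypothesis lhS : forall i, lh i.+1 = phi (lh i) (Y i).

Definition drift (j : nat) : R := C * (X j + (Y j)%:R + 1).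
Local Notation W := (geo_avg kappa drift).

Lemma lh_ge0 i : 0 <= lh i.
Proof. by elim: i => // i IH; rewrite lhS phi_ge0. Qed.

Lemma drift_ge0 j : 0 <= drift j.
Proof. by rewrite mulr_ge0// addr_ge0// addr_ge0// X_ge0. Qed.

Lemma drift_weight_ge0 i : 0 <= W i.
Proof. exact: geo_avg_ge0 kappa_ge0 drift_ge0. Qed.

Lemma lh_error i : `|lh i - X i| <= kappa ^+ i * `|lh 0 - X 0| + r * W i.
Proof.
elim: i => [|i IH]; first by rewrite expr0 mul1r mulr0 addr0.
rewrite lhS XS (le_trans (perturbed_step _ (lh_ge0 i) (X_ge0 i)))//=.
rewrite [r * (kappa * W i + _)]mulrDr addrA lerD2r exprS.
apply: (le_trans (ler_wpM2l kappa_ge0 IH)).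
by rewrite le_eqVlt; apply/orP; left; apply/eqP; ring.
Qed.

Definition window i k : seq nat := [seq Y j | j <- iota i k].

Lemma foldl_window (h : R -> nat -> R) (Z : nat -> R) i k :
  (forall j, Z j.+1 = h (Z j) (Y j)) -> foldl h (Z i) (window i k) = Z (i + k)%N.
Proof.
move=> ZS; elim: k i => [|k IH] i /=; first by rewrite addn0.
by rewrite -ZS IH addSnnS.
Qed.

(** Restarting [phi] at the true value [X i] removes the initial error; the drift accumulated since
    [i] is at most that accumulated since 0. *)
Lemma window_drift i k :
  `|foldl phi (X i) (window i k) - X (i + k)%N| <= r * W (i + k)%N.
Proof.
elim: k => [|k IH]; first by rewrite addn0 subrr normr0 mulr_ge0// drift_weight_ge0.
rewrite /window -addn1 iotaD map_cat foldl_cat /= addnA addn1 XS.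
have f0 : 0 <= foldl phi (X i) (window i k) by apply: foldl_ge0.
rewrite (le_trans (perturbed_step _ f0 (X_ge0 _)))//= [r * (kappa * W _ + _)]mulrDr lerD2r.
by rewrite (mulrCA r kappa) ler_wpM2l.
Qed.

Section cells.
Variables (q L k : nat) (K : R).
Hypothesis q_gt0 : (0 < q)%N.
Hypothesis kappa_le1 : kappa <= 1.
Hypothesis K_bound : forall x s, 0 <= x -> x <= L%:R -> size s = k ->
  (forall y, y \in s -> (y <= L)%N) -> `|foldl phi x s - foldl g x s| <= r * K.

(** A cell fixes the interval of length [1 / q] that contains the intensity at the start of a
    window, and the exact values of the [k] counts in it, all capped at [L]. *)
Definition cell := ('I_(L * q).+1 * k.-tuple 'I_L.+1)%type.

Definition in_cell (x : R) (s : seq nat) (c : cell) : bool :=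
  (Num.truncn (x * q%:R) == c.1 :> nat) && ([seq val j | j <- c.2] == s).

Definition off_cells (x : R) (s : seq nat) : bool := [forall c, ~~ in_cell x s c].

Lemma in_cell_unique x s c c' : in_cell x s c -> in_cell x s c' -> c = c'.
Proof.
case: c c' => [j u] [j' u'] /andP[/= /eqP h1 /eqP h2] /andP[/= /eqP h3 /eqP h4].
congr (_, _); first by apply: val_inj; rewrite /= -h1 -h3.
by apply: val_inj; apply: (inj_map val_inj); rewrite /= h2 h4.
Qed.

(** Evaluated at the left end point of the interval, so that it depends on [phi] but on nothing else
    in the sample once the cell is known. *)
Definition cell_value (c : cell) : R :=
  foldl phi (c.1%:R / q%:R) [seq val j | j <- c.2] - foldl g (c.1%:R / q%:R) [seq val j | j <- c.2].

Let qR : 0 < q%:R :> R. Proof. by rewrite ltr0n. Qed.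

Lemma cell_value_le c : `|cell_value c| <= r * K.
Proof.
apply: K_bound.
- by rewrite divr_ge0.
- rewrite ler_pdivrMr// -natrM ler_nat; exact: leq_ord.
- by rewrite size_map size_tuple.
- by move=> y /mapP[j _ ->]; exact: leq_ord.
Qed.

Lemma cell_value_near x s c : 0 <= x -> in_cell x s c ->
  `|foldl phi x s - foldl g x s - cell_value c| <= 2 / q%:R.
Proof.
move=> x0 /andP[/eqP jE /eqP sE]; rewrite /cell_value sE -jE.
set x' := _ / q%:R.
have xq0 : 0 <= x * q%:R by rewrite mulr_ge0.
have /andP[t1 t2] := archimedean.Num.Theory.truncn_itv xq0.
have x'0 : 0 <= x' by rewrite divr_ge0.
have d : `|x - x'| <= q%:R^-1.
  rewrite ler_norml; apply/andP; split.
    rewrite lerBrDr -lerBrDl opprK; apply: (@le_trans _ _ x); last by rewrite lerDl invr_ge0.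
    by rewrite ler_pdivrMr.
  rewrite lerBlDr -{1}[q%:R^-1]mul1r -mulrDl ler_pdivlMr// nat1r ltW//.
have l1 := foldl_lip s phi_ge0 phi_lip x0 x'0.
have l2 := foldl_lip s g_ge0 g_lip x0 x'0.
have ks : kappa ^+ size s * `|x - x'| <= q%:R^-1.
  by rewrite (le_trans _ d)// ler_piMl// exprn_ile1.
rewrite opprB addrACA [- _ + _]addrC.
rewrite (_ : _ + _ = (foldl phi x s - foldl phi x' s) - (foldl g x s - foldl g x' s)); last by ring.
rewrite (le_trans (ler_normB _ _))// mulr_natl mulr2n lerD//.
- exact: le_trans ks.
- exact: le_trans ks.
Qed.

Let eps i : R := (Y i)%:R - X i.

Definition cell_sum n (c : cell) : R :=
  \sum_(k <= i < n) eps i * (in_cell (X (i - k)) (window (i - k) k) c)%:R.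

(** The first line is the initial error. The second collects times without a full window, what is
    forgotten over [k] steps, and windows outside the cells. The third is rounding within a cell.
    Only the last uses cancellation: the sums of innovations in it do not involve [phi], which
    enters through [cell_value] alone. *)
Lemma cross_term_bound n :
  `|\sum_(0 <= i < n) eps i * (lh i - X i)| <=
    `|lh 0 - X 0| * (\sum_(0 <= i < n) kappa ^+ i * `|eps i|)
  + r * (\sum_(0 <= i < n) `|eps i| * ((i < k)%:R * W i + kappa ^+ k * W (i - k)
        + (off_cells (X (i - k)) (window (i - k) k))%:R * W i))
  + 2 / q%:R * (\sum_(0 <= i < n) `|eps i|)
  + r * K * (\sum_c `|cell_sum n c|).
Proof.
pose hit i c := in_cell (X (i - k)) (window (i - k) k) c.
pose G i := \sum_c (hit i c)%:R * cell_value c.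
have W0 := drift_weight_ge0.
have term i : `|eps i * (lh i - X i - (k <= i)%:R * G i)| <=
    `|lh 0 - X 0| * (kappa ^+ i * `|eps i|)
    + r * (`|eps i| * ((i < k)%:R * W i + kappa ^+ k * W (i - k)
        + (off_cells (X (i - k)) (window (i - k) k))%:R * W i))
    + 2 / q%:R * `|eps i|.
  set off := off_cells _ _; have e0 := normr_ge0 (eps i).
  have D0 := normr_ge0 (lh 0 - X 0).
  have ki0 : 0 <= kappa ^+ i by rewrite exprn_ge0.
  have kk0 : 0 <= kappa ^+ k by rewrite exprn_ge0.
  have q0 : 0 <= 2 / q%:R :> R by rewrite divr_ge0.
  rewrite normrM.
  rewrite (_ : _ + _ + _ = `|eps i| * (kappa ^+ i * `|lh 0 - X 0|
     + r * ((i < k)%:R * W i + kappa ^+ k * W (i - k) + off%:R * W i) + 2 / q%:R)); last by ring.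
  rewrite ler_wpM2l//; have [ik|ki] := ltnP i k.
    rewrite mul0r subr0 mul1r (le_trans (lh_error i))// -addrA lerD2l.
    rewrite -[leLHS]addr0 lerD// ler_wpM2l// -addrA lerDl.
    by rewrite addr_ge0// mulr_ge0.
  rewrite mul1r mul0r add0r.
  have iE : (i - k + k)%N = i by rewrite subnK.
  have ke : kappa ^+ i = kappa ^+ (i - k) * kappa ^+ k by rewrite -exprD iE.
  have lE : lh i = foldl phi (lh (i - k)) (window (i - k) k) by rewrite foldl_window ?iE.
  have XE : X i = foldl g (X (i - k)) (window (i - k) k) by rewrite foldl_window ?iE.
  have d1 : `|lh i - foldl phi (X (i - k)) (window (i - k) k)| <=
      kappa ^+ i * `|lh 0 - X 0| + r * (kappa ^+ k * W (i - k)).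
    rewrite lE (le_trans (foldl_lip _ phi_ge0 phi_lip (lh_ge0 _) (X_ge0 _)))//.
    rewrite size_map size_iota (le_trans (ler_wpM2l kk0 (lh_error _)))//.
    rewrite ke le_eqVlt; apply/orP; left; apply/eqP.
    by move: (kappa ^+ (i - k)) (kappa ^+ k) (W _) => u v z; ring.
  have d2 : `|foldl phi (X (i - k)) (window (i - k) k) - X i - G i| <=
      r * (off%:R * W i) + 2 / q%:R.
    have [offi|] := boolP off.
      rewrite /G big1 ?subr0; last first.
        by move=> c _; have /forallP/(_ c)/negbTE := offi; rewrite /hit => ->; rewrite mul0r.
      rewrite mul1r; have := window_drift (i - k) k; rewrite iE => /le_trans; apply.
      by rewrite lerDl.
    rewrite /off /off_cells negb_forall => /existsP[c]; rewrite negbK => hc.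
    rewrite /G (bigD1 c)//= {1}/hit hc mul1r big1 ?addr0; last first.
      move=> c' cc'; rewrite /hit; case: (boolP (in_cell _ _ c')); last by rewrite mul0r.
      by move=> /(in_cell_unique hc) E; rewrite E eqxx in cc'.
    rewrite XE (le_trans (cell_value_near (X_ge0 _) hc))// lerDr.
    by rewrite mulr_ge0// mulr_ge0.
  rewrite (_ : lh i - X i - G i = (lh i - foldl phi (X (i - k)) (window (i - k) k))
    + (foldl phi (X (i - k)) (window (i - k) k) - X i - G i)); last by ring.
  rewrite (le_trans (ler_normD _ _))//.
  apply: (le_trans (lerD d1 d2)).
  by rewrite le_eqVlt; apply/orP; left; apply/eqP; ring.
have -> : \sum_(0 <= i < n) eps i * (lh i - X i) =
   \sum_(0 <= i < n) eps i * (lh i - X i - (k <= i)%:R * G i) + \sum_c cell_value c * cell_sum n c.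
  have -> : \sum_c cell_value c * cell_sum n c = \sum_(0 <= i < n) eps i * ((k <= i)%:R * G i).
    rewrite /cell_sum.
    transitivity (\sum_c \sum_(0 <= i < n) cell_value c * ((k <= i)%:R * (eps i * (hit i c)%:R))).
      apply: eq_bigr => c _; rewrite -mulr_sumr; congr (_ * _).
      rewrite [RHS](bigID (fun i => (k <= i)%N))/= [X in _ + X]big1 ?addr0; last first.
        by move=> i /negbTE ->; rewrite mul0r.
      rewrite (big_nat_widenl k 0 n)//; apply: eq_bigr => i /andP[_ ->]; by rewrite mul1r.
    rewrite exchange_big/=; apply: eq_bigr => i _.
    rewrite /G !mulr_sumr; apply: eq_bigr => c _; ring.
  by rewrite -big_split/=; apply: eq_bigr => i _; rewrite -mulrDr subrK.
rewrite (le_trans (ler_normD _ _))// lerD//.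
  rewrite (le_trans (ler_norm_sum _ _ _))// !mulr_sumr -!big_split/=.
  by apply: ler_sum => i _; exact: term.
rewrite (le_trans (ler_norm_sum _ _ _))// mulr_sumr; apply: ler_sum => c _.
by rewrite normrM ler_wpM2r// cell_value_le.
Qed.

End cells.
End perturbed_recursion.

(** The point is the order of the quantifiers: [K] is chosen before [phi], which may depend on the
    sample. One step of [phi] is exchanged for one step of [g]; the error made is contracted by the
    remaining [k] steps. *)
Lemma foldl_perturbation_bound {R : realType} (g : R -> nat -> R) (kappa a C : R) (k : nat) :
  0 <= kappa -> 0 <= C -> 0 <= a ->
  (forall x y, 0 <= x -> 0 <= g x y <= a * (x + y%:R + 1)) ->
  forall L : R, exists2 K : R, 0 <= K & forall (phi : R -> nat -> R) r, 0 <= r ->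
    (forall x y, 0 <= x -> 0 <= phi x y) ->
    (forall x x' y, 0 <= x -> 0 <= x' -> `|phi x y - phi x' y| <= kappa * `|x - x'|) ->
    (forall x y, 0 <= x -> `|phi x y - g x y| <= r * (C * (x + y%:R + 1))) ->
    forall x s, 0 <= x -> x <= L -> size s = k -> (forall y, y \in s -> y%:R <= L) ->
      `|foldl phi x s - foldl g x s| <= r * K.
Proof.
move=> kappa0 C0 a0 ga; elim: k => [|k IH] L.
  exists 0 => // phi r r0 _ _ _ x s _ _ /size0nil -> _ /=.
  by rewrite subrr normr0 mulr0.
(* One step of [g] from a state and a count bounded by [L] leads to at most [a * (L + L + 1)], the
   new bound for the shorter window. *)
have [K K0 HK] := IH (Num.max L (a * (L + L + 1))).
exists (K + kappa ^+ k * (C * (Num.max L 0 + Num.max L 0 + 1))).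
  have m0 : 0 <= Num.max L 0 by rewrite le_max lexx orbT.
  by rewrite addr_ge0// mulr_ge0 ?exprn_ge0// mulr_ge0// addr_ge0// addr_ge0.
move=> phi r r0 phi0 phil near x [//|y s] x0 xL [sk] sL /=.
have yL : y%:R <= L by apply: sL; rewrite mem_head.
have /andP[g0 gle] := ga x y x0.
rewrite (le_trans (ler_distD (foldl phi (g x y) s) _ _))// mulrDr addrC lerD//.
  apply: HK => //.
    rewrite le_max; apply/orP; right; apply: (le_trans gle).
    by rewrite ler_wpM2l// lerD2r lerD.
  by move=> z zs; rewrite le_max sL// inE zs orbT.
rewrite (le_trans (foldl_lip kappa0 s phi0 phil (phi0 _ _ x0) g0))// sk mulrCA.
rewrite ler_wpM2l ?exprn_ge0// (le_trans (near _ _ x0))// ler_wpM2l// ler_wpM2l// lerD2r lerD//.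
- by rewrite le_max xL.
- by rewrite le_max yL.
Qed.

Lemma sum_ltn_le {R : realDomainType} n k : \sum_(0 <= i < n) ((i < k)%N%:R : R) <= k%:R.
Proof.
rewrite (_ : \sum_(0 <= i < n) _ = (minn n k)%:R) ?ler_nat ?geq_minr//.
elim: n => [|n IH]; first by rewrite big_geq// min0n.
rewrite big_nat_recr//= IH -natrD; congr (_%:R); lia.
Qed.

Lemma small_factor {R : realFieldType} (a eta : R) : 0 <= a -> 0 < eta ->
  exists2 b : R, 0 < b & b * a <= eta.
Proof.
move=> a0 e0; have a1 : 0 < a + 1 by rewrite ltr_wpDl.
exists (eta / (a + 1)); first exact: divr_gt0.
by rewrite -mulrA -[leRHS]mulr1 ler_pM2l// mulrC ler_pdivrMr// mul1r lerDl.
Qed.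

Lemma young_norm {R : realFieldType} (x u b : R) : 0 < b ->
  `|x| * u <= 2^-1 * (b * x ^+ 2 + b^-1 * u ^+ 2).
Proof.
move=> b0; rewrite -subr_ge0.
rewrite (_ : _ - _ = 2^-1 * b^-1 * (b * `|x| - u) ^+ 2).
  by rewrite mulr_ge0 ?sqr_ge0// mulr_ge0// invr_ge0 ltW.
rewrite -[x ^+ 2]real_normK ?num_real//; field; exact: lt0r_neq0.
Qed.

(** Chebyshev's inequality, pointwise: outside the cells the state is at least [L] or some count
    exceeds [L], so the sum of squares is at least [L^2]. The bound does not depend on the mesh. *)
Lemma off_cells_le {R : realType} (q L k : nat) (x : R) (s : seq nat) :
  (0 < q)%N -> (0 < L)%N -> 0 <= x -> size s = k ->
  (off_cells q L k x s)%:R <= L%:R ^- 2 * (x ^+ 2 + \sum_(y <- s) y%:R ^+ 2).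
Proof.
move=> q0 L0 x0 sk; set V := _ + _.
have LR : 0 < L%:R :> R by rewrite ltr0n.
have qR : 0 < q%:R :> R by rewrite ltr0n.
have S0 : 0 <= \sum_(y <- s) y%:R ^+ 2 :> R by apply: sumr_ge0 => y _; exact: sqr_ge0.
have V0 : 0 <= V by rewrite addr_ge0// sqr_ge0.
have [off|_] := boolP (off_cells q L k x s); last by rewrite mulr_ge0// invr_ge0 sqr_ge0.
rewrite mulrC ler_pdivlMr ?exprn_gt0// mul1r.
have [xL|Lx] := ltP x L%:R; last first.
  by rewrite (@le_trans _ _ (x ^+ 2))// ?ler_sqr ?nnegrE ?lerDl// ltW.
have [|/allPn[y ys yL]] := boolP (all (fun y => y <= L)%N s); last first.
  rewrite (@le_trans _ _ (y%:R ^+ 2))//.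
    by rewrite ler_sqr ?nnegrE// ler_nat ltnW// ltnNge.
  rewrite /V (big_rem y ys)/= addrCA lerDl addr_ge0 ?sqr_ge0//.
  by apply: sumr_ge0 => z _; exact: sqr_ge0.
move=> /allP sL; exfalso; move: off; rewrite /off_cells => /forallP off.
have xq : 0 <= x * q%:R by rewrite mulr_ge0.
have /andP[t1 _] := archimedean.Num.Theory.truncn_itv xq.
have tL : (Num.truncn (x * q%:R)%R < (L * q).+1)%N.
  by rewrite ltnS -(ler_nat R) natrM (le_trans t1)// ler_wpM2r ?ltW.
have us : size [seq inord y : 'I_L.+1 | y <- s] == k by rewrite size_map sk.
move: (off (Ordinal tL, Tuple us)); rewrite /in_cell /= eqxx /= => /negP; apply.
apply/eqP; rewrite -map_comp -[RHS]map_id; apply/eq_in_map => y ys /=.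
by rewrite inordK// ltnS sL.
Qed.

Lemma inv_nat_le {R : realType} (b : R) : 0 < b -> exists2 L, (0 < L)%N & L%:R^-1 <= b.
Proof.
move=> b0; have bi0 : 0 <= b^-1 by rewrite invr_ge0 ltW.
have /andP[_ h] := archimedean.Num.Theory.truncn_itv bi0.
exists (Num.truncn b^-1).+1 => //; rewrite -[leRHS]invrK lef_pV2 ?posrE ?invr_gt0 ?ltr0n//.
exact: ltW.
Qed.

Lemma inv_sqr_nat_le {R : realType} (b : R) : 0 < b -> exists2 L, (0 < L)%N & L%:R ^- 2 <= b.
Proof.
move=> b0; have [L L0 Lb] := inv_nat_le b0; exists L => //; apply: le_trans Lb.
have LR : 0 < L%:R :> R by rewrite ltr0n.
have L1 : L%:R^-1 <= 1 :> R by rewrite invf_le1// ler1n.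
by rewrite -exprVn expr2 ler_piMl// invr_ge0.
Qed.

Lemma div_nat_le {R : realType} (a e : R) : 0 <= a -> 0 < e ->
  \forall n \near \oo, n%:R^-1 * a <= e.
Proof.
move=> a0 e0; near=> n.
have n0 : 0 < n%:R :> R by rewrite ltr0n; near: n; exact: nbhs_infty_gt.
rewrite mulrC ler_pdivrMr// -ler_pdivrMl// mulrC; near: n; exact: nbhs_infty_ger.
Unshelve. all: by end_near. Qed.

Lemma geo_sum_le {R : realType} (k : R) n : 0 <= k -> k < 1 ->
  \sum_(0 <= i < n) k ^+ i <= (1 - k)^-1.
Proof.
move=> k0 k1; have k1' : 0 < 1 - k by rewrite subr_gt0.
rewrite -[leRHS]mul1r ler_pdivlMr// mulrC -(opprB k) mulNr big_mkord -subrX1 opprB.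
by rewrite gerBl exprn_ge0.
Qed.

Lemma inv_sqrt_le {R : realType} (a e : R) : 0 <= a -> 0 < e ->
  \forall n \near \oo, (Num.sqrt n%:R)^-1 * a <= e.
Proof.
move=> a0 e0; have [b b0 ba] := small_factor a0 e0.
have /cvgrPdist_le/(_ b b0) := @cvg_inv_sqrt R.
apply: filterS => n; rewrite sub0r normrN ger0_norm ?invr_ge0// => h.
by apply: le_trans ba; rewrite ler_wpM2r.
Qed.

Lemma card_cell q L k : #|{: cell q L k}| = ((L * q).+1 * L.+1 ^ k)%N.
Proof. by rewrite card_prod card_tuple !card_ord. Qed.

Lemma sum_norm_le {R : realFieldType} (I : finType) (A : I -> R) b : 0 < b ->
  \sum_i `|A i| <= 2^-1 * (b * (\sum_i A i ^+ 2) + b^-1 * #|I|%:R).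
Proof.
move=> b0; have -> : #|I|%:R = \sum_(i : I) 1 :> R by rewrite sumr_const.
rewrite !mulr_sumr -big_split/= mulr_sumr; apply: ler_sum => i _.
by have := young_norm (A i) 1 b0; rewrite expr1n mulr1.
Qed.

(** * Negligibility of the plug-in error *)

Section cross_terms.
Context {R : realType} {d : measure_display} {T : measurableType d}.
Variables (P : probability T R) (N : int -> T -> nat) (lam : int -> T -> R).
Variables (g0 : R -> nat -> R) (kappa1 kappa2 : R).
Hypothesis model : ingarch P N lam g0 kappa1 kappa2.

Let N_meas := ingarch_N_meas model.
Let lam_meas := ingarch_lam_meas model.
Let lam_ge0 := ingarch_lam_ge0 model.
Let kappa1_ge0 := ingarch_kappa1 model.
Let kappa2_ge0 := ingarch_kappa2 model.
Let kappa_lt1 := ingarch_kappa_lt1 model.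
Let g0_ge0 := ingarch_ge0 model.
Let g0_lip := ingarch_lip model.
Let lam_rec := ingarch_rec model.

Local Notation pmeas := (pmeas N lam).
Local Notation mu2 := (mean_sq_intensity P lam).
Variable C : R.
Hypothesis C_ge0 : 0 <= C.

(* Zero-based time: index [i] stands for time [i + 1]. *)
Definition lag_lam (w : T) (i : nat) : R := lam i.+1%:Z w.
Definition lag_N (w : T) (i : nat) : nat := N i.+1%:Z w.
Local Notation X := lag_lam.
Local Notation Y := lag_N.
Definition innovation (w : T) (i : nat) : R := (Y w i)%:R - X w i.
Local Notation eps := innovation.
Local Notation Z w := (drift C (X w) (Y w)).
Local Notation W w := (geo_avg kappa1 (Z w)).

Let kappa1_lt1 : kappa1 < 1.
Proof. by have := kappa_lt1; have := kappa2_ge0; lra. Qed.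

Let mu0 : 0 <= mu2. Proof. exact: mean_sq_intensity_ge0 model. Qed.

Lemma Ele_innovation2 i : Ele P (fun w => eps w i ^+ 2) (1 + mu2).
Proof. exact: (Ele_eps2 model i.+1%:Z). Qed.

Lemma innovation_measurable i : measurable_fun setT (eps ^~ i).
Proof.
apply: (pair_measurable model i.+1%:Z (h := fun x k => k%:R - x)) => k.
exact: measurable_funB.
Qed.

Lemma Ele_innovation i : Ele P (fun w => `|eps w i|) (2 + mu2).
Proof.
have [m _ _] := Ele_innovation2 i.
apply: (Ele_le (Ele_weaken (EleD (Ele_cst P ler01) (Ele_innovation2 i)) _)) => //.
- by rewrite addrA.
- by apply: measurableT_comp => //; exact: innovation_measurable.
move=> w; have := sqr_ge0 (`|eps w i| - 1); rewrite sqrrB1 real_normK ?num_real// => h.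
have := normr_ge0 (eps w i); lra.
Qed.

(** From [(x + y + 1)^2 <= 3 (x^2 + y^2 + 1)] and the second moments of intensity and count. *)
Definition drift_sq := 3 * C ^+ 2 * (1 + mu2 + mu2 + mu2 + 1).

Lemma drift_measurable i : measurable_fun setT (fun w => Z w i).
Proof.
apply: (pair_measurable model i.+1%:Z (h := fun x k => C * (x + k%:R + 1))) => k.
by apply: measurable_funM => //; apply: measurable_funD => //; exact: measurable_funD.
Qed.

Lemma Ele_linear2 t : Ele P (fun w => (C * (lam t w + (N t w)%:R + 1)) ^+ 2) drift_sq.
Proof.
have c0 : 0 <= 3 * C ^+ 2 by rewrite mulr_ge0// sqr_ge0.
have := EleZ c0 (EleD (EleD (Ele_N2 model t) (Ele_lam2 model t)) (Ele_cst P ler01)).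
move=> H; apply: (Ele_le H).
- apply: measurable_funX; apply: measurable_funM => //; apply: measurable_funD => //.
  apply: measurable_funD => //.
  by apply: (pair_measurable model t (h := fun _ k => k%:R)).
- by move=> w; exact: sqr_ge0.
move=> w; set x := lam t w; set y := (N t w)%:R.
rewrite exprMn [3 * _]mulrC -[leRHS]mulrA ler_wpM2l ?sqr_ge0//.
have := sqr_ge0 (x - y); have := sqr_ge0 (x - 1); have := sqr_ge0 (y - 1); nra.
Qed.

Lemma Ele_drift2 i : Ele P (fun w => Z w i ^+ 2) drift_sq.
Proof. exact: Ele_linear2. Qed.

(** Uniform square integrability of the drift: dominated convergence at time 0 supplies the level,
    and stationarity transfers it to all times. *)
Lemma drift_tail e : 0 < e -> exists2 B : R, 0 <= B & forall i,
  Ele P (fun w => Num.max (Z w i - B) 0 ^+ 2) e.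
Proof.
move=> e0.
pose h (n : nat) (x : R) (k : nat) := Num.max (C * (x + k%:R + 1) - n%:R) 0 ^+ 2.
have mh n k : measurable_fun setT (h n ^~ k).
  apply: measurable_funX; apply: measurable_maxr => //; apply: measurable_funB => //.
  by apply: measurable_funM => //; apply: measurable_funD => //; exact: measurable_funD.
have h0 n x k : 0 <= h n x k by exact: sqr_ge0.
have [] := @Ele_dominated _ _ _ P (fun w => (C * (lam 0 w + (N 0 w)%:R + 1)) ^+ 2) drift_sq
  (fun n w => h n (lam 0 w) (N 0 w)) _ _ _ _ e e0.
- exact: Ele_linear2.
- by move=> n; exact: (pair_measurable model).
- move=> n w; rewrite h0/= /h; set z := C * _.
  have z0 : 0 <= z by rewrite mulr_ge0// addr_ge0// addr_ge0// lam_ge0.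
  rewrite ler_sqr ?nnegrE// ?le_max ?lexx ?orbT// ge_max z0 andbT.
  by rewrite lerBlDr lerDl.
- move=> w; apply: cvg_near_cst; near=> n; rewrite /h max_r ?expr0n//.
  rewrite subr_le0; near: n; exact: nbhs_infty_ger.
move=> n _ /(_ n (leqnn n)) H; exists n%:R => // i.
exact: (Ele_stationary model i.+1%:Z (mh n) (h0 n) H).
Unshelve. all: by end_near. Qed.

Let v := 1 + mu2.
Let v0 : 0 <= v. Proof. by rewrite addr_ge0. Qed.

Definition drift_bound := drift_sq / (1 - kappa1) ^+ 2.

Lemma drift_sq_ge0 : 0 <= drift_sq. Proof. exact: Ele_ge0 (Ele_drift2 0). Qed.

Lemma drift_bound_ge0 : 0 <= drift_bound.
Proof. by rewrite divr_ge0 ?sqr_ge0// drift_sq_ge0. Qed.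

Lemma Ele_drift_weight2 i : Ele P (fun w => W w i ^+ 2) drift_bound.
Proof.
apply: (@Ele_geo_avg _ _ _ P kappa1 (fun j w => Z w j)) => // j.
- exact: drift_measurable.
- exact: Ele_drift2.
Qed.

Lemma drift_weight_measurable i : measurable_fun setT (fun w => W w i).
Proof. exact: (@geo_avg_measurable _ _ _ kappa1 (fun j w => Z w j) i drift_measurable). Qed.

Lemma Ele_product (u : T -> R) b s i : 0 < b -> measurable_fun setT u -> (forall w, 0 <= u w) ->
  Ele P (fun w => u w ^+ 2) s ->
  Ele P (fun w => `|eps w i| * u w) (2^-1 * (b * v + b^-1 * s)).
Proof.
move=> b0 mu u0 us; have b0' : 0 <= b^-1 by rewrite invr_ge0 ltW.
have h0 : 0 <= 2^-1 :> R by rewrite invr_ge0.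
apply: (Ele_le (EleZ h0 (EleD (EleZ (ltW b0) (Ele_innovation2 i)) (EleZ b0' us)))).
- apply: measurable_funM => //; apply: measurableT_comp => //; exact: innovation_measurable.
- by move=> w; rewrite mulr_ge0.
- by move=> w; exact: young_norm.
Qed.

Lemma Ele_window2 i k : Ele P (fun w => X w i ^+ 2 + \sum_(y <- window (Y w) i k) y%:R ^+ 2)
  (k.+1%:R * (v + mu2)).
Proof.
have EN : Ele P (fun w => \sum_(i <= j < i + k) (Y w j)%:R ^+ 2) (k%:R * (v + mu2)).
  rewrite -[k in k%:R](addKn i); apply: (@Ele_sum_nat _ _ _ P i (i + k)
    (fun j w => (Y w j)%:R ^+ 2)) => j _; exact: (Ele_N2 model j.+1%:Z).
have := EleD (Ele_lam2 model i.+1%:Z) EN.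
have -> : (fun w => lam i.+1%:Z w ^+ 2 + \sum_(i <= j < i + k) (Y w j)%:R ^+ 2) =
    fun w => X w i ^+ 2 + \sum_(y <- window (Y w) i k) y%:R ^+ 2.
  by apply/funext => w; rewrite /window big_map /index_iota addKn.
move=> H; apply: (Ele_weaken H); rewrite -natr1 mulrDl mul1r addrC lerD2l.
by rewrite lerDr.
Qed.

(** The factors [eps] and [W] have just two moments, so outside the cells [W] is split into a
    bounded part [B'] and a geometric average of drift tails that is small in mean square; on the
    bounded part the indicator is handled by Chebyshev. The choices are made in the order tail
    level, [k], [L]. *)
Lemma window_remainder_small eta : 0 < eta -> exists k, exists2 L, (0 < L)%N &
  \forall n \near \oo, exists2 B, Ele P B eta & forall q w, (0 < q)%N ->
   n%:R^-1 * (\sum_(0 <= i < n) `|eps w i| * ((i < k)%:R * W w i + kappa1 ^+ k * W w (i - k)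
        + (off_cells q L k (X w (i - k)) (window (Y w) (i - k) k))%:R * W w i)) <= B w.
Proof.
move=> eta0; have e5 : 0 < eta / 5 by rewrite divr_gt0.
have k10 : 0 < 1 - kappa1 by rewrite subr_gt0.
have [b b0 bv] := small_factor v0 e5.
have b0' : 0 <= b^-1 by rewrite invr_ge0 ltW.
have [tau tau0 btau] := small_factor b0' e5.
have tau1 : 0 < tau * (1 - kappa1) ^+ 2 by rewrite mulr_gt0// exprn_gt0.
have [B B0 HB] := drift_tail tau1.
pose tail w j := Num.max (Z w j - B) 0.
have mtail j : measurable_fun setT (tail ^~ j).
  by apply: measurable_maxr => //; apply: measurable_funB => //; exact: drift_measurable.
pose B' := B / (1 - kappa1).
have B'0 : 0 <= B' by rewrite divr_ge0// ltW.
have ET i : Ele P (fun w => geo_avg kappa1 (tail w) i ^+ 2) tau.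
  have := @Ele_geo_avg _ _ _ P kappa1 (fun j w => tail w j) _ i kappa1_ge0 kappa1_lt1 mtail HB.
  by rewrite mulfK// expf_neq0// gt_eqF.
have T0 i w : 0 <= geo_avg kappa1 (tail w) i.
  by apply: geo_avg_ge0 => // j; rewrite le_max lexx orbT.
have WT i w : W w i <= B' + geo_avg kappa1 (tail w) i.
  by apply: geo_avg_le => // j; rewrite -lerBlDl le_max lexx.
have W0 i w : 0 <= W w i.
  by apply: geo_avg_ge0 => // j; apply: drift_ge0 => // l; exact: lam_ge0.
pose c := 2^-1 * (1 * v + 1^-1 * drift_bound).
have c0 : 0 <= c.
  by rewrite mulr_ge0 ?invr_ge0// mul1r invr1 mul1r addr_ge0 ?drift_bound_ge0.
have [g g0' gc] := small_factor c0 e5.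
have [k kg] : exists k, kappa1 ^+ k <= g.
  have : \forall k \near \oo, `|0 - kappa1 ^+ k| <= g.
    have k1' : `|kappa1| < 1 by rewrite ger0_norm.
    by have /cvgrPdist_le/(_ g g0') := cvg_expr k1'.
  case=> k _ /(_ k (leqnn k)) h; exists k; apply: le_trans h.
  by rewrite sub0r normrN ler_norm.
have [b2 b20 b2v] := small_factor (mulr_ge0 B'0 v0) e5.
have b20' : 0 <= b2^-1 by rewrite invr_ge0 ltW.
pose m := k.+1%:R * (v + mu2).
have m0 : 0 <= m by rewrite mulr_ge0// addr_ge0.
have [l l0 lm] := small_factor (mulr_ge0 B'0 (mulr_ge0 b20' m0)) e5.
have [L L0 Ll] := inv_sqr_nat_le l0.
exists k, L => //.
pose V w i := X w (i - k) ^+ 2 + \sum_(y <- window (Y w) (i - k) k) y%:R ^+ 2.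
have h2 : 0 <= 2^-1 :> R by rewrite invr_ge0.
have L2 : 0 <= L%:R ^- 2 :> R by rewrite invr_ge0 sqr_ge0.
have kk0 : 0 <= kappa1 ^+ k by rewrite exprn_ge0.
pose U w i := (i < k)%:R * (`|eps w i| * W w i) + kappa1 ^+ k * (`|eps w i| * W w (i - k))
  + B' * (2^-1 * (b2 * eps w i ^+ 2 + b2^-1 * (L%:R ^- 2 * V w i)))
  + `|eps w i| * geo_avg kappa1 (tail w) i.
pose D := 2^-1 * (b * v + b^-1 * tau).
pose A := kappa1 ^+ k * c + B' * (2^-1 * (b2 * v + b2^-1 * (L%:R ^- 2 * m))) + D.
have EU i : Ele P (U ^~ i) ((i < k)%:R * c + A).
  rewrite /A !addrA; apply: EleD; [apply: EleD; [apply: EleD|]|].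
  - by apply: EleZ => //; apply: Ele_product => //; [exact: drift_weight_measurable|exact: Ele_drift_weight2].
  - by apply: EleZ => //; apply: Ele_product => //; [exact: drift_weight_measurable|exact: Ele_drift_weight2].
  - apply: EleZ => //; apply: EleZ => //; apply: EleD.
      by apply: (EleZ (ltW b20)); exact: Ele_innovation2.
    by apply: EleZ => //; apply: EleZ => //; exact: Ele_window2.
  - apply: Ele_product => //.
      exact: (@geo_avg_measurable _ _ _ kappa1 (fun j w => tail w j)).
have UB i q w : (0 < q)%N -> `|eps w i| * ((i < k)%:R * W w i + kappa1 ^+ k * W w (i - k)
        + (off_cells q L k (X w (i - k)) (window (Y w) (i - k) k))%:R * W w i) <= U w i.
  move=> q0; rewrite /U 2!mulrDr -!addrA.
  rewrite mulrCA lerD2l mulrCA lerD2l.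
  set off := off_cells _ _ _ _ _.
  have off0 : off%:R ^+ 2 <= L%:R ^- 2 * V w i.
    rewrite (_ : off%:R ^+ 2 = off%:R); last by case: off; rewrite ?expr1n ?expr0n.
    by apply: off_cells_le => //; [exact: lam_ge0|rewrite size_map size_iota].
  apply: (@le_trans _ _ (`|eps w i| * (off%:R * B' + geo_avg kappa1 (tail w) i))).
    rewrite ler_wpM2l// (le_trans (ler_wpM2l _ (WT i w)))// mulrDr lerD2l.
    by rewrite ler_piMl//; case: off {off0} => //=; rewrite lexx.
  rewrite mulrDr lerD2r mulrA mulrC ler_wpM2l//.
  rewrite (le_trans (young_norm _ _ b20))// ler_wpM2l// lerD2l ler_wpM2l//.
have kn : \forall n \near \oo, n%:R^-1 * (k%:R * c) <= eta / 5.
  by apply: div_nat_le => //; rewrite mulr_ge0.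
near=> n.
have n0 : (0 < n)%N by near: n; exact: nbhs_infty_gt.
have nR : 0 < n%:R :> R by rewrite ltr0n.
have n0' : 0 <= n%:R^-1 :> R by rewrite invr_ge0 ltW.
exists (fun w => n%:R^-1 * \sum_(0 <= i < n) U w i).
  have := EleZ n0' (@Ele_sum _ _ _ P _ (index_iota 0 n) xpredT (fun i w => U w i) _ (fun i _ => EU i)).
  move=> H; apply: (Ele_weaken H) => {H}.
  rewrite big_split/= -mulr_suml sumr_const_nat subn0 -[A *+ n]mulr_natl mulrDr mulKf ?gt_eqF//.
  have s1 : n%:R^-1 * ((\sum_(0 <= i < n) (i < k)%:R) * c) <= eta / 5.
    apply: (@le_trans _ _ (n%:R^-1 * (k%:R * c))); last by near: n.
    by rewrite ler_wpM2l// ler_wpM2r// sum_ltn_le.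
  have s2 : kappa1 ^+ k * c <= eta / 5 by apply: le_trans gc; rewrite ler_wpM2r.
  have s3 : B' * (2^-1 * (b2 * v + b2^-1 * (L%:R ^- 2 * m))) <= eta / 5.
    have : L%:R ^- 2 * (B' * (b2^-1 * m)) <= eta / 5.
      by apply: le_trans lm; apply: ler_wpM2r => //; do 2!rewrite mulr_ge0//.
    move: b2v; set x := L%:R ^- 2 => h1 h3.
    rewrite [leLHS](_ : _ = 2^-1 * (b2 * (B' * v) + x * (B' * (b2^-1 * m)))); last by ring.
    lra.
  have s4 : D <= eta / 5 by rewrite /D mulrC [b^-1 * _]mulrC; lra.
  rewrite /A; lra.
move=> q w q0; rewrite ler_wpM2l//; apply: ler_sum => i _; exact: UB.
Unshelve. all: by end_near. Qed.

(** Peels off the first count, which is why [H] is general. The window from [i] of length [k]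
    consists of [N (i + 1), ..., N (i + k)], hence the condition on [t]. *)
Lemma pmeas_window t (H : seq nat -> T -> R) i k : (forall s, pmeas t (H s)) ->
  (i + k)%N%:Z <= t -> pmeas t (fun w => H (window (Y w) i k) w).
Proof.
elim: k i H => [|k IH] i H mH ikt; first exact: mH.
have it : i.+1%:Z <= t.
  by apply: le_trans ikt; rewrite lez_nat addnS ltnS leq_addr.
have ikt' : (i.+1 + k)%N%:Z <= t by rewrite addSnnS.
have mH' y := IH i.+1 (fun s => H (y :: s)) (fun s => mH (y :: s)) ikt'.
have := @pmeas_switch _ _ _ N lam _ _ (fun y w => H (y :: window (Y w) i.+1 k) w) it mH'.
exact.
Qed.

Section cell_sums.
Variables (q L k : nat).
Implicit Types (c : cell q L k).

Let hit c (j : nat) (w : T) : R :=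
  (in_cell (X w (j.-1 - k)) (window (Y w) (j.-1 - k) k) c)%:R.

Let hit_sqr c j w : hit c j w ^+ 2 = hit c j w.
Proof. by rewrite /hit; case: in_cell; rewrite ?expr1n ?expr0n. Qed.

Let hit_ge0 c j w : 0 <= hit c j w.
Proof. by rewrite /hit ler0n. Qed.

Let sum_hit j w : \sum_c hit c j w <= 1.
Proof.
have [/existsP[c hc]|] := boolP [exists c : cell q L k,
    in_cell (X w (j.-1 - k)) (window (Y w) (j.-1 - k) k) c].
  rewrite (bigD1 c)//= big1 ?addr0 ?/hit ?hc// => c' cc'.
  rewrite /hit; case: (boolP (in_cell _ _ c')) => // hc'.
  by move/eqP: cc'; case; exact: in_cell_unique hc' hc.
rewrite negb_exists => /forallP h; rewrite big1// => c _.
by rewrite /hit (negbTE (h c)).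
Qed.

Let e c (j y : nat) (w : T) : R := (y%:R - lam j%:Z w) * hit c j w.

Let pmeas_hit c j : (k < j)%N -> pmeas (j%:Z - 1) (hit c j).
Proof.
move=> kj; pose j' := (j.-1 - k)%N.
have jE : j%:Z - 1 = (j' + k)%N%:Z.
  rewrite /j' subnK; last by rewrite -ltnS (ltn_predK kj).
  by rewrite -[in LHS](ltn_predK kj) -addn1 PoszD addrK.
pose h (s : seq nat) (x : R) : R :=
  \1_(`[c.1%:R, c.1.+1%:R[%classic) (x * q%:R) * ([seq val l | l <- c.2] == s)%:R.
have mh s : measurable_fun setT (h s).
  have m1 : measurable_fun setT (\1_(`[c.1%:R, c.1.+1%:R[%classic) : R -> R).
    by apply: measurable_indic; exact: measurable_itv.
  have m2 : measurable_fun setT (fun x : R => x * q%:R) by exact: measurable_funM.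
  apply: measurable_funM => //; exact: (measurableT_comp m1 m2).
rewrite (_ : hit c j = fun w => h (window (Y w) j' k) (X w j')); last first.
  apply/funext => w; rewrite /hit /in_cell /h -/j' indicE -natrM mulnb; congr (_%:R)%N.
  congr (nat_of_bool (_ && _)).
  have xq : 0 <= X w j' * q%:R by rewrite mulr_ge0// lam_ge0.
  apply/eqP/idP.
    by move=> <-; rewrite inE/= in_itv/=; exact: archimedean.Num.Theory.truncn_itv.
  by rewrite inE/= in_itv/= => h'; exact: archimedean.Num.Theory.truncn_def.
rewrite jE; apply: (@pmeas_window _ (fun s w => h s (X w j'))) => // s.
apply: (pmeas_comp (mh s)).
have le1 : j'.+1%:Z - 1 <= (j' + k)%N%:Z by rewrite -addn1 PoszD addrK lez_nat leq_addr.
apply: (@pmeas_mono _ _ _ N lam _ _ _ le1).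
exact: (@pmeas_lam_next _ _ _ _ _ _ _ _ _ model j'.+1%:Z).
Qed.

Lemma cell_sumE c n w : cell_sum (X w) (Y w) n c = mart N (e c) k.+1 n.+1 w.
Proof. by rewrite /mart big_add1. Qed.

(** Each cell sum is a martingale whose variance counts [lam j] only at the times spent in the cell.
    The cells being disjoint, these variances add up to at most the sum of the means of all [lam j],
    whatever the number of cells. *)
Lemma Ele_cell_sum2 n :
  Ele P (fun w => \sum_(c : cell q L k) cell_sum (X w) (Y w) n c ^+ 2) (n%:R * (1 + mu2)).
Proof.
have pe c j y : (k < j)%N -> pmeas (j%:Z - 1) (e c j y).
  move=> kj; apply: measurable_funM; last exact: pmeas_hit.
  apply: measurable_funB; first exact: measurable_cst.
  exact: (@pmeas_lam_next _ _ _ _ _ _ _ _ _ model j%:Z).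
have e0 c j w : (k < j)%N -> psum (lam j%:Z w) (e c j ^~ w) 0.
  move=> _; rewrite -(mulr0 (hit c j w)); apply: (eq_psum _ (@psumZ _ (hit c j w) _ _ _ (@psum_center _ (lam j%:Z w)))) => y.
  by rewrite /e mulrC.
have e2 c j w : (k < j)%N -> psum (lam j%:Z w) (fun y => e c j y w ^+ 2) (hit c j w * lam j%:Z w).
  move=> _; apply: (eq_psum _ (@psumZ _ (hit c j w) _ _ _ (@psum_variance _ (lam j%:Z w)))) => y.
  by rewrite /e exprMn hit_sqr mulrC.
have mA c : measurable_fun setT (fun w => cell_sum (X w) (Y w) n c ^+ 2).
  rewrite (_ : (fun w => _) = fun w => mart N (e c) k.+1 n.+1 w ^+ 2).
    by apply: measurable_funX; apply: (mart_measurable model) => j y; exact: pe.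
  by apply/funext => w; rewrite cell_sumE.
split.
- by apply: measurable_sum => c; exact: mA.
- by move=> w; apply: sumr_ge0 => c _; exact: sqr_ge0.
pose Q c w := \sum_(k.+1 <= j < n.+1) hit c j w * lam j%:Z w.
have Q0 c w : 0 <= Q c w by apply: sumr_ge0 => j _; rewrite mulr_ge0// lam_ge0.
have mQ c : measurable_fun setT (Q c).
  apply: measurable_sum_nat => j kj; apply: measurable_funM => //.
  exact: (@pmeas_measurable_fun _ _ _ _ _ _ _ _ _ model _ _ (@pmeas_hit c j kj)).
rewrite integral_sumE//; last by move=> c w; exact: sqr_ge0.
rewrite (eq_bigr (fun c => \int[P]_w (Q c w)%:E)%E); last first.
  move=> c _; rewrite -(mart_variance model (pe c) (e0 c) (e2 c)).
  by apply: eq_integral => w _; rewrite cell_sumE.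
rewrite -integral_sumE//.
have nk : (n.+1 - k.+1)%:R * (1 + mu2) <= n%:R * (1 + mu2).
  by rewrite ler_wpM2r// ler_nat subSS leq_subr.
have [m3 _ h3] : Ele P (fun w => \sum_(k.+1 <= j < n.+1) lam j%:Z w) (n%:R * (1 + mu2)).
  apply: (Ele_weaken _ nk); apply: (@Ele_sum_nat _ _ _ P _ _ (fun j w => lam j%:Z w)) => j _.
  exact: (Ele_lam model).
apply: le_trans h3; apply: le_integralE => //.
- by apply: measurable_sum => c; exact: mQ.
- by move=> w; apply: sumr_ge0 => c _.
move=> w; rewrite /Q exchange_big/=; apply: ler_sum => j _.
by rewrite -mulr_suml ler_piMl// lam_ge0.
Qed.

End cell_sums.

(** What the bounds use about the estimated recursion at a single sample point [w]; no measurability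
    in [w] is involved, so [phi] and [r] may be random in any way. *)
Record plug_in (phi : R -> nat -> R) (r : R) (w : T) (lh : nat -> R) : Prop := PlugIn {
  plug_in_radius : 0 <= r;
  plug_in_ge0 : forall x y, 0 <= x -> 0 <= phi x y;
  plug_in_lip : forall x x' y, 0 <= x -> 0 <= x' ->
    `|phi x y - phi x' y| <= kappa1 * `|x - x'|;
  plug_in_near : forall x y, 0 <= x -> `|phi x y - g0 x y| <= r * (C * (x + y%:R + 1));
  plug_in_init : 0 <= lh 0;
  plug_in_rec : forall i, lh i.+1 = phi (lh i) (Y w i) }.

Lemma lag_lam_rec w i : X w i.+1 = g0 (X w i) (Y w i).
Proof.
by rewrite /X /Y lam_rec (_ : i.+2%:Z - 1 = i.+1%:Z).
Qed.

Lemma g0_lip1 x x' y : `|g0 x y - g0 x' y| <= kappa1 * `|x - x'|.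
Proof. by have := g0_lip x x' y y; rewrite subrr normr0 mulr0 addr0. Qed.

Lemma g0_linear (x : R) y : 0 <= x -> 0 <= g0 x y <= Num.max (g0 0 0) 1 * (x + y%:R + 1).
Proof.
move=> x0; rewrite g0_ge0/=; have := g0_lip x 0 y 0.
rewrite !subr0 (ger0_norm x0) normr_nat => /(le_trans (ler_norm _)) h.
have k1 : kappa1 * x <= x by rewrite ler_piMl// ltW.
have k2 : kappa2 * y%:R <= y%:R :> R.
  by rewrite ler_piMl//; have := kappa_lt1; have := kappa1_ge0; lra.
have m1 : 1 <= Num.max (g0 0 0) 1 by rewrite le_max lexx orbT.
have m2 : g0 0 0 <= Num.max (g0 0 0) 1 by rewrite le_max lexx.
have xy0 : 0 <= x + y%:R by rewrite addr_ge0.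
have h3 : x + y%:R <= Num.max (g0 0 0) 1 * (x + y%:R) by rewrite ler_peMl.
 rewrite mulrDr mulr1; lra.
Qed.

(** The initial error contributes a convergent geometric series and [r^2 <= M^2 / n] multiplies a
    sum with mean of order [n]; the sum of squares is thus bounded in mean and the normalization
    makes it vanish. *)
Lemma plug_in_square_small (M B0 eta : R) : 0 <= M -> 0 <= B0 -> 0 < eta ->
  \forall n \near \oo, exists2 B, Ele P B eta & forall w phi r lh,
    plug_in phi r w lh -> Num.sqrt n%:R * r <= M -> `|lh 0 - X w 0| <= B0 ->
    (Num.sqrt n%:R)^-1 * \sum_(0 <= i < n) (lh i - X w i) ^+ 2 <= B w.
Proof.
move=> M0 B00 eta0; have k10 : 0 < 1 - kappa1 by rewrite subr_gt0.
pose A := 2 * B0 ^+ 2 / (1 - kappa1) + 2 * M ^+ 2 * drift_bound.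
have A1 : 0 <= 2 * B0 ^+ 2 / (1 - kappa1) by rewrite divr_ge0 ?(ltW k10)// mulr_ge0 ?sqr_ge0.
have A2 : 0 <= 2 * M ^+ 2 by rewrite mulr_ge0 ?sqr_ge0.
have A0 : 0 <= A by rewrite addr_ge0// mulr_ge0// drift_bound_ge0.
have := inv_sqrt_le A0 eta0; apply: filter_app; near=> n => nA.
have n0 : 0 < n%:R :> R by rewrite ltr0n; near: n; exact: nbhs_infty_gt.
have sn0 : 0 < Num.sqrt n%:R :> R by rewrite sqrtr_gt0.
have sni : 0 <= (Num.sqrt n%:R)^-1 :> R by rewrite invr_ge0 ltW.
have ni : 0 <= n%:R^-1 :> R by rewrite invr_ge0 ltW.
exists (fun w => (Num.sqrt n%:R)^-1 * (2 * B0 ^+ 2 / (1 - kappa1)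
   + 2 * M ^+ 2 * (n%:R^-1 * \sum_(0 <= i < n) W w i ^+ 2))).
  apply: (Ele_weaken _ nA); apply: EleZ => //; apply: EleD; first exact: Ele_cst.
  apply: EleZ => //; rewrite -[X in Ele P _ X](mulKf (lt0r_neq0 n0)); apply: EleZ => //.
  rewrite -[n in n%:R * _]subn0; apply: (@Ele_sum_nat _ _ _ P 0 n (fun i w => W w i ^+ 2)) => i _.
  exact: Ele_drift_weight2.
move=> w phi r lh H rM lB; rewrite ler_wpM2l//.
have r0 := plug_in_radius H.
have kk i : 0 <= kappa1 ^+ i by rewrite exprn_ge0.
have X0 i : 0 <= X w i by exact: lam_ge0.
have W0 i : 0 <= W w i by apply: geo_avg_ge0 => // j; exact: drift_ge0.
have r2 : r ^+ 2 <= M ^+ 2 * n%:R^-1.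
  rewrite ler_pdivlMr// mulrC -[X in X * _](sqr_sqrtr (ltW n0)) -exprMn ler_sqr ?nnegrE//.
  by rewrite mulr_ge0// ltW.
have S i : (lh i - X w i) ^+ 2 <= 2 * B0 ^+ 2 * kappa1 ^+ i + 2 * r ^+ 2 * W w i ^+ 2.
  have := lh_error kappa1_ge0 (plug_in_ge0 H) (plug_in_lip H) (plug_in_near H) X0
    (lag_lam_rec w) (plug_in_init H) (plug_in_rec H) i.
  move=> h; have h' : `|lh i - X w i| <= kappa1 ^+ i * B0 + r * W w i.
    by rewrite (le_trans h)// lerD2r ler_wpM2l.
  have k2 : (kappa1 ^+ i) ^+ 2 <= kappa1 ^+ i.
    by rewrite expr2 ler_piMl// exprn_ile1// ltW.
  have p0 : 0 <= kappa1 ^+ i * B0 by rewrite mulr_ge0.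
  have q0 : 0 <= r * W w i by rewrite mulr_ge0.
  rewrite -[leLHS]real_normK ?num_real//.
  apply: (@le_trans _ _ ((kappa1 ^+ i * B0 + r * W w i) ^+ 2)).
    by rewrite ler_sqr ?nnegrE// addr_ge0.
  apply: (@le_trans _ _ (2 * (kappa1 ^+ i * B0) ^+ 2 + 2 * (r * W w i) ^+ 2)).
    by rewrite -subr_ge0; have := sqr_ge0 (kappa1 ^+ i * B0 - r * W w i); lra.
  rewrite !exprMn; apply: lerD; last by rewrite mulrA.
  by rewrite [(kappa1 ^+ i) ^+ 2 * _]mulrC mulrA ler_wpM2l// mulr_ge0// sqr_ge0.
apply: (le_trans (ler_sum _ (fun i _ => S i))).
rewrite big_split/= -!mulr_sumr lerD//.
  by rewrite ler_wpM2l ?geo_sum_le// mulr_ge0// sqr_ge0.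
rewrite [leRHS]mulrA ler_wpM2r//; first by apply: sumr_ge0 => i _; exact: sqr_ge0.
by rewrite -mulrA ler_wpM2l.
Unshelve. all: by end_near. Qed.

(** At least [Q sqrt n], so that rounding [n] summands costs [2 / Q] times their mean size after
    normalization, while the number of cells remains of order [sqrt n]. *)
Definition grid (Q n : nat) : nat := (Q * (Num.truncn (Num.sqrt n%:R : R)).+1)%N.

Lemma grid_ge Q n : Q%:R * Num.sqrt n%:R <= (grid Q n)%:R :> R.
Proof.
rewrite /grid natrM ler_wpM2l//; apply: ltW.
by have /andP[] := archimedean.Num.Theory.truncn_itv (sqrtr_ge0 (n%:R : R)).
Qed.

Lemma card_grid_cell Q L k n : (0 < n)%N ->
  #|{: cell (grid Q n) L k}|%:R <= (L * Q).*2.+1%:R * L.+1%:R ^+ k * Num.sqrt n%:R :> R.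
Proof.
move=> n0; rewrite card_cell natrM natrX mulrAC ler_wpM2r ?exprn_ge0//.
(* As [sqrt n >= 1], the integer part plus one is at most [2 sqrt n]; this is the doubling of
   [L * Q]. *)
have s1 : 1 <= Num.sqrt n%:R :> R by rewrite -[leLHS]sqrtr1 ler_wsqrtr// ler1n.
have /andP[t1 _] := archimedean.Num.Theory.truncn_itv (sqrtr_ge0 (n%:R : R)).
rewrite /grid -natr1 -[_.*2.+1%:R]natr1 -muln2 mulnA !natrM -[_.+1%:R]natr1.
set l : R := L%:R; set p : R := Q%:R; set s := Num.sqrt n%:R.
rewrite mulrDl mul1r lerD// -[leRHS]mulrA ler_wpM2l ?mulr_ge0//.
by rewrite /s; lra.
Qed.

(* [phi] may depend on the whole sample; the bound [B] must not. *)
Lemma cross_term_small (M B0 eta : R) : 0 <= M -> 0 <= B0 -> 0 < eta ->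
  \forall n \near \oo, exists2 B, Ele P B eta & forall w phi r lh,
    plug_in phi r w lh -> Num.sqrt n%:R * r <= M -> `|lh 0 - X w 0| <= B0 ->
    `|(Num.sqrt n%:R)^-1 * \sum_(0 <= i < n) eps w i * (lh i - X w i)| <= B w.
Proof.
move=> M0 B00 eta0; have k10 : 0 < 1 - kappa1 by rewrite subr_gt0.
have e4 : 0 < eta / 4 by rewrite divr_gt0.
have e8 : 0 < eta / 8 by rewrite divr_gt0.
have [e1 e10 e1M] := small_factor M0 e4.
(* [k] and [L] come first because [K] and the number of cells depend on them. *)
have [k [L L0 Hrem]] := window_remainder_small e10.
have a0 : 0 <= Num.max (g0 0 0) 1 by rewrite le_max ler01 orbT.
have [K K0 HK] := foldl_perturbation_bound k kappa1_ge0 C_ge0 a0 g0_linear L%:R.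
have v2 : 0 <= 2 * (2 + mu2) by rewrite mulr_ge0// addr_ge0.
have [e2 e20 e2Q] := small_factor v2 e4.
have [Q Q0 Qe] := inv_nat_le e20.
have MK0 : 0 <= M * K by rewrite mulr_ge0.
(* The weight [b] of [sum_norm_le] can stay fixed in [n]: the squares of the cell sums contribute
   [b] times a constant, and the number of cells divided by [n] is of order [n^{-1/2}]. *)
have [b b0 bMK] := small_factor (mulr_ge0 MK0 v0) e8.
have b0' : 0 <= b^-1 by rewrite invr_ge0 ltW.
pose G := (L * Q).*2.+1%:R * L.+1%:R ^+ k : R.
have G0 : 0 <= G by rewrite mulr_ge0// exprn_ge0.
have A10 : 0 <= M * K * (b^-1 * G) by rewrite !mulr_ge0.
have A20 : 0 <= B0 * ((1 - kappa1)^-1 * (2 + mu2)).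
  by rewrite mulr_ge0// mulr_ge0 ?addr_ge0// invr_ge0 ltW.
have N1 := inv_sqrt_le A10 e8; have N2 := inv_sqrt_le A20 e4.
near=> n.
have n0 : (0 < n)%N by near: n; exact: nbhs_infty_gt.
have nR : 0 < n%:R :> R by rewrite ltr0n.
have sn0 : 0 < Num.sqrt n%:R :> R by rewrite sqrtr_gt0.
pose sn : R := (Num.sqrt n%:R)^-1.
have sni : 0 <= sn by rewrite invr_ge0 ltW.
have ni : 0 <= n%:R^-1 :> R by rewrite invr_ge0 ltW.
have snn : sn * sn = n%:R^-1 by rewrite /sn -expr2 exprVn sqr_sqrtr// ltW.
have nG : (Num.sqrt n%:R)^-1 * (M * K * (b^-1 * G)) <= eta / 8 by near: n.
have nB : (Num.sqrt n%:R)^-1 * (B0 * ((1 - kappa1)^-1 * (2 + mu2))) <= eta / 4 by near: n.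
have [Br EBr HBr] : exists2 B, Ele P B e1 & forall q w, (0 < q)%N ->
   n%:R^-1 * (\sum_(0 <= i < n) `|eps w i| * ((i < k)%:R * W w i + kappa1 ^+ k * W w (i - k)
        + (off_cells q L k (X w (i - k)) (window (Y w) (i - k) k))%:R * W w i)) <= B w.
  by near: n.
pose q := grid Q n.
have q0 : (0 < q)%N by rewrite /q /grid muln_gt0 Q0.
have QR : 0 < Q%:R :> R by rewrite ltr0n.
have qR : 0 < q%:R :> R by rewrite ltr0n.
have kk i : 0 <= kappa1 ^+ i by rewrite exprn_ge0.
pose S1 w := sn * (B0 * \sum_(0 <= i < n) kappa1 ^+ i * `|eps w i|).
pose S3 w := 2 / Q%:R * (n%:R^-1 * \sum_(0 <= i < n) `|eps w i|).
pose S4 w := M * K * (2^-1 * (b * (n%:R^-1 * \sum_c cell_sum (X w) (Y w) (q := q) (L := L) (k := k) n c ^+ 2)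
   + b^-1 * (sn * G))).
exists (fun w => S1 w + M * Br w + S3 w + S4 w).
  rewrite (_ : eta = eta / 4 + eta / 4 + eta / 4 + eta / 4); last by field.
  apply: EleD; [apply: EleD; [apply: EleD|]|].
  - apply: (Ele_weaken _ nB); apply: EleZ => //; apply: EleZ => //.
    have H := @Ele_sum _ _ _ P _ (index_iota 0 n) xpredT (fun i w => kappa1 ^+ i * `|eps w i|) _
      (fun i _ => EleZ (kk i) (Ele_innovation i)).
    apply: (Ele_weaken H); rewrite -mulr_suml ler_wpM2r ?geo_sum_le//.
    by rewrite addr_ge0.
  - by apply: (Ele_weaken (EleZ M0 EBr)); rewrite mulrC.
  - have Q2 : 0 <= 2 / Q%:R :> R by rewrite divr_ge0.
    have H := @Ele_sum_nat _ _ _ P 0 n (fun i w => `|eps w i|) _ (fun i _ => Ele_innovation i).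
    apply: (Ele_weaken (EleZ Q2 (EleZ ni H))); rewrite subn0 mulKf ?lt0r_neq0//.
    apply: le_trans e2Q; rewrite [2 / _]mulrC -mulrA ler_wpM2r//.
  - have h2 : 0 <= 2^-1 :> R by rewrite invr_ge0.
    have b1 : 0 <= b^-1 * (sn * G) by rewrite !mulr_ge0.
    have H := EleZ MK0 (EleZ h2 (EleD (EleZ (ltW b0) (EleZ ni (Ele_cell_sum2 q L k n))) (Ele_cst P b1))).
    apply: (Ele_weaken H); rewrite mulKf ?lt0r_neq0//.
    rewrite [leLHS](_ : _ = 2^-1 * (b * (M * K * v) + sn * (M * K * (b^-1 * G)))); last by rewrite /v; ring.
    move: bMK nG; rewrite -/sn; set u1 := b * _; set u2 := sn * _; lra.
move=> w phi r lh H rM lB.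
have r0 := plug_in_radius H.
have X0 i : 0 <= X w i by exact: lam_ge0.
have W0 i : 0 <= W w i by apply: geo_avg_ge0 => // j; exact: drift_ge0.
have KB x s : 0 <= x -> x <= L%:R -> size s = k -> (forall y, y \in s -> (y <= L)%N) ->
    `|foldl phi x s - foldl g0 x s| <= r * K.
  move=> x0 xL sk sL; apply: HK => //; [exact: plug_in_ge0 H|exact: plug_in_lip H|exact: plug_in_near H|].
  by move=> y ys; rewrite ler_nat sL.
have := cross_term_bound kappa1_ge0 r0 C_ge0 (plug_in_ge0 H) (fun x y _ => g0_ge0 x y) (plug_in_lip H)
    (fun x x' y _ _ => g0_lip1 x x' y) (plug_in_near H) X0 (lag_lam_rec w) (plug_in_init H) (plug_in_rec H)
    q0 (ltW kappa1_lt1) KB n.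
(* One factor [n^{-1/2}] is the normalization, the other the rate of the estimator. *)
have sr : sn * r <= M * n%:R^-1.
  by rewrite -snn mulrA [sn * r]mulrC ler_wpM2r// /sn ler_pdivlMr// mulrC.
move=> h; rewrite normrM (ger0_norm sni).
apply: (le_trans (ler_wpM2l sni h)); rewrite !mulrDr; apply: lerD; [apply: lerD; [apply: lerD|]|].
- rewrite ler_wpM2l// ler_wpM2r//; apply: sumr_ge0 => i _; exact: mulr_ge0.
- rewrite mulrA (le_trans (ler_wpM2r _ sr))//; last by rewrite -mulrA ler_wpM2l// HBr.
  apply: sumr_ge0 => i _; rewrite mulr_ge0// !addr_ge0// mulr_ge0//.
- rewrite /S3 !mulrA ler_wpM2r//; first exact: sumr_ge0.
  have qi : q%:R^-1 <= Q%:R^-1 * sn.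
    by rewrite /sn -invfM lef_pV2 ?posrE ?mulr_gt0// grid_ge.
  have := ler_wpM2l sni qi; rewrite mulrCA snn => h'.
  rewrite [leLHS](_ : _ = 2 * (sn * q%:R^-1)); last by ring.
  by rewrite -[leRHS]mulrA ler_pM2l.
- rewrite mulrA mulrA; apply: (le_trans (ler_wpM2r _ (ler_wpM2r K0 sr))); first exact: sumr_ge0.
  rewrite /S4 [M * _ * K]mulrAC -[leLHS]mulrA ler_wpM2l//.
  apply: (le_trans (ler_wpM2l ni (sum_norm_le (fun c => cell_sum (X w) (Y w) n c) b0))).
  rewrite mulrCA ler_wpM2l// mulrDr lerD//; first by rewrite mulrCA.
  rewrite mulrCA ler_wpM2l//.
  apply: (le_trans (ler_wpM2l ni (card_grid_cell Q L k n0))).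
  by rewrite -/G -snn -mulrA ler_wpM2l// mulrCA /sn mulVf ?mulr1// lt0r_neq0.
Unshelve. all: by end_near. Qed.

End cross_terms.

(** * Studentization *)

Section slutsky.
Context {R : realType} {d : measure_display} {T : measurableType d}.
Variable P : probability T R.
Variables (S D V : nat -> T -> R) (s : R).
Hypothesis s_gt0 : 0 < s.
Hypothesis S_clt : forall a e, 0 < e ->
  \forall n \near \oo, `|Ex P (\1_[set w | S n w <= a]) - Phi (a / s)| <= e.
Hypothesis D_small : forall delta e, 0 < delta -> 0 < e ->
  whp P delta (fun n w => `|D n w| <= e).
Hypothesis V_near : forall delta e, 0 < delta -> 0 < e ->
  whp P delta (fun n w => `|V n w - s ^+ 2| <= e).

Lemma sqrt_dist (v e : R) : `|v - s ^+ 2| <= e * s -> `|Num.sqrt v - s| <= e.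
Proof.
move=> h; have s1 : `|Num.sqrt v - s| * s <= `|v - s ^+ 2|.
  have [v0|v0] := leP 0 v.
    rewrite -[v in leRHS](sqr_sqrtr v0) subr_sqr normrM ler_wpM2l//.
    by apply: (le_trans _ (ler_norm _)); rewrite lerDr sqrtr_ge0.
  (* For [v < 0] the square root is 0 by convention, and [s^2 <= s^2 - v]. *)
  rewrite ler0_sqrtr ?(ltW v0)// sub0r normrN gtr0_norm// -expr2 distrC.
  by apply: (le_trans _ (ler_norm _)); rewrite lerDl oppr_ge0 ltW.
by rewrite -(ler_pM2r s_gt0) (le_trans s1).
Qed.

Lemma studentized_sandwich x delta rho : 0 < delta -> 0 < rho ->
  whp P delta (fun n w =>
    ((Num.sqrt (V n w))^-1 * (S n w + D n w) <= x -> S n w <= x * s + rho) /\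
    (S n w <= x * s - rho -> (Num.sqrt (V n w))^-1 * (S n w + D n w) <= x)).
Proof.
move=> d0 r0; have r2 : 0 < rho / 2 by rewrite divr_gt0.
have d2 : 0 < delta / 2 by rewrite divr_gt0.
have [b b0 bx] := small_factor (normr_ge0 x) r2.
(* [s / 2] keeps the random scale [q] positive, so that the inequality can be multiplied by it; [b]
   makes [x * q] close to [x * s]. *)
pose e := Num.min b (s / 2).
have e0 : 0 < e by rewrite lt_min b0 divr_gt0.
have := whpI (D_small d2 r2) (V_near d2 (mulr_gt0 e0 s_gt0)).
rewrite (_ : delta / 2 + delta / 2 = delta); last by field.
move=> H; apply: (whpS H); apply: nearW => n w [Dr /sqrt_dist Vs].
set q := Num.sqrt (V n w) in Vs *.
have es : e <= s / 2 by rewrite ge_min lexx orbT.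
have q0 : 0 < q.
  move: Vs; rewrite ler_norml => /andP[h _]; have := s_gt0; lra.
have xq : `|x * q - x * s| <= rho / 2.
  rewrite -mulrBr normrM mulrC (le_trans _ bx)// ler_wpM2r//.
  by rewrite (le_trans Vs)// ge_min lexx.
move: xq Dr; rewrite !ler_norml => /andP[h1 h2] /andP[h3 h4].
rewrite ler_pdivrMl// [q * x]mulrC; split; lra.
Qed.

Hypothesis S_meas : forall n, measurable_fun setT (S n).
Hypothesis D_meas : forall n, measurable_fun setT (D n).
Hypothesis V_meas : forall n, measurable_fun setT (V n).

Lemma studentized_measurable n :
  measurable_fun setT (fun w => (Num.sqrt (V n w))^-1 * (S n w + D n w)).
Proof.
apply: measurable_funM; last exact: measurable_funD.
exact: (measurableT_comp measurable_inv_sqrt (V_meas n)).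
Qed.

Lemma measurable_le_set (F : T -> R) x : measurable_fun setT F -> measurable [set w | F w <= x].
Proof.
move=> mF; rewrite (_ : [set w | _] = F @^-1` `]-oo, x]); last first.
  by apply/seteqP; split => w /=; rewrite in_itv.
by rewrite -[X in measurable X]setTI; apply: mF => //; exact: measurable_itv.
Qed.

Lemma studentized_clt x :
  (fun n => P [set w | (Num.sqrt (V n w))^-1 * (S n w + D n w) <= x]) @ \oo --> (Phi x)%:E.
Proof.
pose A n := [set w | (Num.sqrt (V n w))^-1 * (S n w + D n w) <= x].
have mA n : measurable (A n) by apply: measurable_le_set; exact: studentized_measurable.
rewrite (_ : (fun n => _) = fun n => (Ex P (\1_(A n)))%:E); last first.
  by apply/funext => n; rewrite -Ex_indic.
apply: cvg_EFin; first exact: nearW.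
apply/cvgrPdist_le => e e0.
have e3 : 0 < e / 3 by rewrite divr_gt0.
(* [Phi] is 16-Lipschitz, so a shift of [rho / s] changes it by at most [e / 3]. *)
pose rho := s * (e / 3 / 16).
have rho0 : 0 < rho by rewrite mulr_gt0// !divr_gt0.
have mS a n : measurable [set w | S n w <= a] by exact: measurable_le_set.
have Ph a : `|a - x * s| <= rho -> `|Phi (a / s) - Phi x| <= e / 3.
  move=> h; apply: (le_trans (Phi_lipschitz _ _)).
  rewrite (_ : a / s - x = (a - x * s) / s); last by field; exact: lt0r_neq0.
  have si : 0 < s^-1 by rewrite invr_gt0.
  rewrite normrM (gtr0_norm si).
  have : `|a - x * s| / s <= e / 3 / 16 by rewrite ler_pdivrMr// [leRHS]mulrC.
  lra.
have sand := studentized_sandwich x e3 rho0.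
have sand1 : whp P (e / 3) (fun n w => A n w -> [set w | S n w <= x * s + rho] w).
  by apply: (whpS sand); apply: nearW => n w [].
have sand2 : whp P (e / 3) (fun n w => [set w | S n w <= x * s - rho] w -> A n w).
  by apply: (whpS sand); apply: nearW => n w [].
have up := whp_measure_le mA (mS (x * s + rho)) sand1.
have lo := whp_measure_le (mS (x * s - rho)) mA sand2.
have P1 : `|Phi ((x * s + rho) / s) - Phi x| <= e / 3.
  by apply: Ph; rewrite addrC addKr gtr0_norm.
have P2 : `|Phi ((x * s - rho) / s) - Phi x| <= e / 3.
  by apply: Ph; rewrite addrC addKr normrN gtr0_norm.
near=> n.
have : (P (A n) <= P [set w | (S n w <= x * s + rho)%R] + (e / 3)%:E)%E by near: n.
have : (P [set w | (S n w <= x * s - rho)%R] <= P (A n) + (e / 3)%:E)%E by near: n.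
have : `|Ex P (\1_[set w | S n w <= x * s + rho]) - Phi ((x * s + rho) / s)| <= e / 3.
  by near: n; exact: S_clt.
have : `|Ex P (\1_[set w | S n w <= x * s - rho]) - Phi ((x * s - rho) / s)| <= e / 3.
  by near: n; exact: S_clt.
rewrite !Ex_indic// -!EFinD !lee_fin /=.
move: P1 P2; move: (Ex _ _) (Ex _ _) (Ex _ _) (Phi _) (Phi _) (Phi _) => p1 p2 p3 f1 f2 f3.
rewrite !ler_norml => /andP[? ?] /andP[? ?] /andP[? ?] /andP[? ?] ? ?.
apply/andP; split; lra.
Unshelve. all: by end_near. Qed.

End slutsky.

(** * The statistic with estimated intensities *)

Section plug_in_statistic.
Context {R : realType} {d : measure_display} {T : measurableType d}.
Variables (P : probability T R) (N : int -> T -> nat) (lam : int -> T -> R).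
Variables (g0 : R -> nat -> R) (kappa1 kappa2 : R).
Hypothesis model : ingarch P N lam g0 kappa1 kappa2.

Let lam_meas := ingarch_lam_meas model.

Local Notation mu2 := (mean_sq_intensity P lam).
Variables (C delta : R) (l1 : T -> R).
Hypotheses (C_ge0 : 0 <= C) (delta_gt0 : 0 < delta) (l1_meas : measurable_fun setT l1).
Variables (phi : nat -> T -> R -> nat -> R) (r : nat -> T -> R) (lh : nat -> T -> nat -> R).
Hypothesis lh_plug_in : forall n w, r n w <= delta ->
  plug_in N g0 kappa1 C (phi n w) (r n w) w (lh n w).
Hypothesis lh_init : forall n w, lh n w 0 = l1 w.
Hypothesis r_tight : forall e, 0 < e ->
  exists2 M : R, 0 <= M & whp P e (fun n w => Num.sqrt n%:R * r n w <= M).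
Local Notation X := (lag_lam lam).
Local Notation Y := (lag_N N).
Local Notation eps := (innovation N lam).

Definition deviation n w i := lh n w i - X w i.
Definition cross_term n w :=
  (Num.sqrt n%:R)^-1 * \sum_(0 <= i < n) eps w i * deviation n w i.
Definition square_term n w :=
  (Num.sqrt n%:R)^-1 * \sum_(0 <= i < n) deviation n w i ^+ 2.

Lemma sum_lag (F : R -> nat -> R) n w :
  \sum_(1 <= t < n.+1) F (lam t%:Z w) (N t%:Z w) = \sum_(0 <= i < n) F (X w i) (Y w i).
Proof. by rewrite big_add1. Qed.

Lemma whp_plug_in e : 0 < e -> exists M B0 : R, [/\ 0 <= M, 0 <= B0 &
  whp P e (fun n w => [/\ plug_in N g0 kappa1 C (phi n w) (r n w) w (lh n w),
    Num.sqrt n%:R * r n w <= M & `|lh n w 0 - X w 0| <= B0])].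
Proof.
move=> e0; have e2 : 0 < e / 2 by rewrite divr_gt0.
have [M M0 HM] := r_tight e2.
have [B B0 HB] := tight_random_variable P (measurable_funB l1_meas (lam_meas 1)) e2.
exists M, B; split => //; first exact: ltW.
have := whpI HM HB; rewrite (_ : e / 2 + e / 2 = e); last by field.
move=> H; apply: (whpS H).
have := inv_sqrt_le M0 delta_gt0; apply: filter_app; near=> n => nM w [rM l1B].
split => //; last by rewrite lh_init.
apply: lh_plug_in; apply: le_trans nM.
have sn0 : 0 < Num.sqrt n%:R :> R.
  by rewrite sqrtr_gt0 ltr0n; near: n; exact: nbhs_infty_gt.
by rewrite ler_pdivlMl.
Unshelve. all: by end_near. Qed.

Lemma deviation_terms_small e a : 0 < e -> 0 < a ->
  whp P e (fun n w => `|cross_term n w| <= a /\ square_term n w <= a).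
Proof.
move=> e0 a0; have e3 : 0 < e / 3 by rewrite divr_gt0.
have [M [B0 [M0 B00 H]]] := whp_plug_in e3.
have ea : 0 < e / 3 * a by rewrite mulr_gt0.
have c1 := cross_term_small model C_ge0 M0 B00 ea.
have c2 := plug_in_square_small model C_ge0 M0 B00 ea.
pose good n w := [/\ plug_in N g0 kappa1 C (phi n w) (r n w) w (lh n w),
    Num.sqrt n%:R * r n w <= M & `|lh n w 0 - X w 0| <= B0].
have w1 : whp P (e / 3) (fun n w => good n w -> `|cross_term n w| <= a).
  apply: filterS c1 => n [B EB HB]; have [A mA [PA AB]] := Ele_markov a0 EB.
  exists A => //; rewrite mulfK ?lt0r_neq0// in PA; split => // w nA [h1 h2 h3].
  by apply: le_trans (AB w nA); exact: HB h1 h2 h3.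
have w2 : whp P (e / 3) (fun n w => good n w -> square_term n w <= a).
  apply: filterS c2 => n [B EB HB]; have [A mA [PA AB]] := Ele_markov a0 EB.
  exists A => //; rewrite mulfK ?lt0r_neq0// in PA; split => // w nA [h1 h2 h3].
  by apply: le_trans (AB w nA); exact: HB h1 h2 h3.
have := whpI (whpI w1 w2) H; rewrite (_ : e / 3 + e / 3 + e / 3 = e); last by field.
by move=> G; apply: (whpS G); apply: nearW => n w [[h1 h2] h3]; split; [exact: h1|exact: h2].
Qed.

Lemma mean_sq_plug_in e a : 0 < e -> 0 < a ->
  whp P e (fun n w => `|2 / n%:R * (\sum_(0 <= i < n) lh n w i ^+ 2) - 2 * mu2| <= a).
Proof.
move=> e0 a0; have e2 : 0 < e / 2 by rewrite divr_gt0.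
have a8 : 0 < a / 8 by rewrite divr_gt0.
have m1 : 0 <= mu2 + 1 by rewrite addr_ge0// (mean_sq_intensity_ge0 model).
have [b b0 bm] := small_factor m1 a8.
have c0 : 0 < 1 + b^-1 by rewrite addr_gt0// invr_gt0.
have [h h0 hb] := small_factor (ltW c0) a8.
(* The entry 1 bounds the average of the squared intensities by [mu2 + 1]; the entry [a / 8] is the
   accuracy. *)
pose t := Num.min 1 (a / 8).
have t0 : 0 < t by rewrite lt_min ltr01.
have L := whp_markov t0 (law_of_large_numbers model (mulr_gt0 e2 t0)).
rewrite mulfK ?lt0r_neq0// in L.
have := whpI (deviation_terms_small e2 h0) L.
rewrite (_ : e / 2 + e / 2 = e); last by field.
move=> H; apply: (whpS H); near=> n => w [[_ sq] lln].
have n0 : (0 < n)%N by near: n; exact: nbhs_infty_gt.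
have nR : 0 < n%:R :> R by rewrite ltr0n.
have ni : 0 <= n%:R^-1 :> R by rewrite invr_ge0 ltW.
rewrite (sum_lag (fun x _ => x ^+ 2)) in lln.
set Sx := \sum_(0 <= i < n) _ in lln; set Sl := \sum_(0 <= i < n) _.
pose Sd := \sum_(0 <= i < n) deviation n w i ^+ 2.
have Sd0 : 0 <= Sd by apply: sumr_ge0 => i _; exact: sqr_ge0.
(* The bound on [square_term], which has the larger factor [n^{-1/2}], is more than enough. *)
have nSd : n%:R^-1 * Sd <= h.
  apply: le_trans sq; rewrite /square_term ler_wpM2r// lef_pV2 ?posrE ?sqrtr_gt0//.
  rewrite -[leRHS](sqr_sqrtr (ltW nR)) expr2 ler_peMl ?sqrtr_ge0//.
  by rewrite -[leLHS]sqrtr1 ler_wsqrtr// ler1n.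
(* From [l^2 - x^2 = (l - x)^2 + 2 (l - x) x] and Young's inequality with weight [b], which is small
   against the mean of [x^2]. *)
have dS : `|Sl - Sx| <= (1 + b^-1) * Sd + b * Sx.
  rewrite /Sl /Sx /Sd -sumrB !mulr_sumr -big_split/=.
  apply: (le_trans (ler_norm_sum _ _ _)); apply: ler_sum => i _.
  rewrite /deviation; set x := X w i; set l := lh n w i.
  have bi0 : 0 < b^-1 by rewrite invr_gt0.
  have := young_norm (l - x) `|x| bi0; rewrite invrK real_normK ?num_real// => y1.
  rewrite (_ : l ^+ 2 - x ^+ 2 = (l - x) ^+ 2 + 2 * ((l - x) * x)); last by ring.
  rewrite (le_trans (ler_normD _ _))// ger0_norm ?sqr_ge0// !normrM normr_nat.
  rewrite [(1 + _) * _]mulrDl mul1r -addrA lerD2l; lra.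
have tS : n%:R^-1 * Sx <= mu2 + 1.
  have t1 : t <= 1 by rewrite ge_min lexx.
  have := le_trans (ler_norm _) (le_trans lln t1); lra.
have ta : t <= a / 8 by rewrite ge_min lexx orbT.
have d2 : `|n%:R^-1 * Sl - n%:R^-1 * Sx| <= a / 8 + a / 8.
  rewrite -mulrBr normrM (ger0_norm ni) (le_trans (ler_wpM2l ni dS))// mulrDr lerD//.
    by rewrite mulrCA (le_trans (ler_wpM2l (ltW c0) nSd))// mulrC.
  by rewrite mulrCA (le_trans (ler_wpM2l (ltW b0) tS)).
have l2 := le_trans lln ta.
rewrite -mulrA; move: d2 l2; rewrite !ler_norml => /andP[? ?] /andP[? ?].
apply/andP; split; lra.
Unshelve. all: by end_near. Qed.

Hypothesis lh_meas : forall n i, measurable_fun setT (fun w => lh n w i).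
Hypothesis g00 : 0 < g0 0 0.

Definition perturbation n w := square_term n w - 2 * cross_term n w.
Definition mean_sq_hat n w := 2 / n%:R * \sum_(0 <= i < n) lh n w i ^+ 2.
Definition pearson_sum_hat n w :=
  (Num.sqrt n%:R)^-1 * \sum_(0 <= i < n) (((Y w i)%:R - lh n w i) ^+ 2 - (Y w i)%:R).

Lemma pearson_sum_hatE n w : pearson_sum_hat n w = pearson_sum N lam n w + perturbation n w.
Proof.
rewrite /pearson_sum (sum_lag (@pearson R)) /perturbation /square_term /cross_term.
rewrite mulrCA -mulrBr -mulrDr; congr (_ * _).
rewrite mulr_sumr -sumrB -big_split/=; apply: eq_bigr => i _.
by rewrite /pearson /deviation /innovation; ring.
Qed.

Lemma studentized_plug_in_clt x :
  (fun n => P [set w | (Num.sqrt (mean_sq_hat n w))^-1 * pearson_sum_hat n w <= x]) @ \oo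
    --> (Phi x)%:E.
Proof.
have mu0 := mean_sq_intensity_gt0 model g00.
have s0 : 0 < Num.sqrt (2 * mu2) by rewrite sqrtr_gt0 mulr_gt0.
rewrite (_ : (fun n => _) = fun n => P [set w |
    (Num.sqrt (mean_sq_hat n w))^-1 * (pearson_sum N lam n w + perturbation n w) <= x]); last first.
  by apply/funext => n; congr (P _); apply/seteqP; split => w /=; rewrite pearson_sum_hatE.
have mX i : measurable_fun setT (fun w => X w i) by exact: lam_meas.
have mdev n i : measurable_fun setT (fun w => deviation n w i) by exact: measurable_funB.
apply: (studentized_clt s0).
- by move=> a e e0; exact: (clt model a mu0 e0).
- move=> e a e0 a0; have a3 : 0 < a / 3 by rewrite divr_gt0.
  apply: (whpS (deviation_terms_small e0 a3)); apply: nearW => n w [c q].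
  have q0 : 0 <= square_term n w.
    by rewrite mulr_ge0 ?invr_ge0 ?sqrtr_ge0// sumr_ge0// => i _; exact: sqr_ge0.
  move: c; rewrite /perturbation !ler_norml => /andP[? ?]; apply/andP; split; lra.
- move=> e a e0 a0; rewrite sqr_sqrtr; first exact: mean_sq_plug_in.
  by rewrite mulr_ge0 // ltW.
- by move=> n; exact: (pearson_sum_measurable model).
- move=> n; apply: measurable_funB.
    by apply: measurable_funM => //; apply: measurable_sum => i; exact: measurable_funX.
  apply: measurable_funM => //; apply: measurable_funM => //.
  apply: measurable_sum => i; apply: measurable_funM => //.
  exact: (innovation_measurable model).
- move=> n; apply: measurable_funM => //; apply: measurable_sum => i; exact: measurable_funX.
Qed.

End plug_in_statistic.

(** * Norm of the estimation error and conclusion *)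

Section euclidean_norm.
Context {R : realType} {d : measure_display} {T : measurableType d} {dim : nat}.

Lemma eucl0 : eucl (0 : 'rV[R]_dim) = 0.
Proof. by rewrite /eucl big1 ?sqrtr0// => i _; rewrite mxE expr0n. Qed.

Lemma eucl_measurable (v : T -> 'rV[R]_dim) (c : 'rV[R]_dim) :
  (forall i, measurable_fun setT (fun w => v w ord0 i)) ->
  measurable_fun setT (fun w => eucl (v w - c)).
Proof.
move=> mv; have ms : measurable_fun setT (@Num.sqrt R).
  by apply: continuous_measurable_fun; exact: sqrt_continuous.
apply: (measurableT_comp ms); apply: measurable_sum => i; apply: measurable_funX.
rewrite (_ : (fun w => _) = fun w => v w ord0 i - c ord0 i).
  exact: measurable_funB.
by apply/funext => w; rewrite !mxE.
Qed.

End euclidean_norm.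

Theorem theorem4p5
  (R : realType) (d : measure_display) (T : measurableType d)
  (P : probability T R) (dim : nat)
  (Theta : set 'rV[R]_dim) (f : 'rV[R]_dim -> R -> nat -> R)
  (th0 : 'rV[R]_dim) (delta C kappa1 kappa2 : R)
  (N : int -> T -> nat) (lam : int -> T -> R)
  (thhat : nat -> T -> 'rV[R]_dim) (l1 : T -> R)
  (f_ge0 : forall th l y, th \in Theta -> 0 <= l -> 0 <= f th l y)
  (th0_in : th0 \in Theta)
  (delta_gt0 : 0 < delta) (kappa1_ge0 : 0 <= kappa1) (kappa2_ge0 : 0 <= kappa2)
  (kappa_lt1 : kappa1 + kappa2 < 1)
  (f_lip_theta : forall th l y, th \in Theta -> eucl (th - th0) <= delta ->
      0 <= l -> `|f th l y - f th0 l y| <= C * eucl (th - th0) * (l + y%:R + 1))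
  (f_contr : forall th l l' y y', th \in Theta -> eucl (th - th0) <= delta ->
      0 <= l -> 0 <= l' ->
      `|f th l y - f th l' y'| <= kappa1 * `|l - l'| + kappa2 * `|y%:R - y'%:R|)
  (N_meas : forall t k, measurable (N t @^-1` [set k]))
  (lam_meas : forall t, measurable_fun setT (lam t))
  (lam_ge0 : forall t w, 0 <= lam t w)
  (stat : strictly_stationary P N lam)
  (cpois : cond_poisson P N lam)
  (recursion : forall t w, lam t w = f th0 (lam (t - 1) w) (N (t - 1) w))
  (thhat_in : forall n w, thhat n w \in Theta)
  (thhat_meas : forall n i, measurable_fun setT (fun w => thhat n w ord0 i))
  (thhat_rate : root_n_tight P thhat th0)
  (l1_meas : measurable_fun setT l1) (l1_ge0 : forall w, 0 <= l1 w)
  (lamhat_meas : forall n t, measurable_fun setT (lamhat f thhat l1 N n t))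
  (f00_pos : 0 < f th0 0 0) :
  (forall x : R,
     (fun n => P [set w | Stat f thhat l1 N n w <= x]) @ \oo --> (Phi x)%:E) /\
  (forall alpha u : R, 0 < alpha < 1 -> Phi u = 1 - alpha ->
     (fun n => P [set w | test f thhat l1 N u n w = 1]) @ \oo --> alpha%:E).
Proof.
(* The assumptions on [f] concern nonnegative intensities only; composing with the positive part,
   which is 1-Lipschitz, gives a map on the whole line with the same constants. *)
pose g0 x k := f th0 (Num.max x 0) k.
have max_ge0 (x : R) : 0 <= Num.max x 0 by rewrite le_max lexx orbT.
have model : ingarch P N lam g0 kappa1 kappa2.
  split => //.
  - by move=> x y; exact: f_ge0.
  - move=> x x' y y'; apply: le_trans (f_contr _ _ _ _ _ th0_in _ (max_ge0 x) (max_ge0 x')) _.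
      by rewrite subrr eucl0 ltW.
    by rewrite lerD2r ler_wpM2l// max_lipschitz.
  - by move=> t w; rewrite /g0 max_l.
pose r n w := eucl (thhat n w - th0).
(* The sign of [C] is not prescribed, so [|C|] takes its place. Index [i] is shifted to time
   [i + 1], hence the initial value at [i = 0] is [l1]. *)
have plug n w : r n w <= delta -> plug_in N g0 kappa1 `|C| (f (thhat n w)) (r n w) w
    (fun i => lamhat f thhat l1 N n i.+1 w).
  move=> rd; split => //.
  - exact: sqrtr_ge0.
  - by move=> x y x0; exact: f_ge0.
  - move=> x x' y x0 x'0; apply: le_trans (f_contr _ _ _ _ _ _ rd x0 x'0) _ => //.
    by rewrite subrr normr0 mulr0 addr0.
  - move=> x y x0; rewrite /g0 max_l//; apply: le_trans (f_lip_theta _ _ _ _ rd x0) _ => //.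
    rewrite [leRHS]mulrA [r n w * _]mulrC ler_wpM2r ?addr_ge0//.
    by rewrite ler_wpM2r ?sqrtr_ge0// ler_norm.
have rtight e : 0 < e -> exists2 M : R, 0 <= M & whp P e (fun n w => Num.sqrt n%:R * r n w <= M).
  move=> e0; have [M [n0 HM]] := thhat_rate e e0.
  exists (Num.max M 0) => //; exists n0 => // n /= n0n.
  have mr : measurable_fun setT (fun w => Num.sqrt n%:R * r n w).
    by apply: measurable_funM => //; exact: eucl_measurable.
  exists (~` [set w | Num.sqrt n%:R * r n w <= M]).
    by apply: measurableC; exact: measurable_le_set.
  split; last by move=> w /contrapT /= h; rewrite le_max h.
  rewrite (_ : ~` _ = [set w | Num.sqrt n%:R * eucl (thhat n w - th0) > M]); first exact: HM.
  by apply/seteqP; split => w /=; [move/negP; rewrite -ltNge|move=> h; apply/negP; rewrite -ltNge].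
have main x : (fun n => P [set w | Stat f thhat l1 N n w <= x]) @ \oo --> (Phi x)%:E.
  have g00 : 0 < g0 0 0 by rewrite /g0 maxxx.
  have H := @studentized_plug_in_clt _ _ _ _ _ _ _ _ _ model `|C| delta l1 (normr_ge0 C)
    delta_gt0 l1_meas (fun n w => f (thhat n w)) r (fun n w i => lamhat f thhat l1 N n i.+1 w)
    plug (fun n w => erefl) rtight (fun n i => lamhat_meas n i.+1) g00 x.
  rewrite (_ : (fun n => _) = fun n => P [set w | (Num.sqrt (mean_sq_hat
    (fun n w i => lamhat f thhat l1 N n i.+1 w) n w))^-1 * pearson_sum_hat N
    (fun n w i => lamhat f thhat l1 N n i.+1 w) n w <= x]); first exact: H.
  apply/funext => n; congr (P _); apply/seteqP.
  by split => w; rewrite /= /Stat /That !big_add1.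
split => // alpha u alpha01 Pu.
have mS n : measurable [set w | Stat f thhat l1 N n w <= u].
  apply: measurable_le_set; apply: measurable_funM.
    apply: (measurableT_comp measurable_inv_sqrt); apply: measurable_funM => //.
    by apply: measurable_sum => t; exact: measurable_funX.
  have mN t : measurable_fun setT (fun w => (N t w)%:R : R).
    exact: (pair_measurable model t (h := fun _ k => k%:R)).
  apply: measurable_funM => //; apply: measurable_sum => t; apply: measurable_funB => //.
  by apply: measurable_funX; exact: measurable_funB.
(* The test takes the values 0 and 1, so rejection is the complement of the event in the
   distribution function at [u]. *)
rewrite (_ : (fun n => _) = fun n => (1 - P [set w | (Stat f thhat l1 N n w <= u)%R])%E).
  rewrite (_ : alpha%:E = (1 - (Phi u)%:E)%E); last by rewrite Pu -EFinB subKr.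
  by apply: cvgeB => //; exact: cvg_cst.
apply/funext => n; rewrite -probability_setC//; congr (P _).
apply/seteqP; split => w; rewrite /test /=; case: ltP => // _ /eqP.
by rewrite eq_sym oner_eq0.
Qed.
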